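(* Let $j : (R, \mathfrak{m}) \rightarrow (A, \mathfrak{n})$ be an algebra retract of Noetherian local rings with a section $p: (A, \mathfrak{n}) \rightarrow (R, \mathfrak{m})$. Let $M$ be a nonzero finitely generated $R$-module which is a Golod $A$-module when viewed as an $A$-module via the homomorphism $p$. Then $M$ is also a Golod $R$-module.
   Context: All rings are Noetherian local rings with $1\neq 0$, all modules are nonzero and finitely generated, and all homomorphisms of local rings are local. Algebra retract: a ring homomorphism $j:R\to A$ is an algebra retract if there is a ring homomorphism $p:A\to R$ with $p\circ j=\mathrm{id}_R$; such a $p$ is called a section of $j$. Golod modules: let $(R,\mathfrak m,k)$ be a local ring with residue field $k=R/\mathfrak m$ and $M$ an $R$-module. The Poincaré series of $M$ is $P^R_M(t)=\sum_{i\ge 0}\dim_k \operatorname{Tor}^R_i(k,M)\,t^i\in\mathbb Z[|t|]$. Let $K^R$ be the Koszul complex of $R$ on a minimal set of generators of $\mathfrak m$, $K^M=K^R\otimes_R M$, and $H_i(R)=H_i(K^R)$, $H_i(M)=H_i(K^M)$. The Koszul polynomials are $\kappa_R(t)=\sum_i\dim_k H_i(R)t^i$ and $\kappa^R_M(t)=\sum_i\dim_k H_i(M)t^i$. One always has the coefficientwise inequality $P^R_M(t)\le \frac{\kappa^R_M(t)}{1-t(\kappa_R(t)-1)}$; $M$ is called a Golod $R$-module if equality holds. *)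

(* Defs.v *)
From HB Require Import structures.
From mathcomp Require Import all_boot all_order all_algebra.
From mathcomp Require Import generic_quotient ring_quotient.

Set Implicit Arguments.
Unset Strict Implicit.
Unset Printing Implicit Defensive.

Import GRing.Theory.
Local Open Scope ring_scope.

Section NoetherianLocalRings.
Variable R : comNzRingType.

(* [idealr R] only contains proper ideals. *)
Definition maximal_ideal (I : idealr R) : Prop :=
  forall J : idealr R, {subset I <= J} -> {subset J <= I}.

Definition generated_by (I : {pred R}) n (x : 'I_n -> R) (J : {set 'I_n}) :=
  forall a, a \in I <-> exists c : 'I_n -> R, a = \sum_(i in J) c i * x i.

(* The unit ideal, not covered by [idealr R], is generated by 1. *)
Definition noetherian : Prop :=
  forall I : idealr R, exists n (x : 'I_n -> R), generated_by I x setT.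

Definition noetherian_local (m : idealr R) : Prop :=
  [/\ noetherian, maximal_ideal m
    & forall I : idealr R, maximal_ideal I -> I =i m].

Definition minimal_generators (I : {pred R}) n (x : 'I_n -> R) : Prop :=
  generated_by I x setT /\
  forall J : {set 'I_n}, generated_by I x J -> J = setT.

Definition fin_gen (M : lmodType R) : Prop :=
  exists n (e : 'I_n -> M), forall v, exists c : 'I_n -> R,
    v = \sum_i c i *: e i.

End NoetherianLocalRings.

Definition local_hom (R A : comNzRingType) (m : {pred R}) (n : {pred A})
  (f : R -> A) : Prop := forall a, a \in m -> f a \in n.

Section RestrictionOfScalars.
Variables (A R : comNzRingType) (p : {rmorphism A -> R}) (M : lmodType R).

Definition restrict_scalars (_ : {rmorphism A -> R}) : Type := M.

Local Notation Mp := (restrict_scalars p).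

HB.instance Definition _ := GRing.Zmodule.on Mp.

Definition restrict_scale (a : A) (v : Mp) : Mp := p a *: (v : M).

Fact restrict_scalerA a b v :
  restrict_scale a (restrict_scale b v) = restrict_scale (a * b) v.
Proof. by rewrite /restrict_scale scalerA rmorphM. Qed.

Fact restrict_scale1r : left_id 1 restrict_scale.
Proof. by move=> v; rewrite /restrict_scale rmorph1 scale1r. Qed.

Fact restrict_scalerDr : right_distributive restrict_scale +%R.
Proof. by move=> a u v; rewrite /restrict_scale scalerDr. Qed.

Fact restrict_scalerDl v : {morph restrict_scale^~ v : a b / a + b}.
Proof. by move=> a b; rewrite /restrict_scale rmorphD scalerDl. Qed.

HB.instance Definition _ := GRing.Zmodule_isLmodule.Build A Mp
  restrict_scalerA restrict_scale1r restrict_scalerDr restrict_scalerDl.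

End RestrictionOfScalars.

(* Complexes ... -> F_1 -> F_0 -> 0 of finite free modules: F_i has basis     *)
(* [fbasis i], and the basis element S of F_(i+1) is sent to                  *)
(* \sum_T fdiff S T *: T.                                                     *)
Record free_complex (R : comNzRingType) := FreeComplex {
  fbasis : nat -> finType;
  fdiff : forall i, fbasis i.+1 -> fbasis i -> R;
  fdiffK : forall i S U,
    \sum_(T : fbasis i.+1) fdiff S T * fdiff T U = 0
}.

Section Koszul.
Variables (R : comNzRingType) (n : nat) (x : 'I_n -> R).
Implicit Types S T U : {set 'I_n}.

Definition koszul_sign S (j : 'I_n) : R :=
  (-1) ^+ #|[set k in S | (k < j)%N]|.

(* The coefficient at e_T of the differential of e_S, where for               *)
(* S = {j_1 < ... < j_p} the exterior product e_S = e_(j_1) ^ ... ^ e_(j_p)   *)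
(* is sent to \sum_r (-1)^(r - 1) x_(j_r) e_(S minus j_r).                    *)
Definition koszul_coef S T : R :=
  \sum_(j in S | T == S :\ j) koszul_sign S j * x j.

Lemma koszul_signC S j k : j \in S -> k \in S -> (j < k)%N ->
  koszul_sign S j * koszul_sign (S :\ j) k =
  - (koszul_sign S k * koszul_sign (S :\ k) j).
Proof.
move=> jS kS ltjk; rewrite /koszul_sign.
have -> : [set l in S :\ k | (l < j)%N] = [set l in S | (l < j)%N].
  apply/setP=> l; rewrite !inE; case: (l =P k) => //= ->.
  by rewrite ltnNge (ltnW ltjk) andbF.
have -> : [set l in S :\ j | (l < k)%N] = [set l in S | (l < k)%N] :\ j.
  by apply/setP=> l; rewrite !inE andbA.
rewrite (cardsD1 j [set l in S | (l < k)%N]) inE jS ltjk /=.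
by rewrite exprS mulN1r mulNr opprK mulrC.
Qed.

Lemma koszul_coefK S U :
  \sum_(T : {set 'I_n}) koszul_coef S T * koszul_coef T U = 0.
Proof.
pose g (j k : 'I_n) : R :=
  if [&& j \in S, k \in S, k != j & U == S :\ j :\ k] then
    (koszul_sign S j * koszul_sign (S :\ j) k) * (x j * x k) else 0.
have gC (j k : 'I_n) : (j < k)%N -> g j k = - g k j.
  move=> ltjk; rewrite /g (_ : S :\ k :\ j = S :\ j :\ k); last first.
    by rewrite !setDDl setUC.
  rewrite (eq_sym j k) [in RHS]andbCA.
  case: ifP => [/and4P[jS kS _ _]|_]; last by rewrite oppr0.
  by rewrite koszul_signC // mulNr (mulrC (x j)).
have -> : \sum_(T : {set 'I_n}) koszul_coef S T * koszul_coef T U =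
    \sum_j \sum_k g j k.
  under eq_bigr => T _ do rewrite {1}/koszul_coef mulr_suml.
  rewrite (exchange_big_dep (mem S)) /=; last by move=> T j _ /andP[].
  rewrite [RHS](bigID (mem S)) /= [X in _ = _ + X]big1 ?addr0; last first.
    by move=> j /negPf jS; rewrite big1 // => k _; rewrite /g jS.
  apply: eq_bigr => j jS; rewrite jS /=.
  rewrite big_pred1_eq /koszul_coef mulr_sumr big_mkcond.
  apply: eq_bigr => k _; rewrite /g jS !inE -andbA andbCA.
  by case: ifP => // _; rewrite mulrACA.
have split3 j : \sum_k g j k =
    \sum_(k : 'I_n | (j < k)%N) g j k + \sum_(k : 'I_n | (k < j)%N) g j k.
  rewrite (bigID (fun k : 'I_n => (j < k)%N)) /=; congr (_ + _).
  rewrite (bigD1 j) ?ltnn //= {1}/g eqxx !andbF add0r.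
  apply: eq_bigl => k; rewrite -leqNgt [RHS]ltn_neqAle andbC; congr (_ && _).
under eq_bigr do rewrite split3.
rewrite big_split /=; apply/eqP; rewrite addr_eq0; apply/eqP.
rewrite -sumrN (exchange_big_dep xpredT) //=; apply: eq_bigr => j _.
by rewrite -sumrN; apply: eq_bigr => k ltkj; rewrite gC.
Qed.

Definition koszul_basis i : finType := {S : {set 'I_n} | #|S| == i}.

Definition koszul_diff i (S : koszul_basis i.+1) (T : koszul_basis i) : R :=
  koszul_coef (val S) (val T).

Fact koszul_diffK i (S : koszul_basis i.+2) (U : koszul_basis i) :
  \sum_(T : koszul_basis i.+1) koszul_diff S T * koszul_diff T U = 0.
Proof.
rewrite -[RHS](koszul_coefK (val S) (val U)).
rewrite [RHS](bigID (fun T : {set 'I_n} => #|T| == i.+1)) /=.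
rewrite [X in _ = _ + X]big1 ?addr0; last first.
  move=> T cardT; rewrite {1}/koszul_coef big1 ?mul0r // => j /andP[jS /eqP eT].
  by move: (valP S) cardT; rewrite (cardsD1 j) jS eqSS eT => ->.
symmetry; exact: (big_sub [pred T : {set 'I_n} | #|T| == i.+1]
  (fun T => koszul_coef (val S) T * koszul_coef T (val U))).
Qed.

Definition koszul : free_complex R := FreeComplex koszul_diffK.

End Koszul.

Section TensorHomology.
Variables (R : comNzRingType) (F : free_complex R) (M : lmodType R).

(* (F (x) M)_i, with F_i (x) M identified with the sum of copies of M indexed *)
(* by the basis of F_i.                                                       *)
Definition tens i := {ffun fbasis F i -> M}.

Definition tens_diff i (u : tens i.+1) : tens i :=
  [ffun T => \sum_S fdiff S T *: u S].

Definition tens_boundary i (v : tens i) : Prop :=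
  exists u : tens i.+1, v = tens_diff u.

Definition tens_cycle i : tens i -> Prop :=
  match i with
  | 0 => fun=> True
  | _.+1 => fun u => tens_diff u = 0
  end.

End TensorHomology.

(* For Z and B submodules of V: Z / B is killed by m and has dimension d over *)
(* R / m; e represents a basis, and an R / m-linear relation lifts to R.      *)
Definition subquotient_dim (R : comNzRingType) (m : {pred R}) (V : lmodType R)
    (Z B : V -> Prop) (d : nat) : Prop :=
  (forall a z, a \in m -> Z z -> B (a *: z)) /\
  exists e : 'I_d -> V,
    [/\ forall i, Z (e i),
        forall z, Z z -> exists c : 'I_d -> R, B (z - \sum_i c i *: e i)
      & forall c : 'I_d -> R, B (\sum_i c i *: e i) -> forall i, c i \in m].

Definition homology_dim (R : comNzRingType) (m : {pred R})
    (F : free_complex R) (M : lmodType R) (i d : nat) : Prop :=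
  subquotient_dim m (@tens_cycle R F M i) (@tens_boundary R F M i) d.

Section Golod.
Variables (R : comNzRingType) (m : idealr R).

Local Notation k := {ideal_quot m}.

(* R acts on k through the projection \pi : R -> k.                           *)
Definition residue_resolution (F : free_complex R) : Prop :=
  (forall i (u : tens F R^o i.+1),
     tens_cycle u -> tens_boundary u) /\
  exists eps : {linear tens F R^o 0 -> k | (\pi_k)%qT \; *%R},
    (forall y : k, exists u, eps u = y) /\
    (forall u, eps u = 0 <-> tens_boundary u).

(* b i = dim_k Tor_i(k, M), the i-th coefficient of the Poincare series of M. *)
Definition poincare_series (M : lmodType R) (b : nat -> nat) : Prop :=
  exists2 F, residue_resolution F & forall i, homology_dim m F M i (b i).

End Golod.

(* Elements of Z[[t]], as coefficient sequences.                              *)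
Definition series := nat -> int.

Definition series_mul (f g : series) : series :=
  fun n => \sum_(i < n.+1) f i * g (n - i)%N.

Definition series_one : series := fun n => (n == 0)%N%:R.

Definition series_sub (f g : series) : series := fun n => f n - g n.

Definition series_mulX (f : series) : series :=
  fun n => if n is n'.+1 then f n' else 0.

Definition series_nat (b : nat -> nat) : series := fun n => (b n)%:Z.

(* P = kM / (1 - t (kR - 1)): the denominator has constant coefficient 1, so  *)
(* the quotient is the only series P whose product with it is kM.             *)
Definition golod_module (R : comNzRingType) (m : idealr R) (M : lmodType R) :=
  exists n (x : 'I_n -> R) (P kR kM : nat -> nat),
    [/\ minimal_generators m x,
        poincare_series m M P,
        forall i, homology_dim m (koszul x) R^o i (kR i),
        forall i, homology_dim m (koszul x) M i (kM i)
      & series_mul (series_nat P)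
          (series_sub series_one
             (series_mulX (series_sub (series_nat kR) series_one)))
        =1 series_nat kM].

(* Main.v *)
Require Import Defs.
From HB Require Import structures.
From mathcomp Require Import all_boot all_algebra.
From mathcomp Require Import generic_quotient ring_quotient.
From mathcomp Require Import ring boolp functions.

(** Let [K] be the Koszul complex of [R], an exterior algebra, and let the letters
be cycles that represent a basis of its homology in positive degrees. Golod's
construction gives a free resolution [F] of the residue field, whether or not [R]
is a Golod ring: as a [K]-module, [F] is free on the words in the letters, and the
word [h :: v] is adjoined to kill a cycle with leading term [lz h (x) v]
([new_generator], [twist_exists], [golod_resolution]). It is filtered by the
length of words; each quotient of the filtration is a direct sum of copies of [K].

After tensoring with [M], the homology of the quotients has in each degree a total
dimension equal to the coefficient of the Golod bound ([total_recursion]). Hence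
the homology of [F (x) M] reaches the bound if and only if every cycle of every
quotient lifts to a cycle of [F (x) M] ([lifting_of_golod], [golod_of_lifting];
[tor_indep] lets the Poincare series be computed with [F]). As the differential
of [z (x) v] is up to sign the product of [z] with the differential of [v], lifting
means that the products of the Koszul cycles of [M] with the cycles of each stage
[F^k] that are killed in the next one bound in [F^k (x) M] ([bounding_of_lifting],
[lifting_of_bounding]).

This last condition passes from [A] to [R] ([bounding_descent]). For suitable
generators the composite of the maps of Koszul complexes from [R] to [A] and back
is the identity ([retract_matrices]), so that the Koszul cycles of [M] come from
[A]. The map from [K] over [A] to [K] over [R] extends to the stages of the two
resolutions ([filtered_map_extend]), and by induction this extension is onto on
the homology that is killed in the next stage ([onto_step]). Thus both factors of
a product over [R] lift to [A], where the product bounds, and the bounding chain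
can be mapped back to [R]. *)

Set Implicit Arguments.
Unset Strict Implicit.
Unset Printing Implicit Defensive.

Import GRing.Theory.
Local Open Scope ring_scope.

(** * The Koszul algebra and its modules *)

(** All exterior degrees at once: [a] stands for [\sum_S e_S (x) a S]. *)
Notation kos n M := {ffun {set 'I_n} -> M}.

Section KoszulModule.
Variables (R : comNzRingType) (n : nat) (M : lmodType R).
Implicit Types (S T : {set 'I_n}) (i j k : 'I_n) (a b : kos n M).

Definition kone (m : M) : kos n M := [ffun S => if S == set0 then m else 0].

Definition kdelta S (m : M) : kos n M := [ffun T => if T == S then m else 0].

Definition kgrade a : kos n M := [ffun S : {set 'I_n} => (-1) ^+ #|S| *: a S].

Definition kleft j a : kos n M :=
  [ffun S : {set 'I_n} => if j \in S then koszul_sign R S j *: a (S :\ j) else 0].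

(** The product [a ^ e_j], which is [(-1)^|a| e_j ^ a]. *)
Definition kright j a : kos n M := kleft j (kgrade a).

Definition kdiff (x : 'I_n -> R) a : kos n M :=
  [ffun T => \sum_S koszul_coef x S T *: a S].

Fact kone_is_zmod_morphism : zmod_morphism kone.
Proof. by move=> u v; apply/ffunP=> S; rewrite !ffunE; case: ifP; rewrite ?subr0. Qed.
HB.instance Definition _ := GRing.isZmodMorphism.Build M (kos n M) kone
  kone_is_zmod_morphism.
Fact kone_is_scalable : scalable kone.
Proof. by move=> c v; apply/ffunP=> S; rewrite !ffunE; case: ifP; rewrite ?scaler0. Qed.
HB.instance Definition _ := GRing.isScalable.Build R M (kos n M) *:%R kone
  kone_is_scalable.

Fact kgrade_is_linear : linear kgrade.
Proof.
by move=> c a b; apply/ffunP=> S; rewrite !ffunE scalerDr !scalerA mulrC.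
Qed.
HB.instance Definition _ := GRing.isLinear.Build R (kos n M) (kos n M) *:%R kgrade
  kgrade_is_linear.

Fact kleft_is_linear j : linear (kleft j).
Proof.
move=> c a b; apply/ffunP=> S; rewrite !ffunE; case: ifP => _.
  by rewrite scalerDr !scalerA mulrC.
by rewrite scaler0 addr0.
Qed.
HB.instance Definition _ j := GRing.isLinear.Build R (kos n M) (kos n M) *:%R (kleft j)
  (kleft_is_linear j).
HB.instance Definition _ j := GRing.Linear.copy (kright j) (kleft j \o kgrade).

Fact kdiff_is_linear x : linear (kdiff x).
Proof.
move=> c a b; apply/ffunP=> T; rewrite !ffunE scaler_sumr -big_split /=.
by apply: eq_bigr => S _; rewrite !ffunE scalerDr !scalerA mulrC.
Qed.
HB.instance Definition _ x := GRing.isLinear.Build R (kos n M) (kos n M) *:%R (kdiff x)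
  (kdiff_is_linear x).

Lemma kgradeK : involutive kgrade.
Proof. by move=> a; apply/ffunP=> S; rewrite !ffunE scalerA -expr2 sqrr_sign scale1r. Qed.

Lemma kgrade_one m : kgrade (kone m) = kone m.
Proof.
apply/ffunP=> S; rewrite !ffunE; case: eqP => [->|]; last by rewrite scaler0.
by rewrite cards0 scale1r.
Qed.

Lemma kgrade_left j a : kgrade (kleft j a) = - kleft j (kgrade a).
Proof.
apply/ffunP=> S; rewrite !ffunE; case: ifP => [jS|]; last by rewrite scaler0 oppr0.
by rewrite (cardsD1 j S) jS exprS mulN1r scaleNr !scalerA mulrC.
Qed.

Lemma kgrade_right j a : kgrade (kright j a) = - kright j (kgrade a).
Proof. exact: kgrade_left. Qed.

Lemma kleft_sq j a : kleft j (kleft j a) = 0.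
Proof.
by apply/ffunP=> S; rewrite !ffunE !inE eqxx /= scaler0; case: ifP.
Qed.

Lemma kleftC i j a : kleft i (kleft j a) = - kleft j (kleft i a).
Proof.
wlog ij : i j / (i < j)%N => [hw|].
  case: (ltngtP i j) => [/hw //|/hw ->|/val_inj ->]; first by rewrite opprK.
  by rewrite kleft_sq oppr0.
apply/ffunP=> S; rewrite !ffunE !inE.
have nij : i != j by apply: contraTneq ij => ->; rewrite ltnn.
rewrite (eq_sym j i) nij /=.
case iS: (i \in S); case jS: (j \in S); rewrite ?scaler0 ?oppr0 //.
by rewrite !scalerA koszul_signC // scaleNr !setDDl (setUC [set j]).
Qed.

Lemma kright_sq j a : kright j (kright j a) = 0.
Proof. by rewrite /kright kgrade_left linearN /= kleft_sq oppr0. Qed.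

Lemma krightC i j a : kright i (kright j a) = - kright j (kright i a).
Proof. by rewrite /kright !kgrade_left !linearN /= kgradeK kleftC. Qed.

Lemma kleft_rightC i j a : kleft i (kright j a) = kright j (kleft i a).
Proof. by rewrite /kright kgrade_left linearN /= kleftC. Qed.

Lemma kdiffE x a T :
  kdiff x a T = \sum_(j | j \notin T) (koszul_sign R (j |: T) j * x j) *: a (j |: T).
Proof.
rewrite ffunE; under eq_bigr do rewrite /koszul_coef scaler_suml.
rewrite (exchange_big_dep xpredT) //= [RHS]big_mkcond /=.
apply: eq_bigr => j _; case: ifP => jT.
  rewrite (bigD1 (j |: T)) /=; last by rewrite setU11 setU1K ?eqxx ?jT.
  rewrite big1 ?addr0 // => S /andP[/andP[jS /eqP ->]].
  by rewrite setD1K // eqxx.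
rewrite big1 // => S /andP[jS /eqP e]; move: jT; rewrite e !inE eqxx //.
Qed.

(** The rule [koszul_signC], freed of the order of [i] and [j] by moving the signs,
whose squares are 1, from one side to the other. *)
Lemma koszul_sign_left_diff (T : {set 'I_n}) i j : i \in T -> j \notin T ->
  koszul_sign R (j |: T) j * koszul_sign R (j |: T) i
  = - (koszul_sign R T i * koszul_sign R (j |: T :\ i) j).
Proof.
move=> iT jT; have nij : i != j by apply: contraNneq jT => <-.
have := @koszul_signC R n (j |: T); set S := j |: T => H.
have jS : j \in S by rewrite setU11.
have iS : i \in S by rewrite !inE iT orbT.
have Sj : S :\ j = T by rewrite setU1K.
have Si : S :\ i = j |: T :\ i.
  by apply/setP=> k; rewrite !inE; case: eqP => //= ->; rewrite (negPf nij).
have sq (U : {set 'I_n}) k : koszul_sign R U k * koszul_sign R U k = 1.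
  by rewrite -expr2 sqrr_sign.
have {}H : koszul_sign R S i * koszul_sign R (S :\ i) j
      = - (koszul_sign R S j * koszul_sign R (S :\ j) i).
  case: (ltngtP i j) => [/H -> //|/H -> //|/val_inj e]; first by rewrite opprK.
  by rewrite e eqxx in nij.
rewrite Sj Si in H.
have : (koszul_sign R S j * koszul_sign R T i) * (koszul_sign R S i * koszul_sign R (S :\ i) j) = -1.
  by rewrite Si H mulrN -expr2 exprMn !sqrr_sign mulr1.
rewrite Si => H2.
have -> : koszul_sign R S j * koszul_sign R S i = - (koszul_sign R T i * koszul_sign R (j |: T :\ i) j)
  * ((koszul_sign R T i * koszul_sign R T i) * (koszul_sign R (j |: T :\ i) j * koszul_sign R (j |: T :\ i) j)) .
  rewrite !sq !mulr1 -[LHS]opprK; congr (- _); rewrite -mulN1r -H2.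
  rewrite [LHS](_ : _ = koszul_sign R T i * koszul_sign R (j |: T :\ i) j *
      (koszul_sign R S j * koszul_sign R S j) * (koszul_sign R S i * koszul_sign R S i)).
    by rewrite !sq !mulr1.
  by ring.
by rewrite !sq !mulr1.
Qed.

(** Multiplication by [e_j] is a homotopy between 0 and multiplication by [x j];
this is why the homology of all complexes below is killed by the ideal of [x]. *)
Lemma kdiff_left x j a : kdiff x (kleft j a) = x j *: a - kleft j (kdiff x a).
Proof.
apply/ffunP=> T; rewrite kdiffE [in RHS]ffunE ffunE [X in _ + X]ffunE [X in _ - X]ffunE.
have term i : i \notin T -> kleft j a (i |: T) =
    if (j == i) || (j \in T) then koszul_sign R (i |: T) j *: a ((i |: T) :\ j) else 0.
  by move=> iT; rewrite ffunE !inE.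
case jT: (j \in T).
  rewrite kdiffE scaler_sumr [in RHS](bigD1 j) ?setD11 //=.
  rewrite setD1K // scalerA mulrA -expr2 sqrr_sign mul1r opprD addNKr -sumrN.
  have e (i : 'I_n) : (i \notin T :\ j) && (i != j) = (i \notin T).
    by rewrite !inE; case: eqP => [->|]; rewrite ?jT ?andbF ?andbT.
  under [in RHS]eq_bigl do rewrite e.
  apply: eq_bigr => i iT; rewrite term // jT orbT !scalerA.
  have -> : (i |: T) :\ j = i |: T :\ j.
    apply/setP=> k; rewrite !inE; case: (k =P j) => //= ->.
    by apply/esym/negbTE; rewrite orbF; apply: contraNneq iT => <-.
  rewrite -scaleNr; congr (_ *: _).
  by rewrite mulrAC koszul_sign_left_diff // mulNr mulrA.
rewrite subr0 (bigD1 j) ?jT //= big1 ?addr0 => [|i /andP[iT ij]].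
  rewrite term ?jT // eqxx /= scalerA mulrAC -expr2 sqrr_sign mul1r setU1K ?jT //.
by rewrite term // jT orbF eq_sym (negPf ij) scaler0.
Qed.

Lemma kdiff_grade x a : kdiff x (kgrade a) = - kgrade (kdiff x a).
Proof.
apply/ffunP=> T; rewrite kdiffE [RHS]ffunE [X in - X]ffunE kdiffE scaler_sumr -sumrN.
apply: eq_bigr => j jT; rewrite ffunE cardsU1 jT exprS mulN1r -scaleNr !scalerA.
by rewrite mulrN mulrC mulNr.
Qed.

Lemma kdiff_right x j a :
  kdiff x (kright j a) = x j *: kgrade a + kright j (kdiff x a).
Proof. by rewrite /kright kdiff_left kdiff_grade linearN /= opprK. Qed.

Lemma kdiff_one x m : kdiff x (kone m) = 0.
Proof.
apply/ffunP=> T; rewrite kdiffE ffunE big1 // => j _; rewrite ffunE.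
case: eqP => [e|]; last by rewrite scaler0.
by move: (setU11 j T); rewrite e inE.
Qed.

Lemma kosE a : a = \sum_S kdelta S (a S).
Proof.
apply/ffunP=> T; rewrite sum_ffunE (bigD1 T) //= ffunE eqxx big1 ?addr0 // => S.
by rewrite eq_sym ffunE => /negPf ->.
Qed.

(** The module [K (x) M] is generated by [M] under right multiplication by the
exterior variables, so that an identity between additive maps that all commute
with these multiplications only has to be checked on [M]. *)
Lemma kos_ind (P : kos n M -> Prop) :
  (forall a b, P a -> P b -> P (a + b)) -> (forall m, P (kone m)) ->
  (forall j a, P a -> P (kright j a)) -> forall a, P a.
Proof.
move=> PD P1 PR a; have P0 : P 0 by rewrite -(raddf0 kone).
rewrite [a]kosE; elim/big_ind: _ => // S _.
elim: {S}#|S| {-2}S (leqnn #|S|) (a S) => [|d IH] S.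
  rewrite leqn0 cards_eq0 => /eqP -> m.
  by rewrite (_ : kdelta _ _ = kone m).
move=> leS m; case: (set_0Vmem S) => [->|[j jS]].
  by rewrite (_ : kdelta _ _ = kone m).
have leS' : (#|S :\ j| <= d)%N by move: leS; rewrite (cardsD1 j S) jS.
have -> : kdelta S m = kright j (kdelta (S :\ j)
   ((koszul_sign R S j * (-1) ^+ #|S :\ j|) *: m)).
  apply/ffunP=> T; rewrite !ffunE; case: (T =P S) => [->|nTS].
    by rewrite jS eqxx !scalerA mulrACA -!expr2 !sqrr_sign mulr1 scale1r.
  case: ifP => // jT; case: eqP => [e|]; rewrite ?scaler0 //.
  by case: nTS; rewrite -(setD1K jT) e setD1K.
exact/PR/IH.
Qed.

Lemma kdiffK x a : kdiff x (kdiff x a) = 0.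
Proof.
elim/kos_ind: a => [a b|m|j a IH]; first by rewrite !linearD /= => -> ->; rewrite addr0.
  by rewrite kdiff_one linear0.
rewrite kdiff_right linearD linearZ /= kdiff_grade kdiff_right IH linear0 addr0.
by rewrite scalerN addNr.
Qed.

End KoszulModule.

Arguments kone {R n M} m.

Section KoszulLift.
Variables (R A : comNzRingType) (n : nat) (M : lmodType R) (N : lmodType A).
Variables (E : 'I_n -> {additive N -> N}) (f : {additive M -> N}).
Implicit Types (S T : {set 'I_n}) (i j k : 'I_n).

Definition kop (s : seq 'I_n) T (y : N) : N :=
  foldl (fun z i => if i \in T then E i z else z) y s.

Fact kop_is_zmod_morphism s T : zmod_morphism (kop s T).
Proof. by elim: s => //= i s IH u v; rewrite /kop /=; case: (i \in T); rewrite ?raddfB; apply: IH. Qed.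
HB.instance Definition _ s T := GRing.isZmodMorphism.Build N N (kop s T)
  (kop_is_zmod_morphism s T).

(** The universal property of the exterior algebra: for operators [E j] that
anticommute and have square zero, [m e_i ^ e_j ^ ... ^ e_k] with [i < j < ... < k]
is sent to [E k (... (E j (E i (f m))))]. Products, base change and their
compatibilities all come from this map through [klift_right]. *)
Definition klift (a : kos n M) : N := \sum_T kop (enum 'I_n) T (f (a T)).

Fact klift_is_zmod_morphism : zmod_morphism klift.
Proof.
move=> a b; rewrite -sumrB; apply: eq_bigr => T _.
by rewrite !ffunE !raddfB.
Qed.
HB.instance Definition _ := GRing.isZmodMorphism.Build (kos n M) N klift
  klift_is_zmod_morphism.

Lemma kop_notin s T y : ~~ has (mem T) s -> kop s T y = y.
Proof. by elim: s y => //= i s IH y; rewrite negb_or => /andP[/negPf -> /IH ->]. Qed.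

Lemma klift_one m : klift (kone m) = f m.
Proof.
rewrite /klift (bigD1 set0) //= ffunE eqxx kop_notin ?big1 ?addr0 //.
  by move=> T /negPf nT; rewrite ffunE nT !raddf0.
by apply/hasPn => i _; rewrite /= inE.
Qed.

Hypothesis EC : forall i j y, E i (E j y) = - E j (E i y).
Hypothesis E_sq : forall i y, E i (E i y) = 0.

Lemma kop_cross s T j y :
  E j (kop s T y) = (-1) ^+ count (mem T) s *: kop s T (E j y).
Proof.
elim: s y => [|i s IH] y /=; first by rewrite scale1r.
rewrite IH; case: (i \in T); last by rewrite add0n.
by rewrite EC raddfN scalerN add1n exprS mulN1r scaleNr.
Qed.

Lemma eq_kop s T T' y : {in s, T =i T'} -> kop s T y = kop s T' y.
Proof.
elim: s y => //= i s IH y eqT; rewrite eqT ?mem_head //; apply: IH => k ks.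
by rewrite eqT // inE ks orbT.
Qed.

(** [E j] is brought to its place by passing it over the factors of larger index. *)
Lemma kop_insert T j y : E j (kop (enum 'I_n) T y) =
  if j \in T then 0
  else (-1) ^+ #|[set k in T | (j < k)%N]| *: kop (enum 'I_n) (j |: T) y.
Proof.
have : pairwise (fun i k : 'I_n => (i < k)%N) (enum 'I_n).
  have := iota_ltn_sorted 0 n; rewrite -val_enum_ord.
  by rewrite (sorted_pairwise ltn_trans) pairwise_map.
have -> : #|[set k in T | (j < k)%N]| =
    count (fun k => (k \in T) && (j < k)%N) (enum 'I_n).
  rewrite cardE -size_filter; congr size; rewrite enumT; apply: eq_filter => k.
  by rewrite !inE.
case/splitPr: (mem_enum 'I_n j) => s1 s2.
rewrite pairwise_cat allrel_consr /= => /and3P[/andP[s1j _] _ /andP[s2j _]].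
rewrite /kop !foldl_cat /= -/(kop s1 T y) -/(kop s2 T _).
rewrite -[foldl _ _ s1]/(kop s1 (j |: T) y) -[foldl _ _ s2]/(kop s2 (j |: T) _).
rewrite setU11 -/(kop s2 T _) kop_cross; case: ifP => jT; first by rewrite E_sq raddf0 scaler0.
have -> : kop s1 (j |: T) y = kop s1 T y.
  apply: eq_kop => k /(allP s1j); rewrite !inE.
  by case: eqP => // ->; rewrite ltnn.
congr (_ *: _); last first.
  apply: eq_kop => k /(allP s2j); rewrite !inE.
  by case: eqP => // ->; rewrite ltnn.
have c1 : count (fun k => (k \in T) && (j < k)%N) s1 = 0%N.
  apply/eqP; rewrite -[_ == _]negbK -lt0n -has_count; apply/hasPn => k.
  by move=> /(allP s1j) kj; rewrite negb_and -leqNgt (ltnW kj) orbT.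
congr (_ ^+ _); rewrite count_cat /= jT /= c1 !add0n.
by apply: eq_in_count => k /(allP s2j) jk; rewrite /= jk andbT.
Qed.

Lemma klift_right j a : klift (kright j a) = E j (klift a).
Proof.
rewrite /klift raddf_sum (bigID (fun S : {set 'I_n} => j \in S)) /=.
rewrite [X in _ + X]big1 ?addr0; last first.
  by move=> S /negPf jS; rewrite ffunE jS !raddf0.
rewrite [RHS](bigID (fun S : {set 'I_n} => j \in S)) /=.
rewrite [X in _ = X + _]big1 ?add0r; last first.
  by move=> S jS; rewrite kop_insert jS.
rewrite (reindex_onto (fun T => j |: T) (fun S => S :\ j)) /=; last first.
  by move=> S; apply: setD1K.
apply: eq_big => T; first rewrite setU11 /=.
  case jT: (j \in T); last by rewrite setU1K ?jT ?eqxx.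
  by apply/negbTE; apply: contraTneq jT => <-; rewrite setD11.
case/andP => _ /eqP eT; have jT : j \notin T by rewrite -eT setD11.
rewrite kop_insert (negPf jT) !ffunE setU11 eT scalerA /koszul_sign -exprD.
rewrite !raddfZsign; congr (_ *: _).
rewrite -signr_odd -[RHS]signr_odd; congr (_ ^+ nat_of_bool _).
have -> : [set k in j |: T | (k < j)%N] = [set k in T | (k < j)%N].
  by apply/setP=> k; rewrite !inE; case: eqP => // ->; rewrite ltnn !andbF.
have -> : (#|T| = #|[set k in T | (k < j)%N]| + #|[set k in T | (j < k)%N]|)%N.
  rewrite -(cardsID [set k : 'I_n | (k < j)%N] T); congr (_ + _)%N; apply: eq_card => k.
    by rewrite !inE.
  rewrite !inE -leqNgt andbC; case kT: (k \in T) => //=.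
  by rewrite ltn_neqAle; case: eqP => //= /val_inj e; rewrite e kT in jT.
by rewrite !oddD addbA addbb.
Qed.

End KoszulLift.

Section KoszulProduct.
Variables (R : comNzRingType) (n : nat).
Local Notation K := (kos n R^o).

Section Def.
Variable M : lmodType R.

Definition scale_on (a : kos n M) (r : R^o) : kos n M := (r : R) *: a.
Fact scale_on_is_zmod_morphism a : zmod_morphism (scale_on a).
Proof. by move=> r s; rewrite /scale_on scalerBl. Qed.
HB.instance Definition _ a := GRing.isZmodMorphism.Build R^o (kos n M) (scale_on a)
  (scale_on_is_zmod_morphism a).

(** The right action of the Koszul algebra on [K (x) M]; for [M = R] it is the
product of the exterior algebra. *)
Definition kmul (a : kos n M) (b : K) : kos n M :=
  klift (fun j => kright j : {additive _ -> _}) (scale_on a) b.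

End Def.

Variable M : lmodType R.
Implicit Types (a : kos n M) (b c : K).

Lemma kmul_one a r : kmul a (kone r) = (r : R) *: a.
Proof. by rewrite /kmul klift_one. Qed.

Lemma kmul_right a j b : kmul a (kright j b) = kright j (kmul a b).
Proof. by rewrite /kmul klift_right // => *; [exact: krightC|exact: kright_sq]. Qed.

HB.instance Definition _ a := GRing.Additive.copy (kmul a)
  (klift (fun j => kright j : {additive _ -> _}) (scale_on a)).

Lemma kmulDr a b c : kmul a (b + c) = kmul a b + kmul a c.
Proof. exact: raddfD. Qed.

Lemma kmulDl a a' b : kmul (a + a') b = kmul a b + kmul a' b.
Proof.
elim/kos_ind: b => [b c|r|j b IH]; first by rewrite !raddfD /= => -> ->; rewrite addrACA.
  by rewrite !kmul_one scalerDr.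
by rewrite !kmul_right IH raddfD.
Qed.

Lemma kmulZl r a b : kmul (r *: a) b = r *: kmul a b.
Proof.
elim/kos_ind: b => [b c|s|j b IH]; first by rewrite !raddfD /= => -> ->; rewrite ?scalerDr.
  by rewrite !kmul_one !scalerA mulrC.
by rewrite !kmul_right IH linearZ.
Qed.

Lemma kmulZr r a b : kmul a (r *: b) = r *: kmul a b.
Proof.
elim/kos_ind: b => [b c|s|j b IH].
    by rewrite scalerDr !raddfD /= => -> ->; rewrite ?scalerDr.
  by rewrite -linearZ /= !kmul_one scalerA.
by rewrite -linearZ /= !kmul_right IH linearZ.
Qed.

Definition kmulr b a := kmul a b.
Fact kmulr_is_zmod_morphism b : zmod_morphism (kmulr b).
Proof.
by move=> a a'; rewrite /kmulr -scaleN1r kmulDl kmulZl scaleN1r.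
Qed.
HB.instance Definition _ b := GRing.isZmodMorphism.Build (kos n M) (kos n M)
  (kmulr b) (kmulr_is_zmod_morphism b).

Lemma kmulNl a b : kmul (- a) b = - kmul a b.
Proof. exact: (raddfN (kmulr b)). Qed.
Lemma kmul0l b : kmul (0 : kos n M) b = 0.
Proof. exact: (raddf0 (kmulr b)). Qed.
Lemma kgrade_mul a b : kgrade (kmul a b) = kmul (kgrade a) (kgrade b).
Proof.
elim/kos_ind: b => [b c|r|j b IH]; first by rewrite !raddfD /= => -> ->.
  by rewrite kgrade_one !kmul_one linearZ.
by rewrite kmul_right !kgrade_right raddfN /= kmul_right IH.
Qed.

Lemma kdiff_mul x a b :
  kdiff x (kmul a b) = kmul (kdiff x a) b + kmul (kgrade a) (kdiff x b).
Proof.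
elim/kos_ind: b => [b c|r|j b IH].
    by rewrite !raddfD /= => -> ->; rewrite addrACA.
  by rewrite kdiff_one raddf0 addr0 !kmul_one linearZ.
rewrite kmul_right !kdiff_right IH raddfD raddfD /= !kmul_right kmulZr.
by rewrite -kgrade_mul addrCA.
Qed.

Lemma kleft_mul j a b : kleft j (kmul a b) = kmul (kleft j a) b.
Proof.
elim/kos_ind: b => [b c|r|i b IH]; first by rewrite !raddfD /= => -> ->.
  by rewrite !kmul_one linearZ.
by rewrite !kmul_right kleft_rightC IH.
Qed.

(** [kten m a] is the element [a (x) m] of [K (x) M]. *)
Definition kten (m : M) (a : K) : kos n M := [ffun S => (a S : R) *: m].

Fact kten_is_linear m : linear (kten m).
Proof.
by move=> r a b; apply/ffunP=> S; rewrite !ffunE scalerDl scalerA.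
Qed.
HB.instance Definition _ m := GRing.isLinear.Build R K (kos n M) *:%R (kten m)
  (kten_is_linear m).

Lemma kten_grade m (a : K) : kten m (kgrade a) = kgrade (kten m a).
Proof. by apply/ffunP=> S; rewrite !ffunE scalerA. Qed.

Lemma kten_left m j (a : K) : kten m (kleft j a) = kleft j (kten m a).
Proof. by apply/ffunP=> S; rewrite !ffunE; case: ifP; rewrite ?scalerA ?scale0r. Qed.

Lemma kten_diff x m (a : K) : kten m (kdiff x a) = kdiff x (kten m a).
Proof.
apply/ffunP=> S; rewrite !ffunE scaler_suml; apply: eq_bigr => T _.
by rewrite ffunE scalerA.
Qed.

End KoszulProduct.

Lemma kmulA (R : comNzRingType) n (M : lmodType R) (a : kos n M) (b c : kos n R^o) :
  kmul a (kmul b c) = kmul (kmul a b) c.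
Proof.
elim/kos_ind: c => [c c'|r|j c IH]; first by rewrite !kmulDr => -> ->.
  by rewrite !kmul_one kmulZr.
by rewrite !kmul_right IH.
Qed.

Lemma kten_mul (R : comNzRingType) n (M : lmodType R) (m : M) (a b : kos n R^o) :
  kten m (kmul a b) = kmul (kten m a) b.
Proof.
elim/kos_ind: b => [b c|r|j b IH]; first by rewrite !raddfD /= => -> ->.
  by rewrite !kmul_one linearZ.
by rewrite !kmul_right /kright kten_left kten_grade IH.
Qed.

(** * Grading and base change *)

Section KoszulGrading.
Variables (R : comNzRingType) (n : nat) (M : lmodType R).
Implicit Types (a : kos n M) (b : kos n R^o).

Definition kpr (q : nat) a : kos n M := [ffun S : {set 'I_n} => if #|S| == q then a S else 0].

Fact kpr_is_linear q : linear (kpr q).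
Proof. by move=> c a b; apply/ffunP=> S; rewrite !ffunE; case: ifP; rewrite // scaler0 addr0. Qed.
HB.instance Definition _ q := GRing.isLinear.Build R (kos n M) (kos n M) *:%R (kpr q)
  (kpr_is_linear q).

Lemma kprK q a : kpr q (kpr q a) = kpr q a.
Proof. by apply/ffunP=> S; rewrite !ffunE; case: (#|S| == q). Qed.

Lemma kpr_neq q r a : q != r -> kpr q (kpr r a) = 0.
Proof.
move=> nqr; apply/ffunP=> S; rewrite !ffunE; case: eqP => // ->.
by rewrite (negPf nqr).
Qed.

Lemma kpr_sum a : a = \sum_(q < n.+1) kpr q a.
Proof.
apply/ffunP=> S; rewrite sum_ffunE.
have le : (#|S| < n.+1)%N by rewrite ltnS -[X in (_ <= X)%N](card_ord n) max_card.
rewrite (bigD1 (Ordinal le)) //= ffunE eqxx big1 ?addr0 // => q nq.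
by rewrite ffunE; case: eqP => // e; case/eqP: nq; apply: val_inj.
Qed.

Lemma kpr_one q m : kpr q (kone m) = if q == 0%N then kone m else 0 :> kos n M.
Proof.
apply/ffunP=> S; rewrite !ffunE; case: (S =P set0) => [->|nS].
  by rewrite cards0 eq_sym; case: eqP; rewrite !ffunE ?eqxx.
by case: ifP => _; case: ifP; rewrite !ffunE // (introF eqP nS).
Qed.

Lemma kpr0 a : kpr 0 a = kone (a set0).
Proof.
by apply/ffunP=> S; rewrite !ffunE cards_eq0; case: eqP => // ->.
Qed.

Lemma kpr_grade q a : kpr q (kgrade a) = kgrade (kpr q a).
Proof. by apply/ffunP=> S; rewrite !ffunE; case: ifP; rewrite ?scaler0. Qed.

Lemma kpr_left q j a : kpr q.+1 (kleft j a) = kleft j (kpr q a).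
Proof.
apply/ffunP=> S; rewrite !ffunE; case jS: (j \in S); last by rewrite if_same.
by rewrite (cardsD1 j S) jS add1n eqSS; case: ifP; rewrite ?scaler0.
Qed.

Lemma kpr0_left j a : kpr 0 (kleft j a) = 0.
Proof. by rewrite kpr0 ffunE inE raddf0. Qed.

Lemma kpr_right q j a : kpr q.+1 (kright j a) = kright j (kpr q a).
Proof. by rewrite kpr_left kpr_grade. Qed.

Lemma kpr0_right j a : kpr 0 (kright j a) = 0.
Proof. exact: kpr0_left. Qed.

Lemma kpr_diff x q a : kpr q (kdiff x a) = kdiff x (kpr q.+1 a).
Proof.
apply/ffunP=> T; rewrite ffunE !kdiffE; case: ifP => [/eqP e|ne].
  by apply: eq_bigr => j jT; rewrite ffunE cardsU1 jT e eqxx.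
by rewrite big1 // => j jT; rewrite ffunE cardsU1 jT add1n eqSS ne scaler0.
Qed.

Lemma kdiff_kpr0 x a : kdiff x (kpr 0 a) = 0.
Proof. by rewrite kpr0 kdiff_one. Qed.

End KoszulGrading.

Section GradedProduct.
Variables (R : comNzRingType) (n : nat) (M : lmodType R).
Implicit Types (a : kos n M) (b : kos n R^o).

Lemma kpr_mul q r a b : kpr (q + r)%N (kmul a (kpr r b)) = kmul (kpr q a) (kpr r b).
Proof.
elim/kos_ind: b q r => [b c IHb IHc|s|j b IH] q r; first by rewrite !raddfD /= IHb IHc.
  rewrite kpr_one; case: eqP => [->|_]; last by rewrite !raddf0.
  by rewrite addn0 !kmul_one linearZ.
case: r => [|r]; first by rewrite kpr0_right !raddf0.
by rewrite kpr_right !kmul_right addnS kpr_right IH.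
Qed.

Lemma kpr_mul_lt q r a b : (q < r)%N -> kpr q (kmul a (kpr r b)) = 0.
Proof.
elim/kos_ind: b q r => [b c IHb IHc|s|j b IH] q r lt.
    by rewrite !raddfD /= IHb // IHc // addr0.
  by rewrite kpr_one gtn_eqF ?(leq_ltn_trans _ lt) // !raddf0.
case: r lt => [//|r] lt; rewrite kpr_right kmul_right.
by case: q lt => [|q] lt; rewrite ?kpr0_right // kpr_right IH ?raddf0.
Qed.

End GradedProduct.

Section BaseChange.
Variables (R A : comNzRingType) (p : {rmorphism R -> A}) (n r : nat).
Variable C : 'I_n -> 'I_r -> A.

Section Coef.
Variable N : lmodType A.
(** Right multiplication by [\sum_l C j l *: e_l], the image of [e_j] under base
change. *)
Definition kvec j (a : kos r N) : kos r N := \sum_l C j l *: kright l a.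

Fact kvec_is_linear j : linear (kvec j).
Proof.
move=> c a b; rewrite /kvec scaler_sumr -big_split /=; apply: eq_bigr => l _.
by rewrite linearP /= scalerDr !scalerA mulrC.
Qed.
HB.instance Definition _ j := GRing.isLinear.Build A (kos r N) (kos r N) *:%R (kvec j)
  (kvec_is_linear j).

Lemma kvecC i j a : kvec i (kvec j a) = - kvec j (kvec i a).
Proof.
rewrite /kvec; under eq_bigr do rewrite linear_sum scaler_sumr /=.
under [in RHS]eq_bigr do rewrite linear_sum scaler_sumr /=.
rewrite exchange_big -sumrN; apply: eq_bigr => k _.
rewrite -sumrN; apply: eq_bigr => l _.
by rewrite !linearZ /= krightC !scalerN !scalerA mulrC.
Qed.

Lemma kvec_sq j a : kvec j (kvec j a) = 0.
Proof.
have -> : kvec j (kvec j a) = \sum_k \sum_l (C j k * C j l) *: kright k (kright l a).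
  apply: eq_bigr => k _; rewrite linear_sum scaler_sumr; apply: eq_bigr => l _.
  by rewrite linearZ /= scalerA.
pose F (k l : 'I_r) := (C j k * C j l) *: kright k (kright l a).
have FC k l : F k l = - F l k by rewrite /F krightC scalerN mulrC.
have Fk k : F k k = 0 by rewrite /F kright_sq scaler0.
transitivity (\sum_(k : 'I_r) (\sum_(l : 'I_r | (l < k)%N) F k l + \sum_(l : 'I_r | (k < l)%N) F k l)).
  apply: eq_bigr => k _; rewrite (bigID (fun l : 'I_r => (l < k)%N)) /=; congr (_ + _).
  rewrite (bigD1 k) ?ltnn //= -/(F k k) Fk add0r; apply: eq_bigl => l.
  by rewrite -leqNgt [RHS]ltn_neqAle andbC eq_sym.
rewrite big_split /= [X in _ + X](exchange_big_dep xpredT) //=.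
rewrite -big_split big1 //= => k _; rewrite -big_split big1 //= => l _.
by rewrite FC addNr.
Qed.

Lemma kgrade_vec j a : kgrade (kvec j a) = - kvec j (kgrade a).
Proof.
rewrite /kvec linear_sum -sumrN; apply: eq_bigr => l _.
by rewrite linearZ /= kgrade_right scalerN.
Qed.

Lemma kdiff_vec x j a :
  kdiff x (kvec j a) = (\sum_l C j l * x l) *: kgrade a + kvec j (kdiff x a).
Proof.
rewrite /kvec linear_sum scaler_suml -big_split; apply: eq_bigr => l _ /=.
by rewrite linearZ /= kdiff_right scalerDr scalerA.
Qed.

Lemma kmul_vec (a : kos r N) j (b : kos r A^o) :
  kmul a (\sum_l C j l *: kright l b) = kvec j (kmul a b).
Proof.
by rewrite (raddf_sum (kmul a)); apply: eq_bigr => l _ /=; rewrite kmulZr kmul_right.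
Qed.

End Coef.

Section Map.
Variables (M : lmodType R) (N : lmodType A) (f : {additive M -> N}).

(** The map [e_j |-> \sum_l C j l *: e_l] of exterior algebras, on coefficients
in [M] and [N]. *)
Definition kmap : kos n M -> kos r N :=
  klift (fun j => @kvec N j : {additive _ -> _})
        (kone \o f : {additive M -> kos r N}).

HB.instance Definition _ := GRing.Additive.copy kmap
  (klift (fun j => @kvec N j : {additive _ -> _})
        (kone \o f : {additive M -> kos r N})).

Lemma kmap_one m : kmap (kone m) = kone (f m).
Proof. exact: klift_one. Qed.

Lemma kmap_right j a : kmap (kright j a) = kvec j (kmap a).
Proof. by rewrite /kmap klift_right // => *; [exact: kvecC|exact: kvec_sq]. Qed.

Lemma kmap_grade a : kmap (kgrade a) = kgrade (kmap a).
Proof.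
elim/kos_ind: a => [a b|m|j a IH]; first by rewrite !raddfD /= => -> ->.
  by rewrite kgrade_one kmap_one kgrade_one.
by rewrite kgrade_right raddfN /= !kmap_right IH kgrade_vec.
Qed.

Lemma kpr_kmap q a : kpr q (kmap a) = kmap (kpr q a).
Proof.
elim/kos_ind: a q => [a b IHa IHb|m|j a IH] q; first by rewrite !raddfD /= IHa IHb.
  by rewrite kmap_one !kpr_one; case: eqP; rewrite ?kmap_one ?raddf0.
rewrite kmap_right linear_sum; case: q => [|q].
  rewrite kpr0_right raddf0 big1 // => l _.
  by rewrite linearZ /= kpr0_right scaler0.
rewrite kpr_right kmap_right -IH; apply: eq_bigr => l _.
by rewrite linearZ /= kpr_right.
Qed.

Hypothesis fZ : forall c m, f (c *: m) = p c *: f m.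

Lemma kmapZ c a : kmap (c *: a) = p c *: kmap a.
Proof.
elim/kos_ind: a => [a b|m|j a IH].
    by rewrite scalerDr !raddfD /= => -> ->; rewrite ?scalerDr.
  by rewrite -linearZ /= !kmap_one fZ linearZ.
by rewrite -linearZ /= !kmap_right IH linearZ.
Qed.

Lemma kmap_diff (x : 'I_n -> R) (y : 'I_r -> A) a :
  (forall j, p (x j) = \sum_l C j l * y l) ->
  kmap (kdiff x a) = kdiff y (kmap a).
Proof.
move=> xy; elim/kos_ind: a => [a b|m|j a IH]; first by rewrite !raddfD /= => -> ->.
  by rewrite kdiff_one kmap_one kdiff_one raddf0.
by rewrite kdiff_right raddfD /= kmapZ !kmap_right kmap_grade IH kdiff_vec xy.
Qed.

End Map.

Definition reg_morph (a : R^o) : A^o := p a.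
HB.instance Definition _ := GRing.Additive.copy reg_morph p.

Lemma reg_morphZ c (a : R^o) : reg_morph (c *: a) = p c *: reg_morph a.
Proof. exact: rmorphM. Qed.

Lemma kmap_mul (M : lmodType R) (N : lmodType A) (f : {additive M -> N})
   (fZ : forall c m, f (c *: m) = p c *: f m) a b :
  kmap f (kmul a b) = kmul (kmap f a) (kmap reg_morph b).
Proof.
elim/kos_ind: b => [b c|c|j b IH]; first by rewrite !raddfD /= => -> ->.
  by rewrite kmul_one kmap_one kmul_one (kmapZ fZ).
by rewrite kmul_right !kmap_right IH kmul_vec.
Qed.

End BaseChange.

(** Both base changes are determined by the images of the exterior variables, so
that it suffices that the matrices compose to the identity. *)
Lemma kmap_comp_id (R A : comNzRingType) (p : {rmorphism A -> R}) n r
    (C : 'I_r -> 'I_n -> A) (D : 'I_n -> 'I_r -> R)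
    (M : lmodType R) (N : lmodType A) (g : {additive M -> N}) (f : {additive N -> M}) :
  (forall c m, f (c *: m) = p c *: f m) -> cancel g f ->
  (forall i k, \sum_l p (C i l) * D l k = (i == k)%:R) ->
  cancel (kmap C g) (kmap D f).
Proof.
move=> fZ gK CD; elim/kos_ind => [a b Ha Hb|m|j a IH]; first by rewrite !raddfD /= Ha Hb.
  by rewrite !kmap_one gK.
rewrite kmap_right {1}/kvec raddf_sum /=.
under eq_bigr => l _ do rewrite (kmapZ _ fZ) kmap_right IH /kvec scaler_sumr.
rewrite exchange_big /= (bigD1 j) //= [X in _ + X]big1 ?addr0 => [|k kj].
  under eq_bigr => l _ do rewrite scalerA.
  by rewrite -scaler_suml CD eqxx scale1r.
under eq_bigr => l _ do rewrite scalerA.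
by rewrite -scaler_suml CD eq_sym (negPf kj) scale0r.
Qed.

(** * Linear algebra over the residue field *)

Lemma idealr_of (R : comNzRingType) (P : R -> Prop) :
  P 0 -> (forall a u v, P u -> P v -> P (a * u + v)) -> ~ P 1 ->
  exists I : idealr R, forall a, a \in I <-> P a.
Proof.
move=> P0 PD P1; pose S : {pred R} := fun a => `[< P a >].
have SE a : a \in S <-> P a by split=> [/asboolP|/asboolP].
have H : idealr_closed S.
  split; [exact/SE|by apply/negP => /SE|move=> a u v /SE Pu /SE Pv; exact/SE/PD].
by exists (HB.pack_for (idealr R) S (isIdealr.Build R S H)).
Qed.

Section MaximalIdeal.
Variables (R : comNzRingType) (m : idealr R) (mmax : maximal_ideal m).

(** Otherwise [a] and [m] generate a proper ideal larger than [m]. *)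
Lemma maximal_inv a : a \notin m -> exists r, 1 - r * a \in m.
Proof.
move=> am; apply: contrapT => H.
have [|c u v [r ur] [s vs]||J HJ] := @idealr_of R (fun b => exists r, b - r * a \in m).
- by exists 0; rewrite mul0r subr0 rpred0.
- exists (c * r + s); rewrite mulrDl opprD addrACA -mulrA -mulrBr.
  by rewrite rpredD // idealMr.
- by case=> r /= ?; apply: H; exists r.
case/negP: am; apply: (mmax (J := J)) => [b bm|]; apply/HJ.
  by exists 0; rewrite mul0r subr0.
by exists 1; rewrite mul1r subrr rpred0.
Qed.

Lemma residue_field : exists (k : fieldType) (f : {rmorphism R -> k}),
  (forall y, exists a, f a = y) /\ (forall a, f a = 0 <-> a \in m).
Proof.
pose Q : comNzRingType := {ideal_quot m}.
pose pi : R -> Q := \pi_Q%qT.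
have pi_surj y : exists a, pi a = y by exists (repr y); exact: reprK.
have pi0 a : pi a = 0 <-> a \in m.
  rewrite -[X in X \in m]subr0 Quotient.idealrBE; split=> [e|/eqP e].
    by apply/eqP; rewrite -/(pi a) e /pi raddf0.
  by rewrite /pi e raddf0.
pose inv (y : Q) : Q :=
  if pselect (exists z, z * y = 1) is left H then projT1 (cid H) else 0.
have invP (y : Q) : y != 0 -> inv y * y = 1.
  move=> y0; rewrite /inv; case: pselect => [H|[]]; first by case: cid.
  have [a ay] := pi_surj y.
  have [|r ra] := @maximal_inv a.
    by apply: contra_neqN y0 => /pi0 <-.
  exists (pi r); rewrite -ay -(rmorphM (\pi_Q%qT : {rmorphism R -> Q})).
  apply/eqP; rewrite eq_sym -subr_eq0 -(rmorph1 (\pi_Q%qT : {rmorphism R -> Q})) -raddfB.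
  by apply/eqP/pi0.
have inv0 : inv 0 = 0.
  rewrite /inv; case: pselect => // H; exfalso; case: H => z.
  by rewrite mulr0 => /esym /eqP; rewrite oner_eq0.
pose k : fieldType := HB.pack_for fieldType {ideal_quot m} (GRing.ComNzRing_isField.Build Q invP inv0).
exists k; exists (\pi_Q%qT : {rmorphism R -> Q}); split; [exact: pi_surj|exact: pi0].
Qed.

End MaximalIdeal.

Section Submodules.
Variables (R : comNzRingType) (V : lmodType R).
Implicit Types (Z B : V -> Prop) (I J : finType).

Definition submod B := B 0 /\ forall a u v, B u -> B v -> B (a *: u + v).

Section Closure.
Variables (B : V -> Prop) (hB : submod B).
Lemma submod0 : B 0. Proof. by case: hB. Qed.
Lemma submodD u v : B u -> B v -> B (u + v).
Proof. by case: hB => _ h Bu Bv; rewrite -[u]scale1r; apply: h. Qed.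
Lemma submodZ a u : B u -> B (a *: u).
Proof. by case: hB => h0 h Bu; rewrite -[_ *: _]addr0; apply: h. Qed.
Lemma submodN u : B u -> B (- u).
Proof. by rewrite -scaleN1r; apply: submodZ. Qed.
Lemma submodB u v : B u -> B v -> B (u - v).
Proof. by move=> Bu Bv; apply/submodD/submodN. Qed.
Lemma submod_sum I (P : pred I) (F : I -> V) :
  (forall i, P i -> B (F i)) -> B (\sum_(i | P i) F i).
Proof. by move=> h; elim/big_ind: _; [exact: submod0|exact: submodD|]. Qed.
End Closure.

Definition spans Z B I (e : I -> V) :=
  forall z, Z z -> exists c : I -> R, B (z - \sum_i c i *: e i).

Definition indep (m : {pred R}) B I (e : I -> V) :=
  forall c : I -> R, B (\sum_i c i *: e i) -> forall i, c i \in m.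

Definition killed (m : {pred R}) Z B := forall a z, a \in m -> Z z -> B (a *: z).

Variables (m : idealr R) (mmax : maximal_ideal m).

(** Over the residue field, the coefficients of more than [#|I|] elements [f j] have
a nontrivial linear relation; lifted to [R] it gives a combination of the [f j] in
[B], whose coefficients are not all in [m]. *)
Lemma exchange B I J (e : I -> V) (f : J -> V) : submod B ->
  (forall a i, a \in m -> B (a *: e i)) ->
  (forall j, exists c : I -> R, B (f j - \sum_i c i *: e i)) ->
  indep m B f -> (#|J| <= #|I|)%N.
Proof.
move=> hB mB /choice[c fc] ind; rewrite leqNgt; apply/negP => lt.
have [k [phi [surj ker]]] := residue_field mmax.
pose A : 'M[k]_(#|J|, #|I|) := \matrix_(j, i) phi (c (enum_val j) (enum_val i)).
have nz : kermx A != 0.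
  rewrite -mxrank_eq0 mxrank_ker subn_eq0 -ltnNge.
  exact: leq_ltn_trans (rank_leq_col _) lt.
pose u := nz_row (kermx A).
have u0 : u != 0 by rewrite /u nz_row_eq0.
have uA : u *m A = 0 by apply/sub_kermxP/nz_row_sub.
have /choice[a aE] : forall j : 'I_#|J|, exists r, phi r = u 0 j by move=> j; apply: surj.
case/eqP: u0; apply/rowP => j; rewrite -aE mxE; apply/ker.
rewrite -[j]enum_valK; move: (enum_val j); apply: (ind (fun j => a (enum_rank j))).
rewrite (eq_bigr (fun j => a (enum_rank j) *: (f j - \sum_i c j i *: e i)
   + \sum_i (a (enum_rank j) * c j i) *: e i)); last first.
  move=> l _; rewrite scalerBr; under [X in _ + X]eq_bigr do rewrite -scalerA.
  by rewrite -scaler_sumr subrK.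
rewrite big_split /=; apply: submodD => //.
  by apply: submod_sum => // i _; apply: submodZ.
rewrite exchange_big /=; apply: submod_sum => // i _; rewrite -scaler_suml.
apply: mB; apply/ker; rewrite rmorph_sum.
have /rowP/(_ (enum_rank i)) := uA; rewrite !mxE; apply: etrans.
rewrite (reindex (@enum_val J predT)) /=; last first.
  exact: (onW_bij _ (@enum_val_bij J)).
by apply: eq_bigr => l _; rewrite rmorphM enum_valK aE mxE enum_rankK.
Qed.

Definition extend d (f : 'I_d -> V) z (i : 'I_d.+1) : V := oapp f z (unlift ord0 i).

Lemma sum_extend d (f : 'I_d -> V) z (c : 'I_d.+1 -> R) :
  \sum_i c i *: extend f z i = c ord0 *: z + \sum_i c (lift ord0 i) *: f i.
Proof.
by rewrite big_ord_recl /extend unlift_none; congr (_ + _); apply: eq_bigr => i _;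
  rewrite liftK.
Qed.

(** If a relation involves [z] with a coefficient outside [m], that coefficient is
invertible modulo [m], and [z] can be solved for. *)
Lemma extend_indep B d (f : 'I_d -> V) z : submod B ->
  (forall a, a \in m -> B (a *: z)) -> indep m B f ->
  (exists c : 'I_d -> R, B (z - \sum_i c i *: f i)) \/ indep m B (extend f z).
Proof.
move=> hB mz ind; case: (pselect (indep m B (extend f z))) => [|/existsNP[c]]; first by right.
move=> /not_implyP[]; rewrite sum_extend => Bc /existsNP[i /negP ci]; left.
have c0 : c ord0 \notin m.
  apply: contraNN ci => c0; case: (unliftP ord0 i) => [l ->|-> //].
  apply: (ind (fun l => c (lift ord0 l))).
  by rewrite -[X in B X](addKr (c ord0 *: z)) addrC; apply: submodB => //; apply: mz.
have [r rc] := maximal_inv mmax c0; exists (fun i => - (r * c (lift ord0 i))).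
rewrite -[z in X in B X]scale1r -(subrK (r * c ord0) 1) scalerDl -addrA.
apply: submodD => //; first exact: mz.
rewrite -sumrN -scalerA; under eq_bigr do rewrite scaleNr opprK -scalerA.
by rewrite -scaler_sumr -scalerDr; apply: submodZ.
Qed.

(** A maximal independent family [f] in [Z1] is a basis of it. Its size is bounded
by [exchange], and if the bound is reached then [f] is maximal in [Z] too. *)
Lemma basis_within Z Z1 B I (e : I -> V) : submod B ->
  (forall z, Z1 z -> Z z) -> killed m Z B ->
  (forall a i, a \in m -> B (a *: e i)) -> spans Z B e ->
  exists d (f : 'I_d -> V), [/\ (d <= #|I|)%N, forall i, Z1 (f i), indep m B f,
    spans Z1 B f & d = #|I| -> spans Z B f].
Proof.
move=> hB sZ mZ me sp.
have bound d (f : 'I_d -> V) : (forall i, Z (f i)) -> indep m B f -> (d <= #|I|)%N.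
  by move=> fZ ind; have := exchange hB me (fun j => sp _ (fZ j)) ind; rewrite card_ord.
pose ok d := `[< exists2 f : 'I_d -> V, (forall i, Z1 (f i)) & indep m B f >].
have ok0 : exists d, ok d.
  by exists 0%N; apply/asboolP; exists (fun _ => 0) => [[]|c _ []].
have okle d : ok d -> (d <= #|I|)%N.
  by move=> /asboolP[f fZ1]; apply: bound => i; exact/sZ.
case: (ex_maxnP ok0 okle) => d /asboolP[f fZ1 ind] dmax.
have ext z W : (forall z, W z -> Z z) -> (forall i, W (f i)) -> W z ->
    (exists c : 'I_d -> R, B (z - \sum_i c i *: f i)) \/
    exists2 f : 'I_d.+1 -> V, (forall i, W (f i)) & indep m B f.
  move=> WZ fW Wz; have [|h|h] := @extend_indep B d f z hB _ ind; first 1 last.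
  - by left.
  - right; exists (extend f z) => // i; rewrite /extend.
    by case: unliftP => [j|] _ /=.
  by move=> a am; apply: mZ => //; apply: WZ.
exists d, f; split=> //; first by apply: okle; apply/asboolP; exists f.
  move=> z Zz; have [//|h] := ext z Z1 sZ fZ1 Zz.
  by have := dmax d.+1; rewrite ltnn => H; have := H (introT (asboolP _) h).
move=> dI z Zz; have [//|[g gZ gi]] := ext z Z (fun _ => id) (fun i => sZ _ (fZ1 i)) Zz.
by have := bound _ _ gZ gi; rewrite -dI ltnn.
Qed.

Lemma subquotient_dimI Z B I (e : I -> V) : killed m Z B -> (forall i, Z (e i)) ->
  spans Z B e -> indep m B e -> subquotient_dim m Z B #|I|.
Proof.
move=> mZ eZ sp ind; split=> //; exists (fun i => e (enum_val i)); split=> [i||c].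
- exact: eZ.
- move=> z /sp[c Bc]; exists (fun i => c (enum_val i)).
  rewrite -(reindex (@enum_val I predT) (P := predT) (F := fun i => c i *: e i)) //.
  exact: (onW_bij _ (@enum_val_bij I)).
have -> : \sum_i c i *: e (enum_val i) = \sum_i c (enum_rank i) *: e i.
  rewrite [RHS](reindex (@enum_val I predT)) /=; last exact: (onW_bij _ (@enum_val_bij I)).
  by apply: eq_bigr => i _; rewrite enum_valK.
by move=> /ind h i; rewrite -(enum_valK i).
Qed.

Lemma subquotient_dim_indep_le Z B d I (f : I -> V) : submod B ->
  subquotient_dim m Z B d -> (forall i, Z (f i)) -> indep m B f -> (#|I| <= d)%N.
Proof.
move=> hB [mZ [e [eZ sp _]]] fZ ind; rewrite -[X in (_ <= X)%N]card_ord.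
by apply: (exchange hB _ _ ind) => [a i am|j]; [apply: mZ|apply: sp].
Qed.

Lemma subquotient_dim_uniq Z B d d' : submod B ->
  subquotient_dim m Z B d -> subquotient_dim m Z B d' -> d = d'.
Proof.
move=> hB h h'; apply/eqP; rewrite eqn_leq; apply/andP; split.
  have [_ [e [eZ _ ie]]] := h.
  by have := subquotient_dim_indep_le hB h' eZ ie; rewrite card_ord.
have [_ [e [eZ _ ie]]] := h'.
by have := subquotient_dim_indep_le hB h eZ ie; rewrite card_ord.
Qed.

Lemma subquotient_dim_spans Z B I (e : I -> V) : submod B ->
  killed m Z B -> (forall i, Z (e i)) -> spans Z B e -> exists d, subquotient_dim m Z B d.
Proof.
move=> hB mZ eZ sp.
have me a i : a \in m -> B (a *: e i) by move=> am; apply: mZ.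
have [d [f [_ fZ ind spf _]]] := basis_within hB (fun z (h : Z z) => h) mZ me sp.
by exists d; split=> //; exists f.
Qed.

End Submodules.

Definition sumfam I J V (e : I -> V) (f : J -> V) (i : I + J) : V :=
  match i with inl i => e i | inr j => f j end.

Lemma sum_sumfam (R : comNzRingType) (V : lmodType R) (I J : finType)
    (e : I -> V) (f : J -> V) (c : I + J -> R) :
  \sum_i c i *: sumfam e f i = \sum_i c (inl i) *: e i + \sum_j c (inr j) *: f j.
Proof. by rewrite big_sumType. Qed.

(** Counting dimensions along an exact sequence [Z'/B' -> Z/B -> Z2/B2] whose
second map is induced by [top]. *)
Section Extension.
Variables (R : comNzRingType) (m : idealr R) (mmax : maximal_ideal m).
Variables (V V2 : lmodType R) (top : {linear V -> V2}).
Variables (Z' B' Z B : V -> Prop) (Z2 B2 : V2 -> Prop).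
Hypotheses (hB : submod B) (hZ : submod Z) (hB2 : submod B2).
Hypothesis B'B : forall z, B' z -> B z.
Hypothesis topZ : forall z, Z z -> Z2 (top z).
Hypothesis exactZ : forall z, Z z -> B2 (top z) -> exists2 z', Z' z' & B (z - z').

Lemma ext_spans_lift (I J : finType) (e' : I -> V) (g : J -> V) :
  spans Z' B' e' -> (forall j, Z (g j)) ->
  (forall z, Z z -> exists c : J -> R, B2 (top z - \sum_j c j *: top (g j))) ->
  spans Z B (sumfam e' g).
Proof.
move=> sp' gZ sp2 z Zz; have [c Bc] := sp2 z Zz.
have [||z' Z'z' Bz'] := exactZ (z := z - \sum_j c j *: g j).
- by apply: submodB => //; apply: submod_sum => // j _; apply: submodZ.
- by rewrite linearB linear_sum; under eq_bigr do rewrite linearZ.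
have [c' Bc'] := sp' z' Z'z'.
exists (fun i => match i with inl i => c' i | inr j => c j end).
rewrite sum_sumfam [X in _ - X]addrC opprD addrA.
by have := submodD hB Bz' (B'B Bc'); rewrite addrA subrK.
Qed.

(** The new generators [g] lift a basis of the image of [Z] in [Z2/B2]. There are
at most [dim (Z2/B2)] of them, and if there are as many then [Z] maps onto [Z2/B2]. *)
Lemma ext_count (I J : finType) (e' : I -> V) (e2 : J -> V2) :
  spans Z' B' e' -> killed m Z2 B2 -> spans Z2 B2 e2 -> (forall j, Z2 (e2 j)) ->
  exists d (g : 'I_d -> V), [/\ (d <= #|J|)%N, forall j, Z (g j),
    spans Z B (sumfam e' g) &
    d = #|J| -> forall y, Z2 y -> exists2 z, Z z & B2 (y - top z)].
Proof.
move=> sp' mZ2 sp2 e2Z.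
pose Z1 y := exists2 z, Z z & y = top z.
have [y [z Zz ->]||d [f [le fZ1 _ sp1 full]]] :=
  @basis_within _ _ m mmax Z2 Z1 B2 J e2 hB2 _ mZ2 _ sp2.
- exact: topZ.
- by move=> a j am; apply: mZ2.
have /choice[g gP] : forall j, exists z, Z z /\ f j = top z.
  by move=> j; have [z Zz ->] := fZ1 j; exists z.
exists d, g; split=> [//|j||dJ y /(full dJ)[c Bc]]; first by case: (gP j).
  apply: ext_spans_lift sp' _ _ => [j|z Zz]; first by case: (gP j).
  have [|c Bc] := sp1 (top z); first by exists z.
  by exists c; under eq_bigr => j _ do rewrite -(proj2 (gP j)).
exists (\sum_j c j *: g j).
  by apply: submod_sum => // j _; apply: submodZ => //; case: (gP j).
by rewrite linear_sum; under eq_bigr => j _ do rewrite linearZ /= -(proj2 (gP j)).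
Qed.

(** When moreover [Z'/B' -> Z/B] is injective, a basis of [Z'/B'] and lifts of a
basis of the image stay independent. *)
Lemma ext_indep (I J : finType) (e' : I -> V) (g : J -> V) :
  submod Z' -> killed m Z B ->
  (forall z, Z' z -> B z -> B' z) -> (forall z, B z -> B2 (top z)) ->
  (forall i, Z' (e' i)) -> (forall i, top (e' i) = 0) -> indep m B' e' ->
  (forall j, Z (g j)) -> indep m B2 (fun j => top (g j)) ->
  indep m B (sumfam e' g).
Proof.
move=> hZ' mZ inj topB e'Z' tope' ind' gZ ind2 c; rewrite sum_sumfam => Bc.
have cg j : c (inr j) \in m.
  apply: (ind2 (fun j => c (inr j))); have := topB _ Bc.
  rewrite linearD !linear_sum /= big1 ?add0r => [|i _].
    by under eq_bigr do rewrite linearZ.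
  by rewrite linearZ /= tope' scaler0.
have ce : forall i, c (inl i) \in m.
  apply: (ind' (fun i => c (inl i))); apply: inj.
    by apply: submod_sum => // i _; apply: submodZ.
  rewrite -[X in B X](addrK (\sum_j c (inr j) *: g j)); apply: submodB => //.
  by apply: submod_sum => // j _; apply: mZ.
by case.
Qed.

End Extension.

(** * Twisted complexes over the Koszul algebra *)

Lemma kdiff0 (R : comNzRingType) n (M : lmodType R) (x : 'I_n -> R) :
  kdiff x (0 : kos n M) = 0.
Proof. exact: linear0. Qed.

Lemma kgrade0 (R : comNzRingType) n (M : lmodType R) : kgrade (0 : kos n M) = 0.
Proof. exact: linear0. Qed.

Lemma kleft0 (R : comNzRingType) n (M : lmodType R) j : kleft j (0 : kos n M) = 0.
Proof. exact: linear0. Qed.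

Lemma kpr_zero (R : comNzRingType) n (M : lmodType R) q : kpr q (0 : kos n M) = 0.
Proof. exact: linear0. Qed.

Section Words.
Variable L : finType.

Fixpoint words k : seq (seq L) :=
  if k is k'.+1 then [seq h :: v | h <- enum L, v <- words k'] else [:: [::]].

Fixpoint words_le k : seq (seq L) :=
  if k is k'.+1 then words_le k' ++ words k else words 0.

Lemma mem_words k v : (v \in words k) = (size v == k).
Proof.
elim: k v => [|k IH] v /=; first by rewrite inE size_eq0.
apply/allpairsP/idP => [[[h w] /= [_ hw ->]]|]; first by rewrite /= eqSS -IH.
by case: v => [//|h v]; rewrite /= eqSS -IH => hv; exists (h, v); rewrite /= mem_enum.
Qed.

Lemma mem_words_le k v : (v \in words_le k) = (size v <= k)%N.
Proof.
elim: k => [|k IH]; first by rewrite mem_words leqn0.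
by rewrite mem_cat IH mem_words orbC -leq_eqVlt.
Qed.

Lemma uniq_words k : uniq (words k).
Proof.
elim: k => [//|k IH]; apply: allpairs_uniq; rewrite ?enum_uniq //.
by move=> [h v] [g w] _ _ /= [-> ->].
Qed.

Lemma uniq_words_le k : uniq (words_le k).
Proof.
elim: k => [//|k IH]; rewrite cat_uniq IH uniq_words andbT; apply/hasPn => v.
by rewrite mem_words mem_words_le => /eqP ->; rewrite ltnn.
Qed.

Lemma big_words (V : nmodType) k (F : seq L -> V) :
  \sum_(v <- words k.+1) F v = \sum_h \sum_(v <- words k) F (h :: v).
Proof. by rewrite big_allpairs_dep big_enum. Qed.

Lemma big_words_le (V : nmodType) k l (F : seq L -> V) : (k <= l)%N ->
  (forall v, (k < size v)%N -> F v = 0) ->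
  \sum_(v <- words_le l) F v = \sum_(v <- words_le k) F v.
Proof.
move=> /subnK <- F0; elim: (l - k)%N => [//|d IH]; have F0s : \sum_(v <- words (d + k).+1) F v = 0.
  rewrite big_seq big1 // => v; rewrite mem_words => /eqP e.
  by apply: F0; rewrite e ltnS leq_addl.
by rewrite addSn big_cat IH F0s; apply: addr0.
Qed.

Lemma big_words1 (V : nmodType) (r : seq (seq L)) (F : seq L -> V) w :
  uniq r -> w \in r -> \sum_(v <- r) (if w == v then F v else 0) = F w.
Proof.
move=> ur wr; rewrite (bigD1_seq w) //= eqxx big1 ?addr0 // => v.
by rewrite eq_sym => /negPf ->.
Qed.

End Words.

Arguments words L k : simpl never.
Arguments words_le L k : simpl never.

Section Twisted.
Variables (R : comNzRingType) (n : nat) (x : 'I_n -> R).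
Variables (L : finType) (ldeg : L -> nat).
Local Notation K := (kos n R^o).
Local Notation chain M := (seq L -> kos n M).
Implicit Types (v w : seq L) (D : seq L -> chain R^o).

(** A letter [h] becomes a generator whose differential is a cycle of degree
[ldeg h], whence the shift by 1. *)
Definition wdeg v : nat := \sum_(h <- v) (ldeg h).+1.

Lemma wdeg_cons h v : wdeg (h :: v) = ((ldeg h).+1 + wdeg v)%N.
Proof. exact: big_cons. Qed.

Lemma wdeg_nil : wdeg [::] = 0%N.
Proof. exact: big_nil. Qed.

Lemma size_wdeg v : (size v <= wdeg v)%N.
Proof. by elim: v => [|h v IH]; rewrite ?wdeg_cons //= addSn ltnS (leq_trans IH) ?leq_addl. Qed.

Section Chains.
Variable M : lmodType R.
Implicit Types (u : chain M) (a : kos n M) (zeta : chain R^o).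

(** The differential of the chain [\sum_v u v (x) v] in the complex where the word
[v] is a generator with differential [D v], by the Leibniz rule. The cut at words
of length [k] keeps the sum finite; chains supported on words of length at most
[k] form the stage [F^k] of the filtration. *)
Definition gdiff D k u : chain M := fun w =>
  kdiff x (u w) + \sum_(v <- words_le L k) kmul (kgrade (u v)) (D v w).

Definition gact a zeta : chain M := fun w => kmul a (zeta w).
Definition gbas v a : chain M := fun w => if w == v then a else 0.
Definition gleft j u : chain M := fun w => kleft j (u w).
Definition gpr i u : chain M := fun w =>
  if (wdeg w <= i)%N then kpr (i - wdeg w)%N (u w) else 0.
Definition supp k u := forall w, (k < size w)%N -> u w = 0.

Fact gdiff_is_linear D k : linear (gdiff D k).
Proof.
move=> c u u'; apply/funext => w; rewrite /gdiff !fctE linearP /=.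
rewrite scalerDr addrACA; congr (_ + _); rewrite scaler_sumr -big_split /=.
by apply: eq_bigr => v _; rewrite linearP /= kmulDl kmulZl.
Qed.
HB.instance Definition _ D k := GRing.isLinear.Build R (chain M) (chain M) *:%R
  (gdiff D k) (gdiff_is_linear D k).

Fact gpr_is_linear i : linear (gpr i).
Proof.
move=> c u u'; apply/funext => w; rewrite /gpr !fctE; case: ifP => _.
  by rewrite linearP.
by rewrite scaler0 addr0.
Qed.
HB.instance Definition _ i := GRing.isLinear.Build R (chain M) (chain M) *:%R
  (gpr i) (gpr_is_linear i).

Fact gleft_is_linear j : linear (gleft j).
Proof. by move=> c u u'; apply/funext => w; rewrite /gleft !fctE linearP. Qed.
HB.instance Definition _ j := GRing.isLinear.Build R (chain M) (chain M) *:%R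
  (gleft j) (gleft_is_linear j).

Fact gbas_is_linear v : linear (gbas v).
Proof.
move=> c a b; apply/funext => w; rewrite /gbas !fctE; case: ifP => // _.
by rewrite scaler0 addr0.
Qed.
HB.instance Definition _ v := GRing.isLinear.Build R (kos n M) (chain M) *:%R
  (gbas v) (gbas_is_linear v).

Fact gact_is_zmod_morphism a : zmod_morphism (gact a).
Proof. by move=> u u'; apply/funext => w; rewrite /gact !fctE raddfB. Qed.
HB.instance Definition _ a := GRing.isZmodMorphism.Build (chain R^o) (chain M)
  (gact a) (gact_is_zmod_morphism a).

Lemma gdiff0 D k : gdiff D k 0 = 0. Proof. exact: linear0. Qed.
Lemma gdiffD D k u u' : gdiff D k (u + u') = gdiff D k u + gdiff D k u'.
Proof. exact: linearD. Qed.
Lemma gdiffN D k u : gdiff D k (- u) = - gdiff D k u.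
Proof. exact: linearN. Qed.
Lemma gdiffB D k u u' : gdiff D k (u - u') = gdiff D k u - gdiff D k u'.
Proof. exact: linearB. Qed.
Lemma gdiffZ D k c u : gdiff D k (c *: u) = c *: gdiff D k u.
Proof. exact: linearZ. Qed.
Lemma gdiff_sum D k I (r : seq I) (Q : pred I) (F : I -> chain M) :
  gdiff D k (\sum_(i <- r | Q i) F i) = \sum_(i <- r | Q i) gdiff D k (F i).
Proof. exact: linear_sum. Qed.

Lemma gpr0 i : gpr i 0 = 0. Proof. exact: linear0. Qed.
Lemma gprD i u u' : gpr i (u + u') = gpr i u + gpr i u'.
Proof. exact: linearD. Qed.
Lemma gprB i u u' : gpr i (u - u') = gpr i u - gpr i u'.
Proof. exact: linearB. Qed.
Lemma gprZ i c u : gpr i (c *: u) = c *: gpr i u.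
Proof. exact: linearZ. Qed.
Lemma gpr_sum i I (r : seq I) (Q : pred I) (F : I -> chain M) :
  gpr i (\sum_(i <- r | Q i) F i) = \sum_(j <- r | Q j) gpr i (F j).
Proof. exact: linear_sum. Qed.

Lemma gleft0 j : gleft j 0 = 0. Proof. exact: linear0. Qed.
Lemma gbas0 v : gbas v 0 = 0. Proof. exact: linear0. Qed.
Lemma gbasZ v c a : gbas v (c *: a) = c *: gbas v a. Proof. exact: linearZ. Qed.
Lemma gbas_sum v (I : finType) (P : pred I) (F : I -> kos n M) :
  gbas v (\sum_(i | P i) F i) = \sum_(i | P i) gbas v (F i).
Proof. exact: linear_sum. Qed.

Lemma gact0r a : gact a 0 = 0. Proof. exact: raddf0. Qed.
Lemma gactDr a zeta zeta' : gact a (zeta + zeta') = gact a zeta + gact a zeta'.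
Proof. exact: raddfD. Qed.
Lemma gactBr a zeta zeta' : gact a (zeta - zeta') = gact a zeta - gact a zeta'.
Proof. exact: raddfB. Qed.
Lemma gact_sumr a I (r : seq I) (Q : pred I) (F : I -> chain R^o) :
  gact a (\sum_(i <- r | Q i) F i) = \sum_(i <- r | Q i) gact a (F i).
Proof. exact: raddf_sum. Qed.

Lemma gactZr c a zeta : gact a (c *: zeta) = c *: gact a zeta.
Proof. by apply/funext => w; rewrite /gact !fctE kmulZr. Qed.

Lemma chain_subE u u' w S : (u - u') w S = u w S - u' w S.
Proof. by rewrite fctE !ffunE. Qed.

Lemma supp_submod k : submod (supp k).
Proof.
split=> [//|c u u' su su' w lt]; rewrite !fctE su // su' // scaler0 addr0 //.
Qed.

Lemma supp_le k l u : (k <= l)%N -> supp k u -> supp l u.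
Proof. by move=> kl su w lw; apply/su/(leq_ltn_trans kl). Qed.

Lemma supp_bas k v a : (size v <= k)%N -> supp k (gbas v a).
Proof. by move=> vk w kw; rewrite /gbas; case: eqP kw => // ->; rewrite ltnNge vk. Qed.

Lemma supp_pr k i u : supp k u -> supp k (gpr i u).
Proof. by move=> su w kw; rewrite /gpr su // linear0 if_same. Qed.

Lemma supp_act k a zeta : (forall w, (k < size w)%N -> zeta w = 0) -> supp k (gact a zeta).
Proof. by move=> su w kw; rewrite /gact su // raddf0. Qed.

Lemma gch_expand k u : supp k u -> u = \sum_(v <- words_le L k) gbas v (u v).
Proof.
move=> su; apply/funext => w; rewrite fct_sumE.
case: (leqP (size w) k) => [wk|kw].
  by rewrite (@big_words1 _ _ _ (fun v => u v)) ?uniq_words_le ?mem_words_le.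
rewrite su // big_seq big1 // => v; rewrite mem_words_le /gbas.
by case: eqP => // <-; rewrite leqNgt kw.
Qed.

Lemma gprK i u : gpr i (gpr i u) = gpr i u.
Proof. by apply/funext => w; rewrite /gpr; case: (wdeg w <= i)%N; rewrite ?kprK. Qed.

Lemma gdiff_widen D k l u : (k <= l)%N -> supp k u -> gdiff D l u = gdiff D k u.
Proof.
move=> kl su; apply/funext => w; rewrite /gdiff (big_words_le kl) // => v kv.
by rewrite su // !linear0 kmul0l.
Qed.

Lemma eq_gdiff D D' k u : (forall v, (size v <= k)%N -> D v = D' v) ->
  gdiff D k u = gdiff D' k u.
Proof.
move=> eqD; apply/funext => w; rewrite /gdiff; congr (_ + _).
rewrite big_seq [RHS]big_seq; apply: eq_bigr => v; rewrite mem_words_le => vk.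
by rewrite eqD.
Qed.

Lemma gdiff_bas D k v a : (size v <= k)%N ->
  gdiff D k (gbas v a) = gbas v (kdiff x a) + gact (kgrade a) (D v).
Proof.
move=> vk; apply/funext => w; rewrite /gdiff /gbas !fctE /gact; congr (_ + _).
  by case: ifP; rewrite ?linear0.
rewrite -(@big_words1 _ _ (words_le L k) (fun v => kmul (kgrade a) (D v w)));
  rewrite ?uniq_words_le ?mem_words_le //.
by apply: eq_bigr => v' _; rewrite eq_sym; case: eqP; rewrite // !linear0 kmul0l.
Qed.

Lemma gdiff_left D k j u : gdiff D k (gleft j u) = x j *: u - gleft j (gdiff D k u).
Proof.
apply/funext => w; rewrite /gdiff /gleft !fctE kdiff_left linearD opprD addrA.
congr (_ + _); rewrite linear_sum -sumrN; apply: eq_bigr => v _ /=.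
by rewrite kgrade_left kmulNl kleft_mul.
Qed.

End Chains.

Arguments gdiff {M}.

Lemma gdiff_act D (M : lmodType R) k (a : kos n M) (zeta : chain R^o) :
  gdiff D k (gact a zeta) = gact (kdiff x a) zeta + gact (kgrade a) (gdiff D k zeta).
Proof.
apply/funext => w; rewrite /gdiff /gact !fctE kdiff_mul -addrA; congr (_ + _).
rewrite kmulDr; congr (_ + _); rewrite (raddf_sum (kmul (kgrade a))).
by apply: eq_bigr => v _ /=; rewrite kgrade_mul kmulA.
Qed.

Lemma gact_assoc (M : lmodType R) (a : kos n M) (b : K) (zeta : chain R^o) :
  gact a (gact b zeta) = gact (kmul a b) zeta.
Proof. by apply/funext => w; rewrite /gact kmulA. Qed.

Lemma gact_gbas (M : lmodType R) (a : kos n M) (b : K) v :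
  gact a (gbas v b) = gbas v (kmul a b).
Proof. by apply/funext => w; rewrite /gact /gbas; case: ifP; rewrite // raddf0. Qed.

Lemma gactDl (M : lmodType R) (a b : kos n M) zeta :
  gact (a + b) zeta = gact a zeta + gact b zeta.
Proof. by apply/funext => w; rewrite /gact !fctE kmulDl. Qed.

Lemma gact0l (M : lmodType R) zeta : gact (0 : kos n M) zeta = 0.
Proof. by apply/funext => w; rewrite /gact kmul0l. Qed.

Lemma gactZl (M : lmodType R) r (a : kos n M) zeta : gact (r *: a) zeta = r *: gact a zeta.
Proof. by apply/funext => w; rewrite /gact !fctE kmulZl. Qed.

Lemma kmul_onel (b : K) r : kmul (kone (r : R^o)) b = r *: b.
Proof.
elim/kos_ind: b => [b c|s|j b IH]; first by rewrite kmulDr scalerDr => -> ->.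
  rewrite kmul_one; apply/ffunP => S; rewrite !ffunE.
  by case: ifP => _; [exact: mulrC|rewrite !scaler0].
by rewrite kmul_right IH linearZ.
Qed.

Lemma gact_kone r zeta : gact (kone (r : R^o)) zeta = r *: zeta.
Proof. by apply/funext => w; rewrite /gact !fctE kmul_onel. Qed.

(** Products of elements of positive degree have positive degree, so that the
coefficient at 1 is multiplicative. *)
Lemma kmul_set0 (M : lmodType R) (a : kos n M) (b : K) :
  kmul a b set0 = (b set0 : R) *: a set0.
Proof.
elim/kos_ind: b => [b c Hb Hc|r|j b IH].
- by rewrite kmulDr !ffunE Hb Hc scalerDl.
- by rewrite kmul_one !ffunE eqxx.
- by rewrite kmul_right !ffunE !inE scale0r.
Qed.

Section Homogeneous.
Variables (M : lmodType R) (D : seq L -> chain R^o) (k : nat).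
Hypothesis D_nil : D [::] = 0.
Hypothesis D_pr : forall v, (size v <= k)%N -> gpr (wdeg v).-1 (D v) = D v.

Lemma gpr_gdiff i (u : chain M) : gpr i (gdiff D k u) = gdiff D k (gpr i.+1 u).
Proof.
apply/funext => w; rewrite {1}/gpr /gdiff.
have -> : (if (wdeg w <= i)%N then kpr (i - wdeg w)
      (kdiff x (u w) + \sum_(v <- words_le L k) kmul (kgrade (u v)) (D v w)) else 0)
  = (if (wdeg w <= i)%N then kpr (i - wdeg w)%N (kdiff x (u w)) else 0) +
    \sum_(v <- words_le L k) (if (wdeg w <= i)%N then
       kpr (i - wdeg w)%N (kmul (kgrade (u v)) (D v w)) else 0).
  case: ifP => _; last by rewrite big1 // addr0.
  by rewrite linearD linear_sum.
congr (_ + _).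
  rewrite /gpr; case: (leqP (wdeg w) i) => wi.
    by rewrite kpr_diff subSn // leqW.
  case: leqP => wi'; last by rewrite linear0.
  have -> : (i.+1 - wdeg w = 0)%N by apply/eqP; rewrite subn_eq0.
  by rewrite kdiff_kpr0.
rewrite big_seq [RHS]big_seq; apply: eq_bigr => v; rewrite mem_words_le => vk.
case: v vk => [_|h v vk]; first by rewrite D_nil !raddf0 if_same.
rewrite -D_pr // wdeg_cons addSn /= {1 3}/gpr.
set e := (ldeg h + wdeg v)%N; case: (leqP (wdeg w) e) => we; last first.
  by rewrite !raddf0 if_same.
rewrite /gpr wdeg_cons addSn ltnS -/e.
case: (leqP e i) => ei.
  rewrite (leq_trans we ei) subSS -kpr_grade -kpr_mul; congr (kpr _ _).
  by rewrite addnBA // subnK.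
rewrite linear0 kmul0l; case: leqP => // wi; apply: kpr_mul_lt.
by rewrite ltn_sub2r // (leq_ltn_trans wi).
Qed.

Lemma wdeg_eq0 w : (wdeg w == 0%N) = (w == [::]).
Proof. by case: w => [|h w]; rewrite ?wdeg_nil ?wdeg_cons. Qed.

Lemma gdiff_gpr0 (u : chain M) : gdiff D k (gpr 0 u) = 0.
Proof.
apply/funext => w; rewrite /gdiff /gpr leqn0; case: ifP => [_|ne].
  rewrite kdiff_kpr0 add0r big1 // => v _.
  rewrite leqn0 wdeg_eq0; case: eqP => [->|_]; first by rewrite D_nil raddf0.
  by rewrite linear0 kmul0l.
rewrite linear0 add0r big1 // => v _.
rewrite leqn0 wdeg_eq0; case: eqP => [->|_]; first by rewrite D_nil raddf0.
by rewrite linear0 kmul0l.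
Qed.

End Homogeneous.

End Twisted.

Arguments supp_submod {R n L M} k.

Definition zeroE := (kdiff0, kgrade0, kleft0, kpr_zero, gdiff0, gpr0, gbas0, gleft0).

(** * The Golod resolution *)

(** Cycles [lz h] of positive degree [ldeg h] that represent, together with 1, a
basis of the Koszul homology of [R]. *)
Record letters (R : comNzRingType) (m : {pred R}) n (x : 'I_n -> R) := Letters {
  ltype : finType;
  lz : ltype -> kos n R^o;
  ldeg : ltype -> nat;
  ldeg_gt0 : forall h, (0 < ldeg h)%N;
  lz_pr : forall h, kpr (ldeg h) (lz h) = lz h;
  lz_cycle : forall h, kdiff x (lz h) = 0;
  lz_gen : forall a : kos n R^o, kdiff x a = 0 ->
    exists (r : R^o) (c : ltype -> R) theta,
      a = kone r + \sum_h c h *: lz h + kdiff x theta;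
  lz_ind : forall (r : R^o) (c : ltype -> R) theta,
    kone r + \sum_h c h *: lz h = kdiff x theta -> forall h, c h \in m
}.

Section GolodResolution.
Variables (R : comNzRingType) (m : idealr R) (n : nat) (x : 'I_n -> R).
Hypothesis xgen : generated_by m x setT.
Variable H : letters m x.
Local Notation L := (ltype H).
Local Notation K := (kos n R^o).
Local Notation chain M := (seq L -> kos n M).
Local Notation wdeg := (wdeg (@ldeg _ _ _ _ H)).
Local Notation gpr := (gpr (@ldeg _ _ _ _ H)).
Local Notation gdiff := (gdiff x).
Local Notation words := (words L).
Implicit Types (v w : seq L) (D : seq L -> chain R^o).

Lemma mgen a : a \in m <-> exists c : 'I_n -> R, a = \sum_j c j * x j.
Proof.
by split=> [/xgen[c ->]|[c ->]]; [|apply/xgen]; exists c; apply: eq_bigl => j;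
  rewrite finset.in_setT.
Qed.

Lemma xm j : x j \in m.
Proof.
apply/mgen; exists (fun i => (i == j)%:R); rewrite (bigD1 j) //= eqxx mul1r.
by rewrite big1 ?addr0 // => i /negPf ->; rewrite mul0r.
Qed.

Lemma kill_kdiff (M : lmodType R) a (z : kos n M) :
  a \in m -> kdiff x z = 0 -> exists theta, a *: z = kdiff x theta.
Proof.
move=> /mgen[c ->] dz; exists (\sum_j c j *: kleft j z).
rewrite linear_sum scaler_suml; apply: eq_bigr => j _.
by rewrite linearZ /= kdiff_left dz zeroE subr0 scalerA.
Qed.

Lemma kdiff_aug (a : K) : (kdiff x a set0 : R) \in m.
Proof.
rewrite kdiffE; apply: rpred_sum => j _; set b := a _.
rewrite (_ : _ *: b = (b * koszul_sign R (j |: set0) j) * x j); first exact/idealMr/xm.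
by rewrite -mulrA [RHS]mulrC.
Qed.

(** [D] is the differential of a complex [F^0 <= ... <= F^k], where [F^i] is the
free module over the Koszul algebra on the words of length at most [i]. The
last clause says that a word [h :: v] of length [i + 1] kills a cycle of [F^i]
whose image in the Koszul homology of [F^i / F^(i-1)] is [lz h (x) v] up to
multiples of the words of length [i]. *)
Record twist k D : Prop := Twist {
  twist_low : forall v w, (size v <= k)%N -> (size v <= size w)%N -> D v w = 0;
  twist_pr : forall v, (size v <= k)%N -> gpr (wdeg v).-1 (D v) = D v;
  twist_cycle : forall v, (size v <= k)%N -> gdiff D k (D v) = 0;
  twist_top : forall h v w, (size v < k)%N -> size w = size v ->
    exists r : R^o, D (h :: v) w = (if w == v then lz h else 0) - kone r
}.

Section Twist.
Variables (k : nat) (D : seq L -> chain R^o) (tD : twist k D).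

Lemma twist_nil : D [::] = 0.
Proof. by apply/funext => w; rewrite (twist_low tD). Qed.

Lemma twist_le l : (l <= k)%N -> twist l D.
Proof.
move=> lk; have le v : (size v <= l)%N -> (size v <= k)%N by move=> vl; apply: leq_trans lk.
split=> [v w vl vw|v vl|v vl|h v w vl]; first exact/(twist_low tD)/vw/le.
- exact/(twist_pr tD)/le.
- rewrite -(twist_cycle tD (le v vl)); symmetry; apply: gdiff_widen => // w lw.
  by apply: (twist_low tD); [exact: le|apply: leq_trans vl (ltnW lw)].
- by apply: (twist_top tD); apply: leq_trans lk.
Qed.

Lemma gdiff_supp (M : lmodType R) (u : chain M) l : (l <= k)%N ->
  supp l u -> supp l (gdiff D l u).
Proof.
move=> lk su w lw; rewrite /gdiff su // zeroE add0r big_seq big1 // => v.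
rewrite mem_words_le => vl; rewrite (twist_low tD) ?raddf0 //.
  exact: leq_trans lk.
exact: leq_trans vl (ltnW lw).
Qed.

Lemma gdiff_top (M : lmodType R) (u : chain M) l w : (l <= k)%N -> size w = l ->
  gdiff D l u w = kdiff x (u w).
Proof.
move=> lk sw; rewrite /gdiff big_seq big1 ?addr0 // => v; rewrite mem_words_le => vl.
by rewrite (twist_low tD) ?raddf0 ?sw // (leq_trans vl).
Qed.

Lemma gdiffK (M : lmodType R) (u : chain M) l : (l <= k)%N -> supp l u ->
  gdiff D l (gdiff D l u) = 0.
Proof.
move=> lk su; rewrite (gch_expand su) !gdiff_sum big_seq big1 //= => v.
rewrite mem_words_le => vl; rewrite gdiff_bas // gdiffD gdiff_bas //.
rewrite gdiff_act kdiffK kgradeK kdiff_grade zeroE add0r.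
rewrite (twist_cycle (twist_le lk)) // raddf0 addr0 -gactDl.
by rewrite addrN gact0l.
Qed.

Lemma gpr_gdiffk (M : lmodType R) i l (u : chain M) : (l <= k)%N ->
  gpr i (gdiff D l u) = gdiff D l (gpr i.+1 u).
Proof.
move=> lk; apply: gpr_gdiff twist_nil _ _ _ => v vl.
exact: (twist_pr (twist_le lk)).
Qed.

Lemma twist_aug v : (size v <= k)%N -> D v [::] set0 = 0.
Proof.
move=> vk; rewrite -(twist_pr tD) // /gpr wdeg_nil leq0n subn0 ffunE cards0.
case: v vk => [_|h v _]; first by rewrite twist_nil ffunE if_same.
by rewrite wdeg_cons addSn /= eq_sym addn_eq0 -leqn0 leqNgt ldeg_gt0.
Qed.

Lemma gdiff_aug l (u : chain R^o) : (l <= k)%N -> gdiff D l u [::] set0 \in m.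
Proof.
move=> lk; rewrite /gdiff ffunE sum_ffunE [X in _ + X]big_seq [X in _ + X]big1 ?addr0; last first.
  move=> v; rewrite mem_words_le => vl.
  by rewrite kmul_set0 twist_aug ?scale0r // (leq_trans vl).
exact: kdiff_aug.
Qed.

End Twist.

(** The cycles of [F^k] that the augmentation to the residue field kills: in a
resolution all of them have to bound. *)
Definition aug_cycle D k (zeta : chain R^o) :=
  [/\ supp k zeta, gdiff D k zeta = 0 & zeta [::] set0 \in m].

(** Passing to the words of length [k] on both sides turns the relation into one
between the cycles [lz h], scalars and Koszul boundaries. *)
Lemma words_indep k D (c : seq L -> R) eta : twist k.+1 D -> supp k eta ->
  \sum_(v <- words k.+1) c v *: D v = gdiff D k eta ->
  forall v, size v = k.+1 -> c v \in m.
Proof.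
move=> tD se e [//|h v] [sv].
have := congr1 (fun f => f v) e; rewrite fct_sumE (gdiff_top tD) // big_words => e'.
have /choice[r rP] : forall g, exists r : seq L -> R^o, forall w, size w = k ->
    D (g :: w) v = (if v == w then lz g else 0) - kone (r w).
  move=> g; have /choice[r rP] : forall w, exists r : R^o, size w = k ->
      D (g :: w) v = (if v == w then lz g else 0) - kone r.
    move=> w; case: (size w =P k) => [sw|]; last by exists 0.
    have [||r e1] := twist_top tD g (v := w) (w := v); rewrite ?sw ?sv //; by exists r.
  by exists r.
apply: (lz_ind (l := H) (r := - \sum_g \sum_(w <- words k) c (g :: w) * r g w)
   (c := fun g => c (g :: v)) (theta := eta v)).
rewrite -e' raddfN raddf_sum /= addrC -sumrB; apply: eq_bigr => g _.
rewrite raddf_sum /= -[X in X - _](@big_words1 _ _ (words k) (fun w => c (g :: w) *: lz g));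
  rewrite ?uniq_words ?mem_words ?sv //.
rewrite -sumrB big_seq [RHS]big_seq; apply: eq_bigr => w; rewrite mem_words => /eqP sw.
rewrite fctE rP // scalerBr -linearZ; congr (_ - _).
by case: ifP; rewrite ?scaler0.
Qed.

(** The words of length [k + 1] kill the homology of [F^k] in the kernel of the
augmentation. As 1 is a cycle, the coefficient of [eta] at 1 is free; it is set to
0 for the sake of [fm_aug] below. *)
Definition gen_prop k D := forall zeta, aug_cycle D k zeta ->
  exists (c : seq L -> R) eta, [/\ supp k eta, eta [::] set0 = 0 &
    zeta = \sum_(v <- words k.+1) c v *: D v + gdiff D k eta].

Lemma supp_top_sum (M : lmodType R) k (th : seq L -> kos n M) :
  supp k (\sum_(v <- words k) gbas v (th v)).
Proof.
move=> w kw; rewrite fct_sumE big_seq big1 // => v; rewrite mem_words => /eqP sv.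
by rewrite (supp_bas (k := k)) // sv.
Qed.

Lemma top_sumE (M : lmodType R) k (th : seq L -> kos n M) w : size w = k ->
  (\sum_(v <- words k) gbas v (th v)) w = th w.
Proof.
by move=> sw; rewrite fct_sumE big_words1 ?uniq_words // mem_words sw.
Qed.

Lemma top_sum_out (M : lmodType R) k (th : seq L -> kos n M) w : size w != k ->
  (\sum_(v <- words k) gbas v (th v)) w = 0.
Proof.
move=> sw; rewrite fct_sumE big_seq big1 // => v; rewrite mem_words => /eqP sv.
by rewrite /gbas; case: eqP => // e; rewrite e sv eqxx in sw.
Qed.

Lemma gdiff_scalar_top D k (c : seq L -> R) :
  gdiff D k (\sum_(v <- words k) gbas v (kone (c v : R^o))) =
  \sum_(v <- words k) c v *: D v.
Proof.
rewrite gdiff_sum big_seq [RHS]big_seq; apply: eq_bigr => v.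
rewrite mem_words => /eqP sv.
by rewrite gdiff_bas ?sv // kdiff_one zeroE add0r kgrade_one gact_kone.
Qed.

Lemma supp_pred (M : lmodType R) k (u : chain M) : supp k.+1 u ->
  (forall w, size w = k.+1 -> u w = 0) -> supp k u.
Proof.
move=> su u0 w; rewrite leq_eqVlt => /orP[/eqP/esym/u0 //|]; exact: su.
Qed.

(** A cycle of [F^k] is a boundary of [F^k] once its leading terms are homologous
to scalars. These scalars are in [m] by [words_indep], or by the augmentation if
[k] is 0, so that they bound in the Koszul complex and the leading terms can be
removed; and a cycle of [F^(k-1)] bounds in [F^k]. *)
Lemma bound_of_scalar_top k D zeta : twist k D ->
  (forall k', k = k'.+1 -> gen_prop k' D) -> aug_cycle D k zeta ->
  (forall w, size w = k -> exists (r : R^o) theta, zeta w = kone r + kdiff x theta) ->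
  exists2 eta, supp k eta & zeta = gdiff D k eta.
Proof.
move=> tD gen [sz dz az] tops.
have /choice[r /choice[th thP]] : forall w, exists (r : R^o) theta, size w = k ->
    zeta w = kone r + kdiff x theta.
  move=> w; case: (size w =P k) => [/tops[r [theta e]]|]; first by exists r, theta.
  by exists 0, 0.
(* Subtracting a boundary of [F^k] changes the leading terms by Koszul boundaries. *)
have step (th' : seq L -> K) : let z := zeta - gdiff D k (\sum_(v <- words k) gbas v (th' v)) in
    aug_cycle D k z /\ forall w, size w = k -> z w = zeta w - kdiff x (th' w).
  split; first split.
  - apply: (submodB (supp_submod k)) => //; apply: (gdiff_supp tD) => //.
    exact: supp_top_sum.
  - by rewrite gdiffB dz (gdiffK tD) ?subr0 //; exact: supp_top_sum.
  - by rewrite chain_subE rpredB // (gdiff_aug tD).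
  by move=> w sw; rewrite !fctE (gdiff_top tD) // top_sumE.
have rm w : size w = k -> (r w : R) \in m.
  have [[s1 d1 a1] top1] := step th.
  have {}top1 v : size v = k -> (zeta - gdiff D k (\sum_(v <- words k) gbas v (th v))) v
    = kone (r v) by move=> sv; rewrite top1 // thP // addrK.
  case: k => [|k'] in tD gen sz dz az tops thP step s1 d1 a1 top1 *.
    move=> /size0nil ->; move: a1; rewrite top1 // ffunE eqxx //.
  set z := zeta - _ in s1 d1 a1 top1.
  pose rho := z - \sum_(v <- words k'.+1) gbas v (kone (r v)).
  have srho : supp k' rho.
    apply: supp_pred => [|v sv].
      apply: (submodB (supp_submod _)) => //; exact: supp_top_sum.
    by rewrite /rho !fctE top1 // top_sumE // subrr.
  apply: (words_indep (c := r) tD (eta := - rho)).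
    exact: (submodN (supp_submod _)).
  rewrite gdiffN -(gdiff_widen _ _ (leqnSn k') srho) /rho gdiffB d1 sub0r opprK.
  by rewrite gdiff_scalar_top.
have /choice[th' th'P] : forall w, exists theta : K, size w = k ->
    kone (r w) = kdiff x theta.
  move=> w; case: (size w =P k) => [/rm rmw|]; last by exists 0.
  have [theta e] := kill_kdiff rmw (kdiff_one x (1 : R^o)).
  by exists theta => _; rewrite -e -linearZ /=; congr kone; rewrite /= [RHS]mulr1.
have [ac top2] := step (fun w => th' w + th w).
set z := zeta - _ in ac top2.
have {}top2 w : size w = k -> z w = 0.
  by move=> sw; rewrite top2 // linearD /= -th'P // -thP // subrr.
suff [eta se ze] : exists2 eta, supp k eta & z = gdiff D k eta.
  exists (eta + \sum_(v <- words k) gbas v (th' v + th v)).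
    apply: (submodD (supp_submod k)) => //; exact: supp_top_sum.
  by rewrite gdiffD -ze /z subrK.
clearbody z; clear zeta sz dz az tops th thP step rm th' th'P.
case: k => [|k'] in tD gen ac top2 *.
  exists 0; first exact: (submod0 (supp_submod _)).
  rewrite zeroE; apply/funext => w; case: ac => sz' _ _.
  by case: (posnP (size w)) => [/top2|/sz'].
have [|c [eta [se _ ->]]] := gen k' erefl z.
  case: ac => s2 d2 a2; have s2' := supp_pred s2 top2; split=> //.
  by rewrite -(gdiff_widen _ _ (leqnSn k') s2').
exists (\sum_(v <- words k'.+1) gbas v (kone (c v : R^o)) + eta).
  apply: (submodD (supp_submod _)); first exact: supp_top_sum.
  exact: supp_le se.
by rewrite gdiffD (gdiff_widen _ _ (leqnSn k') se) gdiff_scalar_top.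
Qed.

(** The leading terms of a cycle of [F^k] are Koszul cycles, hence combinations of 1
and the [lz h] up to boundaries. Subtracting the cycles [D (h :: w)] with the same
coefficients leaves scalars, to which [bound_of_scalar_top] applies. *)
Lemma gen_step k D : twist k.+1 D -> (forall k', k = k'.+1 -> gen_prop k' D) ->
  gen_prop k D.
Proof.
move=> tD gen zeta [sz dz az].
have tD' : twist k D := twist_le tD (leqnSn k).
have /choice[r /choice[b /choice[th thP]]] : forall w, exists (r : R^o) (b : L -> R) theta,
     size w = k -> zeta w = kone r + \sum_h b h *: lz h + kdiff x theta.
  move=> w; case: (size w =P k) => [sw|]; last by exists 0, (fun _ => 0), 0.
  have [|r [b [th e]]] := lz_gen H (a := zeta w); last by exists r, b, th.
  by rewrite -(gdiff_top tD' zeta (leqnn k) sw) dz.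
pose c v := if v is h :: w then b w h else 0.
pose s := \sum_(v <- words k.+1) c v *: D v.
have [||eta se ze] := @bound_of_scalar_top k D (zeta - s) tD' gen.
- split.
  + apply: (submodB (supp_submod k)) => // w kw; rewrite /s fct_sumE big_seq big1 // => v.
    by rewrite mem_words => /eqP sv; rewrite fctE (twist_low tD) ?sv // scaler0.
  + rewrite gdiffB dz sub0r /s gdiff_sum big_seq big1 ?oppr0 // => v.
    rewrite mem_words => /eqP sv; rewrite gdiffZ -(gdiff_widen _ _ (leqnSn k)).
      by rewrite (twist_cycle tD) ?sv // scaler0.
    by move=> w kw; rewrite (twist_low tD) ?sv.
  + rewrite chain_subE rpredB // /s fct_sumE sum_ffunE big_seq rpred_sum // => v.
    by rewrite mem_words => /eqP sv; rewrite fctE ffunE (twist_aug tD) ?sv // scaler0 rpred0.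
- move=> w sw; have /choice[q qP] : forall h, exists q : seq L -> R^o, forall v, size v = k ->
      D (h :: v) w = (if w == v then lz h else 0) - kone (q v).
    move=> h; have /choice[q qP] : forall v, exists q : R^o, size v = k ->
      D (h :: v) w = (if w == v then lz h else 0) - kone q.
      move=> v; case: (size v =P k) => [sv|]; last by exists 0.
      have [||q e1] := twist_top tD h (v := v) (w := w); rewrite ?sw ?sv //; by exists q.
    by exists q.
  exists (r w + \sum_h \sum_(v <- words k) c (h :: v) * q h v), (th w).
  rewrite !fctE thP // addrAC; congr (_ + _).
  rewrite /s fct_sumE big_words linearD /= -addrA; congr (_ + _).
  rewrite [RHS]linear_sum /= -sumrB; apply: eq_bigr => h _; rewrite [RHS]linear_sum /=.
  rewrite -(@big_words1 _ _ (words k) (fun v => c (h :: v) *: lz h));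
    rewrite ?uniq_words ?mem_words ?sw //.
  rewrite -sumrB big_seq [RHS]big_seq; apply: eq_bigr => v; rewrite mem_words => /eqP sv.
  rewrite fctE qP // scalerBr -linearZ /= opprB addrCA.
  by case: ifP; rewrite ?scaler0 ?subrr ?addr0 ?subr0.
exists c, (eta - gbas [::] (kone (eta [::] set0 : R^o))); split.
- by apply: (submodB (supp_submod k)) => //; apply: supp_bas.
- by rewrite chain_subE /gbas eqxx ffunE eqxx subrr.
rewrite gdiffB -ze gdiff_bas // kdiff_one zeroE add0r kgrade_one gact_kone.
by rewrite (twist_nil tD) scaler0 subr0 addrC subrK.
Qed.

Lemma twist_gen k D : twist k.+1 D -> gen_prop k D.
Proof.
elim: k => [|k IH] tD; apply: gen_step => // k' [<-].
exact/IH/(twist_le tD).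
Qed.

End GolodResolution.

Section GolodResolutionExists.
Variables (R : comNzRingType) (m : idealr R) (n : nat) (x : 'I_n -> R).
Hypothesis xgen : generated_by m x setT.
Variable H : letters m x.
Local Notation L := (ltype H).
Local Notation chain M := (seq L -> kos n M).
Local Notation wdeg := (wdeg (@ldeg _ _ _ _ H)).
Local Notation gpr := (gpr (@ldeg _ _ _ _ H)).
Local Notation gdiff := (gdiff x).
Local Notation twist := (@twist R m n x H).
Implicit Types (v w : seq L) (D : seq L -> chain R^o).

Lemma twist_ext k D D' : (forall v, (size v <= k)%N -> D v = D' v) ->
  twist k D -> twist k D'.
Proof.
move=> e [low pr cyc top]; split=> [v w vk|v vk|v vk|h v w vk].
- by rewrite -e //; apply: low.
- by rewrite -e //; apply: pr.
- by rewrite -(eq_gdiff x _ e) -e //; apply: cyc.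
- by rewrite -e //; apply: top.
Qed.

(** The differential of [lz h (x) v] is the product of [lz h] with [D v], a cycle of
the previous stage without term at 1. By [twist_gen] it is a combination of
differentials [D w] of words of the length of [v] plus a boundary of that stage,
and correcting [lz h (x) v] accordingly gives a cycle. The words [w] come with
scalar coefficients, which is the indeterminacy allowed by [twist_top]. *)
Lemma new_generator k D h v : twist k D -> size v = k ->
  exists y : chain R^o, [/\ supp k y, gdiff D k y = 0,
    gpr (wdeg (h :: v)).-1 y = y &
    forall w, size w = k -> exists r : R^o, y w = (if w == v then lz h else 0) - kone r].
Proof.
move=> tD sv; set e := (wdeg (h :: v)).-1.
have eE : e = (ldeg h + wdeg v)%N by rewrite /e wdeg_cons.
(* A homogeneous component of a cycle of the right shape still has that shape. *)
suff [y [sy dy ty]] : exists y : chain R^o, [/\ supp k y, gdiff D k y = 0 &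
    forall w, size w = k -> exists r : R^o, y w = (if w == v then lz h else 0) - kone r].
  exists (gpr e y); split; [exact: supp_pr| |exact: gprK|].
    have e0 : e = e.-1.+1 by rewrite prednK // eE addn_gt0 ldeg_gt0.
    by rewrite e0 -(gpr_gdiffk tD) // dy zeroE.
  move=> w sw; have [r yw] := ty w sw; rewrite /gpr yw linearB /= kpr_one.
  case: (w =P v) => [->|_].
    rewrite eE leq_addl addnK lz_pr (negPf (lt0n_neq0 (ldeg_gt0 h))).
    by exists 0; rewrite (raddf0 kone).
  case: ifP => _; last by exists 0; rewrite (raddf0 kone) subr0.
  by rewrite linear0; case: ifP => _; [exists r|exists 0; rewrite (raddf0 kone)].
have db : gdiff D k (gbas v (lz h)) = gact (kgrade (lz h)) (D v).
  by rewrite gdiff_bas ?sv // lz_cycle zeroE add0r.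
case: k => [|k] in tD sv db *.
  exists (gbas v (lz h)); split; first by apply: supp_bas; rewrite sv.
    by move/size0nil: sv => -> in db *; rewrite db (twist_nil tD) raddf0.
  by move=> w _; exists 0; rewrite (raddf0 kone) subr0.
have [|c [eta [se _ ze]]] := twist_gen xgen tD (zeta := gact (kgrade (lz h)) (D v)).
  have sD : supp k (D v).
    by move=> w kw; rewrite (twist_low tD) ?sv.
  split; first by apply: supp_act.
    rewrite gdiff_act kdiff_grade lz_cycle zeroE oppr0 gact0l add0r.
    by rewrite -(gdiff_widen _ _ (leqnSn k) sD) (twist_cycle tD) ?sv // raddf0.
  by rewrite /gact kmul_set0 (twist_aug tD) ?sv // scale0r rpred0.
exists (gbas v (lz h) - \sum_(w <- words L k.+1) gbas w (kone (c w : R^o)) - eta); split.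
- apply: (submodB (supp_submod _)); last exact: supp_le se.
  by apply: (submodB (supp_submod _)); [apply: supp_bas; rewrite sv|exact: supp_top_sum].
- rewrite !gdiffB db ze (gdiff_widen _ _ (leqnSn k) se) gdiff_scalar_top.
  by rewrite [X in X - _ - _]addrC addrK subrr.
move=> w sw; exists (c w); rewrite !fctE top_sumE // se ?sw // subr0.
by rewrite /gbas.
Qed.

Lemma twist_extend k D : twist k D ->
  exists D', twist k.+1 D' /\ forall v, (size v <= k)%N -> D v = D' v.
Proof.
move=> tD.
have /choice[y yP] : forall hv : L * seq L, exists y : chain R^o, size hv.2 = k ->
   [/\ supp k y, gdiff D k y = 0, gpr (wdeg (hv.1 :: hv.2)).-1 y = y &
    forall w, size w = k ->
      exists r : R^o, y w = (if w == hv.2 then lz hv.1 else 0) - kone r].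
  move=> [h v] /=; case: (size v =P k) => [sv|]; last by exists 0.
  by have [y hy] := new_generator h tD sv; exists y.
pose D' v := if v is h :: w then if size w == k then y (h, w) else D v else D v.
have D'E v : (size v <= k)%N -> D v = D' v.
  by case: v => [//|h v] /= vk; rewrite ltn_eqF.
have D'k h v : size v = k -> D' (h :: v) = y (h, v) by move=> /= ->; rewrite eqxx.
have tD' : twist k D' := twist_ext D'E tD.
exists D'; split=> //.
have split_k v : (size v <= k.+1)%N -> (size v <= k)%N \/ exists h w, v = h :: w /\ size w = k.
  rewrite leq_eqVlt ltnS => /orP[|]; last by left.
  by case: v => [//|h w] /eqP[sw]; right; exists h, w.
split=> [v w /split_k[vk|[h [v' [-> sv]]]]|v /split_k[vk|[h [v' [-> sv]]]]
        |v /split_k[vk|[h [v' [-> sv]]]]|h v w].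
- exact: (twist_low tD').
- by rewrite D'k //; have [sy _ _ _] := yP (h, v') sv; rewrite /= sv; apply: sy.
- exact: (twist_pr tD').
- by rewrite D'k //; have [_ _ py _] := yP (h, v') sv.
- rewrite (gdiff_widen _ _ (leqnSn k)); first exact: (twist_cycle tD').
  by move=> w kw; rewrite (twist_low tD') // (leq_trans vk) // ltnW.
- rewrite D'k //; have [sy dy _ _] := yP (h, v') sv.
  by rewrite (gdiff_widen _ _ (leqnSn k)) // -(eq_gdiff _ _ D'E).
rewrite ltnS leq_eqVlt => /orP[/eqP sv sw|vk sw]; last by apply: (twist_top tD').
by rewrite D'k //; have [_ _ _ ty] := yP (h, v) sv; apply: ty; rewrite sw sv.
Qed.

Lemma twist_exists : exists D, forall k, twist k D.
Proof.
have t0 : twist 0 (0 : seq L -> chain R^o).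
  by split=> [//|v _|v _|//]; rewrite zeroE.
have step k (D : {D | twist k D}) : {D' : {D' | twist k.+1 D'} |
    forall v, (size v <= k)%N -> sval D v = sval D' v}.
  have /cid[D' [tD' e]] := twist_extend (svalP D).
  by exists (exist _ D' tD').
pose F := fix F k : {D | twist k D} :=
  if k is k'.+1 then sval (step k' (F k')) else exist _ _ t0.
have FS k v : (size v <= k)%N -> sval (F k.+1) v = sval (F k) v.
  by move=> vk; rewrite /= -(svalP (step k (F k)) v vk).
have FE k v : (size v <= k)%N -> sval (F k) v = sval (F (size v)) v.
  by move=> /subnK <-; elim: (k - size v)%N => [//|d IH]; rewrite addSn FS ?leq_addl.
exists (fun v => sval (F (size v)) v) => k.
by apply: twist_ext (svalP (F k)) => v; apply: FE.
Qed.

End GolodResolutionExists.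

(** * Descent along the retraction *)

Section Bounds.
Variables (R : comNzRingType) (m : idealr R) (n : nat) (x : 'I_n -> R).
Variable H : letters m x.
Local Notation L := (ltype H).
Local Notation chain M := (seq L -> kos n M).
Variable D : seq L -> chain R^o.
Hypothesis tD : forall k, twist k D.

(** The products of Koszul cycles of [M] with the cycles of [F^k] that are killed
in [F^(k+1)] bound in [F^k (x) M]. *)
Definition bounding (M : lmodType R) := forall k v (z : kos n M),
  size v = k.+1 -> kdiff x z = 0 ->
  exists2 eta, supp k eta & gact z (D v) = gdiff x D k eta.

(** Every cycle of [(F^k / F^(k-1)) (x) M] lifts to a cycle of [F^k (x) M]: as the
differential of the quotient is that of the Koszul complex on each word, it
suffices to lift the cycles [z (x) v]. *)
Definition lifting (M : lmodType R) := forall v (z : kos n M), kdiff x z = 0 ->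
  exists u, [/\ supp (size v) u, gdiff x D (size v) u = 0 &
    forall w, size w = size v -> u w = if w == v then z else 0].

(** The differential of [z (x) v] is, up to sign, the product of [z] with [D v]. Thus
[z (x) v] lifts to a cycle, by adding terms of the previous stage, exactly when
this product bounds there. *)
Lemma bounding_of_lifting M : lifting M -> bounding M.
Proof.
move=> lift k v z sv dz; have [|u [su du tu]] := lift v (kgrade z).
  by rewrite kdiff_grade dz zeroE oppr0.
rewrite sv in su du tu; have s' : supp k (gbas v (kgrade z) - u).
  apply: supp_pred; first by apply: (submodB (supp_submod _)) => //; apply: supp_bas; rewrite sv.
  by move=> w sw; rewrite !fctE tu // subrr.
exists (gbas v (kgrade z) - u) => //.
rewrite -(gdiff_widen _ _ (leqnSn k)) // gdiffB du subr0 gdiff_bas ?sv //.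
by rewrite kdiff_grade dz zeroE oppr0 zeroE add0r kgradeK.
Qed.

Lemma lifting_of_bounding M : bounding M -> lifting M.
Proof.
move=> bnd v z dz; case sv: (size v) => [|k].
  exists (gbas v z); split=> //; first by apply: supp_bas; rewrite sv.
  move/size0nil: sv => ->; rewrite gdiff_bas // dz zeroE add0r.
  by rewrite (twist_nil (tD 0)) gact0r.
have [|eta se e] := bnd k v (kgrade z) sv; first by rewrite kdiff_grade dz zeroE oppr0.
exists (gbas v z - eta); split.
- apply: (submodB (supp_submod _)); last exact: supp_le se.
  by apply: supp_bas; rewrite sv.
- by rewrite gdiffB gdiff_bas ?sv // dz zeroE add0r e (gdiff_widen _ _ (leqnSn k)) // subrr.
by move=> w sw; rewrite !fctE se ?sw // subr0.
Qed.

Lemma aug_cycleD k v : size v = k.+1 -> aug_cycle D k (D v).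
Proof.
move=> sv; have sD : supp k (D v) by move=> w kw; rewrite (twist_low (tD k.+1)) ?sv.
split=> //; last by rewrite (twist_aug (tD k.+1)) ?sv // rpred0.
by rewrite -(gdiff_widen _ _ (leqnSn k) sD) (twist_cycle (tD k.+1)) ?sv.
Qed.

Lemma gact_gdiff (M : lmodType R) k (z : kos n M) eta : kdiff x z = 0 ->
  gact z (gdiff x D k eta) = gdiff x D k (gact (kgrade z) eta).
Proof. by move=> dz; rewrite gdiff_act kdiff_grade dz zeroE oppr0 gact0l add0r kgradeK. Qed.

End Bounds.

Section Descent.
Variables (R A : comNzRingType) (mR : idealr R) (mA : idealr A).
Variables (j : {rmorphism R -> A}) (p : {rmorphism A -> R}).
Hypotheses (hj : local_hom mR mA j) (hp : local_hom mA mR p).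
Hypothesis hpj : forall r, p (j r) = r.
Variables (r n : nat) (x : 'I_r -> R) (y : 'I_n -> A).
Hypotheses (xgen : generated_by mR x setT) (ygen : generated_by mA y setT).
Variables (C : 'I_r -> 'I_n -> A) (C' : 'I_n -> 'I_r -> R).
Hypothesis jx : forall i, j (x i) = \sum_l C i l * y l.
Hypothesis py : forall l, p (y l) = \sum_i C' l i * x i.
Hypothesis CC' : forall i k, \sum_l p (C i l) * C' l k = (i == k)%:R.
Variables (HR : letters mR x) (HA : letters mA y).
Local Notation LR := (ltype HR).
Local Notation LA := (ltype HA).
Local Notation chainR M := (seq LR -> kos r M).
Local Notation chainA N := (seq LA -> kos n N).
Variables (DR : seq LR -> chainR R^o) (DA : seq LA -> chainA A^o).
Hypotheses (tR : forall k, twist k DR) (tA : forall k, twist k DA).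

Local Notation sigma := (kmap C (reg_morph j)).
Local Notation pi := (kmap C' (reg_morph p)).

Lemma sigmaK : cancel sigma pi.
Proof. by apply: (kmap_comp_id (p := p)) CC'; [exact: reg_morphZ|exact: hpj]. Qed.

Section Psi.
Variables (N : lmodType A) (M : lmodType R) (f : {additive N -> M}).
Hypothesis fZ : forall c v, f (c *: v) = p c *: f v.
Variable Psi : seq LA -> chainR R^o.

(** The map of twisted complexes over [pi] that sends the word [v] to [Psi v]. *)
Definition psi k (u : chainA N) : chainR M :=
  \sum_(v <- words_le LA k) gact (kmap C' f (u v)) (Psi v).

Fact psi_is_zmod_morphism k : zmod_morphism (psi k).
Proof.
move=> u u'; rewrite -sumrB; apply: eq_bigr => v _; rewrite !fctE raddfB /=.
by rewrite -scaleN1r gactDl gactZl scaleN1r.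
Qed.
HB.instance Definition _ k := GRing.isZmodMorphism.Build (chainA N) (chainR M) (psi k)
  (psi_is_zmod_morphism k).

Lemma psiZ k c u : psi k (c *: u) = p c *: psi k u.
Proof.
rewrite scaler_sumr; apply: eq_bigr => v _; rewrite fctE.
by rewrite (kmapZ _ fZ) gactZl.
Qed.

Lemma psi_bas k v a : (size v <= k)%N -> psi k (gbas v a) = gact (kmap C' f a) (Psi v).
Proof.
move=> vk; rewrite -[RHS](@big_words1 _ _ (words_le LA k)
   (fun v => gact (kmap C' f a) (Psi v)));
  rewrite ?uniq_words_le ?mem_words_le //.
apply: eq_bigr => w _; rewrite /gbas eq_sym; case: ifP => // _.
by rewrite raddf0 gact0l.
Qed.

Lemma psi_widen k l u : (k <= l)%N -> supp k u -> psi l u = psi k u.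
Proof.
move=> kl su; apply: big_words_le => // v kv.
by rewrite su // raddf0 gact0l.
Qed.

Lemma psi_supp k u : (forall v, (size v <= k)%N -> supp (size v) (Psi v)) -> supp k (psi k u).
Proof.
move=> sP w kw; rewrite /psi fct_sumE big_seq big1 // => v; rewrite mem_words_le => vk.
by rewrite /gact sP ?raddf0 // (leq_ltn_trans vk).
Qed.

End Psi.

Lemma psi_act (N : lmodType A) (M : lmodType R) (f : {additive N -> M}) (fZ : forall c v, f (c *: v) = p c *: f v)
    Psi k (a : kos n N) (zeta : chainA A^o) :
  psi f Psi k (gact a zeta) = gact (kmap C' f a) (psi (reg_morph p) Psi k zeta).
Proof.
rewrite /psi raddf_sum; apply: eq_bigr => v _ /=.
by rewrite gact_assoc /gact (kmap_mul _ fZ).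
Qed.

(** The conditions on the images of the words of length at most [k] under which
[psi] is a filtered chain map. *)
Record filtered_map k (Psi : seq LA -> chainR R^o) : Prop := FilteredMap {
  fm_nil : Psi [::] = gbas [::] (kone (1 : R^o));
  fm_supp : forall v, (size v <= k)%N -> supp (size v) (Psi v);
  fm_diff : forall v, (size v <= k)%N ->
    gdiff x DR k (Psi v) = psi (reg_morph p) Psi k (DA v);
  fm_top : forall v w, (size v <= k)%N -> size w = size v ->
    exists b : R^o, Psi v w = kone b;
  fm_aug : forall v, (size v <= k)%N -> v != [::] -> (Psi v [::] set0 : R) \in mR
}.

(** Surjectivity of [psi] on the homology in the kernel of the augmentation. *)
Definition onto k Psi := forall zeta, aug_cycle DR k zeta ->
  exists2 zeta', aug_cycle DA k zeta' &
  exists2 eta, supp k eta & zeta - psi (reg_morph p) Psi k zeta' = gdiff x DR k eta.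

Section Filtered.
Variables (k : nat) (Psi : seq LA -> chainR R^o) (fP : filtered_map k Psi).

Lemma psi_gdiff (N : lmodType A) (M : lmodType R) (f : {additive N -> M}) (fZ : forall c v, f (c *: v) = p c *: f v)
    (u : chainA N) : supp k u ->
  psi f Psi k (gdiff y DA k u) = gdiff x DR k (psi f Psi k u).
Proof.
move=> su; rewrite (gch_expand su) (raddf_sum (psi f Psi k)) !(raddf_sum (gdiff _ _ k)) (raddf_sum (psi f Psi k)).
rewrite big_seq [RHS]big_seq; apply: eq_bigr => v; rewrite mem_words_le => vk /=.
rewrite gdiff_bas // psi_bas // (raddfD (psi f Psi k)) /= psi_bas // (psi_act fZ) gdiff_act.
by rewrite (fm_diff fP) // kmap_grade (kmap_diff fZ _ py).
Qed.

Lemma psi_aug_cycle zeta : aug_cycle DA k zeta ->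
  aug_cycle DR k (psi (reg_morph p) Psi k zeta).
Proof.
case=> sz dz az; split; first exact/psi_supp/(fm_supp fP).
  by rewrite -(psi_gdiff (reg_morphZ p)) // dz raddf0.
rewrite /psi fct_sumE sum_ffunE big_seq rpred_sum // => v; rewrite mem_words_le => vk.
rewrite /gact kmul_set0.
have pi0 (a : kos n A^o) : pi a set0 = p (a set0).
  have := congr1 (fun b : kos r R^o => b set0) (kpr_kmap C' (reg_morph p) 0 a).
  by rewrite !kpr0 kmap_one !ffunE eqxx.
case: (v =P [::]) => [->|/eqP nv].
  by rewrite pi0 (fm_nil fP) /gbas eqxx ffunE eqxx scale1r hp.
rewrite -[X in X \in _]/((Psi v [::] set0 : R) * (pi (zeta v) set0 : R)) mulrC.
exact/idealMr/(fm_aug fP).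
Qed.

End Filtered.

Lemma filtered_map0 : exists2 Psi, filtered_map 0 Psi & onto 0 Psi.
Proof.
pose Psi (v : seq LA) : chainR R^o := gbas [::] (kone (1 : R^o)).
exists Psi.
  split=> // [v _|v|v w|v]; rewrite ?leqn0 ?size_eq0.
  - exact: supp_bas.
  - move=> /eqP ->; rewrite (twist_nil (tA 0)) raddf0 gdiff_bas //.
    by rewrite kdiff_one zeroE add0r (twist_nil (tR 0)) raddf0.
  - move=> /eqP -> /size0nil ->; exists 1; by rewrite /Psi /gbas eqxx.
  - by move=> ->.
move=> zeta [sz dz az].
have ze : zeta = gbas [::] (zeta [::]).
  by apply/funext => w; rewrite /gbas; case: w => [//|h w]; rewrite sz.
have d0 : kdiff x (zeta [::]) = 0 by rewrite -(gdiff_top (tR 0) zeta (leqnn 0)) ?dz.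
exists (gbas [::] (sigma (zeta [::]))); last first.
  exists 0; first exact: (submod0 (supp_submod _)).
  rewrite zeroE psi_bas // sigmaK {1}ze gact_gbas kmul_one scale1r.
  by rewrite subrr.
split; first exact: supp_bas.
  rewrite gdiff_bas // (twist_nil (tA 0)) raddf0 addr0.
  by rewrite -(kmap_diff (reg_morphZ j) _ jx) d0 raddf0 zeroE.
rewrite /gbas eqxx.
have := congr1 (fun b : kos n A^o => b set0) (kpr_kmap C (reg_morph j) 0 (zeta [::])).
by rewrite !kpr0 kmap_one !ffunE eqxx => ->; apply: hj.
Qed.


Lemma psi_top k Psi (b : seq LA -> seq LR -> R^o) (u : chainA A^o) w :
  filtered_map k Psi ->
  (forall v w, size v = k -> size w = k -> Psi v w = kone (b v w)) ->
  size w = k ->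
  psi (reg_morph p) Psi k u w = \sum_(v <- words LA k) (b v w : R) *: pi (u v).
Proof.
move=> fP bP sw; have e0 (F : seq LA -> kos r R^o) :
    (forall v, (size v < k)%N -> F v = 0) ->
    \sum_(v <- words_le LA k) F v = \sum_(v <- words LA k) F v.
  case: k sw {fP bP} => [//|k] _ F0; rewrite -[words_le _ _]/(words_le LA k ++ words LA k.+1).
  rewrite big_cat /= [X in X + _]big_seq [X in X + _]big1 ?add0r // => v.
  by rewrite mem_words_le => vk; apply: F0.
rewrite /psi fct_sumE e0 => [|v vk].
  rewrite big_seq [RHS]big_seq; apply: eq_bigr => v; rewrite mem_words => /eqP sv.
  by rewrite /gact bP // kmul_one.
by rewrite /gact (fm_supp fP) ?raddf0 ?sw // ltnW.
Qed.

(** For a word [v] of length [k + 1], [psi] of the differential of [v] is a cycle of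
[F^k] over [R], so that [twist_gen] writes it as the differential of a
combination of words of length [k + 1] plus an element of [F^k]: this element of
[F^(k+1)] is the image of [v]. *)
Lemma filtered_map_extend k Psi : filtered_map k Psi ->
  exists Psi', filtered_map k.+1 Psi' /\ forall v, (size v <= k)%N -> Psi' v = Psi v.
Proof.
move=> fP.
have /choice[b /choice[eta hP]] : forall v, exists (b : seq LR -> R) eta, size v = k.+1 ->
    [/\ supp k eta, eta [::] set0 = 0 & psi (reg_morph p) Psi k (DA v) =
      \sum_(w <- words LR k.+1) b w *: DR w + gdiff x DR k eta].
  move=> v; case: (size v =P k.+1) => [sv|]; last by exists (fun _ => 0), 0.
  have [b [eta h]] := twist_gen xgen (tR k.+1) (psi_aug_cycle fP (aug_cycleD tA sv)).
  by exists b, eta.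
pose new v : chainR R^o := \sum_(w <- words LR k.+1) gbas w (kone (b v w : R^o)) + eta v.
pose Psi' v := if size v == k.+1 then new v else Psi v.
have PsiE v : (size v <= k)%N -> Psi' v = Psi v.
  by move=> vk; rewrite /Psi' ltn_eqF.
have psiE zeta : supp k zeta -> psi (reg_morph p) Psi' k.+1 zeta = psi (reg_morph p) Psi k zeta.
  move=> sz; rewrite (psi_widen _ _ (leqnSn k)) //; apply: eq_big_seq => v.
  by rewrite mem_words_le => vk; rewrite PsiE.
have supp_new v : size v = k.+1 -> supp k.+1 (new v).
  move=> /hP[se _ _]; apply: (submodD (supp_submod _)); first exact: supp_top_sum.
  exact: supp_le se.
have lt_k v : (size v <= k.+1)%N -> size v = k.+1 \/ (size v <= k)%N.
  by rewrite leq_eqVlt ltnS => /orP[/eqP|]; [left|right].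
exists Psi'; split=> //; split.
- by rewrite PsiE // (fm_nil fP).
- move=> v /lt_k[sv|vk]; last by rewrite PsiE //; apply: (fm_supp fP).
  by rewrite /Psi' sv eqxx; apply: supp_new.
- move=> v /lt_k[sv|vk].
    have [sD _ _] := aug_cycleD tA sv; have [se _ e] := hP v sv.
    rewrite psiE // e /Psi' sv eqxx /new gdiffD gdiff_scalar_top.
    by rewrite (gdiff_widen _ _ (leqnSn k) se).
  have sD : supp k (DA v).
    by move=> w kw; rewrite (twist_low (tA k)) // (leq_trans vk) // ltnW.
  rewrite psiE // PsiE // (gdiff_widen _ _ (leqnSn k)) ?(fm_diff fP) //.
  exact: supp_le (fm_supp fP vk).
- move=> v w /lt_k[sv|vk] sw; last by rewrite PsiE //; apply: (fm_top fP).
  have [se _ _] := hP v sv; exists (b v w).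
  by rewrite /Psi' sv eqxx /new !fctE top_sumE ?sw // se ?sw ?sv // addr0.
- move=> v /lt_k[sv|vk] nv; last by rewrite PsiE //; apply: (fm_aug fP).
  have [_ e0 _] := hP v sv; rewrite /Psi' sv eqxx /new fctE top_sum_out //.
  by rewrite !ffunE e0 addr0 rpred0.
Qed.

(** By [twist_gen] it suffices to reach the cycles [DR (h :: w')]. By induction
[DR w'] is, up to a boundary, the image of a cycle [S] of [F^k] over [A], which is a
combination of the [DA v]. The product of the lift [sigma (lz h)] with [S] is again
a combination of the [DA v] up to a boundary, and this relation is a cycle
[zeta'] of [F^(k+1)] over [A]. The leading terms of its image are those of
[DR (h :: w')] up to scalars and boundaries, because [sigma] is a section of
[pi]; so [bound_of_scalar_top] applies to the difference. *)
Lemma onto_step k Psi Psi' : filtered_map k Psi -> onto k Psi ->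
  filtered_map k.+1 Psi' -> (forall v, (size v <= k)%N -> Psi' v = Psi v) ->
  onto k.+1 Psi'.
Proof.
move=> fP oP fP' PsiE.
have psiE zeta : supp k zeta -> psi (reg_morph p) Psi' k.+1 zeta = psi (reg_morph p) Psi k zeta.
  move=> sz; rewrite (psi_widen _ _ (leqnSn k)) //; apply: eq_big_seq => v.
  by rewrite mem_words_le => vk; rewrite PsiE.
have /choice[b bP] : forall v, exists b : seq LR -> R^o, forall w,
    size v = k.+1 -> size w = k.+1 -> Psi' v w = kone (b w).
  move=> v; have /choice[b bP] : forall w, exists b : R^o,
      size v = k.+1 -> size w = k.+1 -> Psi' v w = kone b.
    move=> w; case: (size v =P k.+1) => [sv|]; last by exists 0.
    case: (size w =P k.+1) => [sw|]; last by exists 0.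
    by have [||c e] := fm_top fP' (v := v) (w := w); rewrite ?sv ?sw //; exists c.
  by exists b.
have single h w' : size w' = k.+1 -> exists2 zeta', aug_cycle DA k.+1 zeta' &
    exists2 eta, supp k.+1 eta &
    DR (h :: w') - psi (reg_morph p) Psi' k.+1 zeta' = gdiff x DR k.+1 eta.
  move=> sw'.
  have [xi axi [eta0 seta0 e0]] := oP _ (aug_cycleD tR sw').
  have [a [eta1 [se1 _ xie]]] := twist_gen ygen (tA k.+1) axi.
  (* The image of [\sum_v a v (x) v] has leading part [w'], modulo the maximal
     ideal, as its differential is homologous to [DR w']. *)
  pose q w := (w == w')%:R - \sum_(v <- words LA k.+1) (b v w : R) * p (a v).
  have qm w : size w = k.+1 -> q w \in mR.
    pose low v := Psi' v - \sum_(w <- words LR k.+1) gbas w (kone (b v w)).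
    have slow v : size v = k.+1 -> supp k (low v).
      move=> sv; apply: supp_pred => [|w1 sw1].
        apply: (submodB (supp_submod _)); last exact: supp_top_sum.
        by rewrite -sv; apply: (fm_supp fP'); rewrite sv.
      by rewrite /low !fctE top_sumE // bP // subrr.
    apply: (words_indep (c := q) (tR k.+1) (eta := eta0 + psi (reg_morph p) Psi k eta1 +
        \sum_(v <- words LA k.+1) p (a v) *: low v)).
      apply: (submodD (supp_submod _)); first apply: (submodD (supp_submod _)) => //.
        exact/psi_supp/(fm_supp fP).
      move=> w1 kw1; rewrite fct_sumE big_seq big1 // => v; rewrite mem_words => /eqP sv.
      by rewrite fctE slow // scaler0.
    rewrite !gdiffD -(psi_gdiff fP (reg_morphZ p)) // -e0.
    have -> : gdiff x DR k (\sum_(v <- words LA k.+1) p (a v) *: low v) =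
       \sum_(v <- words LA k.+1) p (a v) *: psi (reg_morph p) Psi k (DA v)
       - \sum_(w1 <- words LR k.+1) (\sum_(v <- words LA k.+1) (b v w1 : R) * p (a v)) *: DR w1.
      rewrite gdiff_sum.
      under [X in _ - X]eq_bigr => w1 _ do rewrite scaler_suml.
      rewrite exchange_big -sumrB big_seq [RHS]big_seq; apply: eq_bigr => v.
      rewrite mem_words => /eqP sv /=; rewrite gdiffZ.
      have [sD _ _] := aug_cycleD tA sv.
      rewrite -psiE // -(fm_diff fP') ?sv // -(gdiff_widen _ _ (leqnSn k) (slow v sv)).
      rewrite /low gdiffB gdiff_scalar_top scalerBr; congr (_ - _).
      by rewrite scaler_sumr; apply: eq_bigr => w1 _; rewrite scalerA mulrC.
    rewrite xie raddfD raddf_sum /=.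
    under [X in _ - (X + _)]eq_bigr => v _ do rewrite (psiZ (reg_morphZ p)).
    rewrite /q; under eq_bigr => w1 _ do rewrite scalerBl.
    rewrite sumrB; have -> : \sum_(w1 <- words LR k.+1) (w1 == w')%:R *: DR w1 = DR w'.
      rewrite -[RHS](@big_words1 _ _ (words LR k.+1) DR w') ?uniq_words ?mem_words ?sw' //.
      by apply: eq_bigr => w1 _; rewrite eq_sym; case: ifP; rewrite ?scale1r ?scale0r.
    have tele (V : zmodType) (d t s g : V) : d - t = d - (s + g) + g + (s - t).
      by rewrite opprD [d + (_ - _)]addrA subrK addrA subrK.
    exact: tele.
  have dz : kdiff y (sigma (lz h)) = 0.
    by rewrite -(kmap_diff (reg_morphZ j) _ jx) lz_cycle raddf0.
  pose z' := sigma (lz h); pose S := \sum_(v <- words LA k.+1) a v *: DA v.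
  have [c [eta' [se' e0' ce]]] : exists (c : seq LA -> A) eta', [/\ supp k eta',
      eta' [::] set0 = 0 & gact (kgrade z') S =
       \sum_(v <- words LA k.+1) c v *: DA v + gdiff y DA k eta'].
    apply: (twist_gen ygen (tA k.+1)).
    have [sxi dxi _] := axi.
    have SE : S = xi - gdiff y DA k eta1 by rewrite xie addrK.
    have sS : supp k S.
      rewrite SE; apply: (submodB (supp_submod _)) => //.
      exact: (gdiff_supp (tA k)).
    split; first exact: supp_act.
      rewrite gdiff_act kdiff_grade dz zeroE oppr0 gact0l add0r SE.
      by rewrite gdiffB dxi (gdiffK (tA k)) // subrr raddf0.
    rewrite /gact kmul_set0 /S fct_sumE sum_ffunE big_seq big1 ?scale0r ?rpred0 // => v.
    by rewrite mem_words => /eqP sv; rewrite fctE ffunE (twist_aug (tA k.+1)) ?sv // scaler0.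
  (* The relation between the [DA v] obtained from [S], as a cycle of [F^(k+1)]. *)
  pose top v := a v *: z' - kone (c v : A^o).
  pose zeta' := \sum_(v <- words LA k.+1) gbas v (top v) - eta'.
  have topE v : size v = k.+1 -> zeta' v = top v.
    by move=> sv; rewrite /zeta' !fctE top_sumE // se' ?sv // subr0.
  have azeta' : aug_cycle DA k.+1 zeta'.
    split.
    - apply: (submodB (supp_submod _)); first exact: supp_top_sum.
      exact: supp_le se'.
    - rewrite /zeta' gdiffB (gdiff_widen _ _ (leqnSn k) se') gdiff_sum.
      apply/eqP; rewrite subr_eq0 -(inj_eq (addrI (\sum_(v <- words LA k.+1) c v *: DA v))).
      rewrite -ce /S gact_sumr -big_split big_seq [X in _ == X]big_seq; apply/eqP.
      apply: eq_bigr => v; rewrite mem_words => /eqP sv /=.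
      rewrite gdiff_bas ?sv // /top linearB /= kdiff_one subr0 linearZ /= dz scaler0.
      rewrite gbas0 add0r linearB /= kgrade_one linearZ /= gactZr.
      by rewrite -scaleN1r gactDl !gactZl gact_kone scaleN1r addrC subrK.
    - by rewrite /zeta' chain_subE top_sum_out // ffunE e0' subrr rpred0.
  exists zeta' => //.
  have aD1 : aug_cycle DR k.+1 (DR (h :: w')) by apply: (aug_cycleD tR); rewrite /= sw'.
  have aD2 := psi_aug_cycle fP' azeta'.
  apply: (bound_of_scalar_top xgen (tR k.+1)) => [k' _||w sw].
  - exact: (twist_gen xgen (tR k'.+1)).
  - have [s1 d1 a1] := aD1; have [s2 d2 a2] := aD2; split; first exact: (submodB (supp_submod _)).
      by rewrite gdiffB d1 d2 subrr.
    by rewrite chain_subE rpredB.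
  have [||rho rhoE] := twist_top (tR k.+2) h (v := w') (w := w); rewrite ?sw ?sw' //.
  have dq : exists theta, q w *: lz h = kdiff x theta.
    by apply: (kill_kdiff xgen); [exact: qm|exact: lz_cycle].
  have [theta qe] := dq.
  exists (- rho + \sum_(v <- words LA k.+1) (b v w : R) * p (c v)), theta.
  rewrite !fctE rhoE (psi_top _ fP' bP) // -qe /q scalerBl scaler_suml.
  rewrite big_seq; under eq_bigr => v.
    rewrite mem_words => /eqP sv; rewrite topE // /top raddfB /= (kmapZ _ (reg_morphZ p)).
    rewrite sigmaK kmap_one scalerBr scalerA; over.
  rewrite -big_seq sumrB [X in _ = X + _](raddfD kone) /= (raddfN kone) (raddf_sum kone) /=.
  have -> : (w == w')%:R *: lz h = if w == w' then lz h else 0.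
    by case: ifP; rewrite ?scale1r ?scale0r.
  have tele (V : zmodType) (d e s t : V) : d - e - (s - t) = - e + t + (d - s).
    by rewrite opprB [RHS]addrACA [- e + d]addrC.
  under [X in _ = _ + X + _]eq_bigr => v _ do rewrite -[_ * _]/(_ *: (_ : R^o)) linearZ.
  exact: tele.
move=> zeta az; have [c [eta [se _ ->]]] := twist_gen xgen (tR k.+2) az.
have /choice[z' /choice[e' P]] : forall w, exists z' e', size w = k.+2 ->
    [/\ aug_cycle DA k.+1 z', supp k.+1 e' &
     DR w - psi (reg_morph p) Psi' k.+1 z' = gdiff x DR k.+1 e'].
  move=> w; case: (size w =P k.+2) => [|]; last by exists 0, 0.
  case: w => [//|h w] [/(single h)[z' az' [e' se' ee]]].
  by exists z', e'.
exists (\sum_(w <- words LR k.+2) j (c w) *: z' w).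
  split.
  - move=> w kw; rewrite fct_sumE big_seq big1 // => v; rewrite mem_words => /eqP sv.
    by have [[sz _ _] _ _] := P v sv; rewrite fctE sz // scaler0.
  - rewrite gdiff_sum big_seq big1 // => v; rewrite mem_words => /eqP sv.
    by have [[_ dz _] _ _] := P v sv; rewrite gdiffZ dz scaler0.
  - rewrite fct_sumE sum_ffunE big_seq rpred_sum // => v; rewrite mem_words => /eqP sv.
    have [[_ _ az'] _ _] := P v sv; rewrite fctE ffunE; exact: idealMr.
exists (\sum_(w <- words LR k.+2) c w *: e' w + eta).
  apply: (submodD (supp_submod _)) => // w kw; rewrite fct_sumE big_seq big1 // => v.
  by rewrite mem_words => /eqP sv; have [_ se' _] := P v sv; rewrite fctE se' // scaler0.
rewrite gdiffD addrAC; congr (_ + _).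
rewrite (raddf_sum (psi (reg_morph p) Psi' k.+1)) [RHS]gdiff_sum -sumrB.
rewrite big_seq [RHS]big_seq; apply: eq_bigr => v; rewrite mem_words => /eqP sv.
have [_ _ e] := P v sv; rewrite /= [RHS]gdiffZ -e (psiZ (reg_morphZ p)) hpj.
by rewrite scalerBr.
Qed.

Lemma onto_exists k : exists2 Psi, filtered_map k Psi & onto k Psi.
Proof.
elim: k => [|k [Psi fP oP]]; first exact: filtered_map0.
have [Psi' [fP' PsiE]] := filtered_map_extend fP.
by exists Psi' => //; apply: onto_step PsiE.
Qed.

(** By [onto_exists], the cycles that are killed in the Golod resolution over [R]
come from [A] up to boundaries, and so do the Koszul cycles of [M]; their products
bound over [R] because they do over [A]. *)
Theorem bounding_descent (M : lmodType R) :
  bounding DA (restrict_scalars M p) -> bounding DR M.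
Proof.
move=> bA k w z sw dz; have [Psi fP oP] := onto_exists k.
pose N := restrict_scalars M p.
pose f : {additive N -> M} := idfun; pose g : {additive M -> N} := idfun.
have fZ c v : f (c *: v) = p c *: f v by [].
have gZ c v : g (c *: v) = j c *: g v by rewrite /g /= -[RHS]/(p (j c) *: v) hpj.
have zK : kmap C' f (kmap C g z) = z by apply: (kmap_comp_id (g := g) fZ _ CC').
have dz' : kdiff y (kmap C g z) = 0 by rewrite -(kmap_diff gZ _ jx) dz raddf0.
have [zeta' az' [eta se e]] := oP _ (aug_cycleD tR sw).
have [a [eta1 [se1 _ ze]]] := twist_gen ygen (tA k.+1) az'.
have /choice[u uP] : forall v, exists u : chainA N, size v = k.+1 ->
    supp k u /\ gact (kmap C g z) (DA v) = gdiff y DA k u.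
  move=> v; case: (size v =P k.+1) => [sv|]; last by exists 0.
  by have [u su ue] := bA k v _ sv dz'; exists u.
pose Y := \sum_(v <- words LA k.+1) a v *: u v + gact (kgrade (kmap C g z)) eta1.
have sY : supp k Y.
  apply: (submodD (supp_submod _)); last exact: supp_act.
  move=> w1 kw; rewrite fct_sumE big_seq big1 // => v; rewrite mem_words => /eqP sv.
  by have [su _] := uP v sv; rewrite fctE su // scaler0.
have Ye : gact (kmap C g z) zeta' = gdiff y DA k Y.
  rewrite ze gactDr gact_gdiff // gdiffD; congr (_ + _).
  rewrite gact_sumr gdiff_sum big_seq [RHS]big_seq; apply: eq_bigr => v.
  rewrite mem_words => /eqP sv; have [_ ue] := uP v sv.
  by rewrite gactZr ue gdiffZ.
exists (gact (kgrade z) eta + psi f Psi k Y).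
  apply: (submodD (supp_submod _)); first exact: supp_act.
  exact/psi_supp/(fm_supp fP).
rewrite gdiffD -(psi_gdiff fP fZ) // -Ye (psi_act fZ) zK -gact_gdiff // -e.
by rewrite gactBr subrK.
Qed.

End Descent.

(** * Counting dimensions along the filtration by word length *)

(** Homogeneous cycles that represent a basis of the Koszul homology of [M] over
the residue field. *)
Record koszul_basis_of (R : comNzRingType) (m : {pred R}) n (x : 'I_n -> R)
    (M : lmodType R) := KoszulBasisOf {
  btype : finType;
  bz : btype -> kos n M;
  bdeg : btype -> nat;
  bz_pr : forall b, kpr (bdeg b) (bz b) = bz b;
  bz_cycle : forall b, kdiff x (bz b) = 0;
  bz_gen : forall z : kos n M, kdiff x z = 0 ->
    exists (c : btype -> R) theta, z = \sum_b c b *: bz b + kdiff x theta;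
  bz_ind : forall (c : btype -> R) theta,
    \sum_b c b *: bz b = kdiff x theta -> forall b, c b \in m
}.

Lemma sum_words_tuple (L : finType) (V : nmodType) k (F : seq L -> V) :
  \sum_(v <- words L k) F v = \sum_(t : k.-tuple L) F t.
Proof.
rewrite -big_enum -(big_map (@tval k L) xpredT F) /=; apply: perm_big.
apply: uniq_perm; rewrite ?uniq_words ?map_inj_uniq ?enum_uniq //.
- by rewrite -enumT enum_uniq.
- exact: val_inj.
move=> v; rewrite mem_words; apply/eqP/mapP => [sv|[t _ ->]]; last exact: size_tuple.
by exists (tcast sv (in_tuple v)); rewrite ?mem_enum // val_tcast.
Qed.

Section Counting.
Variables (R : comNzRingType) (m : idealr R) (mmax : maximal_ideal m).
Variables (n : nat) (x : 'I_n -> R).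
Hypothesis xgen : generated_by m x setT.
Variable H : letters m x.
Variable M : lmodType R.
Variable B : koszul_basis_of m x M.
Local Notation L := (ltype H).
Local Notation chain := (seq L -> kos n M).
Local Notation wdeg := (wdeg (@ldeg _ _ _ _ H)).
Local Notation gpr := (gpr (@ldeg _ _ _ _ H)).
Local Notation words := (words L).
Variable D : seq L -> seq L -> kos n R^o.
Hypothesis tD : forall k, twist k D.
Local Notation gd := (gdiff x D).
Implicit Types (u z : chain) (k i : nat).

Definition vanish k u := forall w, (k <= size w)%N -> u w = 0.

(** [Zf k i] and [Bf k i] are the cycles and boundaries of degree [i] in
[F^(k-1) (x) M], [Zg k i] and [Bg k i] those of the quotient
[(F^k / F^(k-1)) (x) M], which is called the layer of the words of length [k]; its
differential is [kd], and [top k] is the projection. *)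
Definition Zf k i u := [/\ vanish k u, gpr i u = u & gd k u = 0].
Definition Bf k i u := exists eta, [/\ vanish k eta, gpr i.+1 eta = eta & u = gd k eta].
Definition layer k u := forall w, size w != k -> u w = 0.
Definition kd u : chain := fun w => kdiff x (u w).
Definition Zg k i u := [/\ layer k u, gpr i u = u & kd u = 0].
Definition Bg k i u := exists eta, [/\ layer k eta, gpr i.+1 eta = eta & u = kd eta].
Definition top k u : chain := fun w => if size w == k then u w else 0.

Fact top_is_linear k : linear (top k).
Proof.
move=> c u u'; apply/funext => w; rewrite /top !fctE; case: ifP => // _.
by rewrite scaler0 addr0.
Qed.
HB.instance Definition _ k := GRing.isLinear.Build R chain chain *:%R (top k) (top_is_linear k).

Fact kd_is_linear : linear kd.
Proof. by move=> c u u'; apply/funext => w; rewrite /kd !fctE linearP. Qed.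
HB.instance Definition _ := GRing.isLinear.Build R chain chain *:%R kd kd_is_linear.

Lemma top0 k : top k 0 = 0. Proof. exact: linear0. Qed.
Lemma topB k u u' : top k (u - u') = top k u - top k u'. Proof. exact: linearB. Qed.
Lemma kd0 : kd 0 = 0. Proof. exact: linear0. Qed.
Lemma kdD u u' : kd (u + u') = kd u + kd u'. Proof. exact: linearD. Qed.
Lemma kdZ c u : kd (c *: u) = c *: kd u. Proof. exact: linearZ. Qed.
Lemma kd_sum (I : finType) (P : pred I) (F : I -> chain) :
  kd (\sum_(i | P i) F i) = \sum_(i | P i) kd (F i).
Proof. exact: linear_sum. Qed.
Lemma top_sum k (I : finType) (P : pred I) (F : I -> chain) :
  top k (\sum_(i | P i) F i) = \sum_(i | P i) top k (F i).
Proof. exact: linear_sum. Qed.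
Lemma topZ k c u : top k (c *: u) = c *: top k u. Proof. exact: linearZ. Qed.

Lemma vanish_submod k : submod (vanish k).
Proof. by split=> [//|c u u' su su' w lt]; rewrite !fctE su // su' // scaler0 addr0. Qed.

Lemma layer_submod k : submod (layer k).
Proof. by split=> [//|c u u' su su' w lt]; rewrite !fctE su // su' // scaler0 addr0. Qed.

Lemma Zf_submod k i : submod (Zf k i).
Proof.
split; first by split; rewrite ?zeroE.
move=> c u u' [su pu du] [su' pu' du']; split; rewrite ?gdiffD ?gdiffZ ?gprD ?gprZ ?pu ?pu' //.
  exact: (proj2 (vanish_submod k)).
by rewrite du du' scaler0 addr0.
Qed.

Lemma Bf_submod k i : submod (Bf k i).
Proof.
split; first by exists 0; rewrite !zeroE.
move=> c _ _ [e [se pe ->]] [e' [se' pe' ->]]; exists (c *: e + e').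
rewrite gprD gprZ gdiffD gdiffZ pe pe'; split=> //; exact: (proj2 (vanish_submod k)).
Qed.

Lemma Bg_submod k i : submod (Bg k i).
Proof.
split; first by exists 0; rewrite zeroE kd0.
move=> c _ _ [e [se pe ->]] [e' [se' pe' ->]]; exists (c *: e + e').
rewrite gprD gprZ kdD kdZ pe pe'; split=> //; exact: (proj2 (layer_submod k)).
Qed.

Lemma gpr_left i j u : gpr i.+1 (gleft j u) = gleft j (gpr i u).
Proof.
apply/funext => w; rewrite /gpr /gleft; case: leqP => wi; case: leqP => // wi'.
- by rewrite subSn // kpr_left.
- have -> : (i.+1 - wdeg w = 0)%N by apply/eqP; rewrite subn_eq0.
  by rewrite kpr0_left zeroE.
- by rewrite ltnNge (leqW wi') in wi.
by rewrite zeroE.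
Qed.

Lemma Zf_killed k i : killed m (Zf k i) (Bf k i).
Proof.
move=> a u /(mgen xgen)[c ->] [su pu du]; exists (\sum_j c j *: gleft j u); split.
- apply: (submod_sum (vanish_submod k)) => j _; apply: (submodZ (vanish_submod k)).
  by move=> w kw; rewrite /gleft su // zeroE.
- by rewrite gpr_sum; apply: eq_bigr => j _; rewrite gprZ gpr_left pu.
rewrite gdiff_sum scaler_suml; apply: eq_bigr => j _.
by rewrite gdiffZ gdiff_left du zeroE subr0 scalerA.
Qed.

Lemma Zg_killed k i : killed m (Zg k i) (Bg k i).
Proof.
move=> a u /(mgen xgen)[c ->] [su pu du]; exists (\sum_j c j *: gleft j u); split.
- apply: (submod_sum (layer_submod k)) => j _; apply: (submodZ (layer_submod k)).
  by move=> w kw; rewrite /gleft su // zeroE.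
- by rewrite gpr_sum; apply: eq_bigr => j _; rewrite gprZ gpr_left pu.
rewrite kd_sum scaler_suml; apply: eq_bigr => j _; rewrite kdZ -scalerA.
congr (_ *: _); apply/funext => w; rewrite /kd /gleft kdiff_left.
by have /(congr1 (fun f => f w)) := du; rewrite /kd => ->; rewrite zeroE subr0 fctE.
Qed.

Lemma vanish_le k l u : (k <= l)%N -> vanish k u -> vanish l u.
Proof. by move=> kl su w lw; apply/su/(leq_trans kl). Qed.

Lemma gd_widen k l u : (k <= l)%N -> vanish k u -> gd l u = gd k u.
Proof. by move=> kl su; apply: gdiff_widen => // w kw; apply/su/ltnW. Qed.

Lemma gd_vanish k u : vanish k u -> vanish k (gd k u).
Proof.
case: k => [|k] su.
  have -> : u = 0 by apply/funext => w; apply: su.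
  by rewrite zeroE.
by rewrite (gdiff_widen _ _ (leqnSn k)) //; apply: (gdiff_supp (tD k)).
Qed.

Lemma gdK k u : vanish k u -> gd k (gd k u) = 0.
Proof.
by move=> su; apply: (gdiffK (tD k)) => // w kw; apply/su/ltnW.
Qed.

Lemma gpr_gd k i u : gpr i (gd k u) = gd k (gpr i.+1 u).
Proof. exact: (gpr_gdiffk (tD k)). Qed.

Lemma vanish_gpr k i u : vanish k u -> vanish k (gpr i u).
Proof. by move=> su w kw; rewrite /gpr su // zeroE if_same. Qed.

Lemma gpr_kd i u : gpr i (kd u) = kd (gpr i.+1 u).
Proof.
apply/funext => w; rewrite /gpr /kd; case: leqP => wi.
  by rewrite leqW // kpr_diff subSn.
case: leqP => wi'; last by rewrite zeroE.
have -> : (i.+1 - wdeg w = 0)%N by apply/eqP; rewrite subn_eq0.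
by rewrite kdiff_kpr0.
Qed.

Lemma gpr_top k i u : gpr i (top k u) = top k (gpr i u).
Proof. by apply/funext => w; rewrite /gpr /top; case: (size w == k); rewrite // zeroE if_same. Qed.

Lemma gpr_bas i v (b : btype B) :
  gpr i (gbas v (bz b)) = if (wdeg v + bdeg b == i)%N then gbas v (bz b) else 0.
Proof.
apply/funext => w; rewrite /gpr /gbas; case: (w =P v) => [->|nwv]; last first.
  by rewrite zeroE if_same; case: ifP => // _; rewrite (introF eqP nwv).
case: leqP => vi; last by rewrite gtn_eqF // ltn_addr.
rewrite -(bz_pr b); case: eqP => [<-|ne]; first by rewrite addKn kprK eqxx.
by rewrite kpr_neq //; apply: contra_not_neq ne => <-; rewrite subnKC.
Qed.

Lemma top_gd k u : vanish k.+1 u -> top k (gd k.+1 u) = kd (top k u).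
Proof.
move=> su; rewrite (gdiff_widen _ _ (leqnSn k)) //; apply/funext => w.
rewrite /top /kd; case: eqP => [sw|]; last by rewrite zeroE.
by rewrite (gdiff_top (tD k)).
Qed.

Lemma layer_top k u : layer k (top k u).
Proof. by move=> w; rewrite /top => /negPf ->. Qed.

Lemma layer_vanish k u : layer k u -> vanish k.+1 u.
Proof. by move=> su w kw; apply: su; rewrite gtn_eqF. Qed.

Lemma top_layer k u : layer k u -> top k u = u.
Proof. by move=> su; apply/funext => w; rewrite /top; case: eqP => // /eqP /su. Qed.

Lemma Bf_le k i u : Bf k i u -> Bf k.+1 i u.
Proof.
move=> [e [se pe ->]]; exists e; split=> //; first exact: vanish_le se.
by rewrite (gd_widen (leqnSn k)).
Qed.

Lemma top_Zf k i u : Zf k.+1 i u -> Zg k i (top k u).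
Proof.
move=> [su pu du]; split; [exact: layer_top|by rewrite gpr_top pu|].
by rewrite -top_gd // du top0.
Qed.

Lemma top_Bf k i u : Bf k.+1 i u -> Bg k i (top k u).
Proof.
move=> [e [se pe ->]]; exists (top k e); split; [exact: layer_top|by rewrite gpr_top pe|].
exact: top_gd.
Qed.

(** A cycle whose leading part bounds in the layer differs by a boundary from a cycle
of the previous stage. *)
Lemma exact_Zf k i u : Zf k.+1 i u -> Bg k i (top k u) ->
  exists2 u', Zf k i u' & Bf k.+1 i (u - u').
Proof.
move=> [su pu du] [e [le pe te]]; have ve := layer_vanish le.
exists (u - gd k.+1 e); last first.
  by exists e; split=> //; rewrite opprB addrC subrK.
have v' : vanish k (u - gd k.+1 e).
  have v1 : vanish k.+1 (u - gd k.+1 e).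
    by apply: (submodB (vanish_submod _)) => //; apply: gd_vanish.
  move=> w; rewrite leq_eqVlt => /orP[/eqP sw|]; last exact: v1.
  have /(congr1 (fun f => f w)) : top k (u - gd k.+1 e) = 0.
    by rewrite topB te top_gd // top_layer // subrr.
  by rewrite /top sw eqxx.
split=> //; first by rewrite gprB pu gpr_gd pe.
by rewrite -(gd_widen (leqnSn k)) // gdiffB du gdK // subrr.
Qed.

Definition J k i : finType :=
  {tb : k.-tuple L * btype B | (wdeg tb.1 + bdeg tb.2 == i)%N}.
Definition Jw k i (s : J k i) : seq L := (val s).1.
Definition Jb k i (s : J k i) : btype B := (val s).2.
Definition e2 k i (s : J k i) : chain := gbas (Jw s) (bz (Jb s)).

Lemma e2_Zg k i s : Zg k i (@e2 k i s).
Proof.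
case: s => [[t b] tbi]; have /= /eqP e := tbi; rewrite /e2 /Jw /Jb /=; split.
- by move=> w sw; rewrite /gbas; case: eqP => // e1; rewrite e1 size_tuple eqxx in sw.
- by rewrite gpr_bas e eqxx.
by apply/funext => w; rewrite /kd /gbas; case: ifP; rewrite ?zeroE ?bz_cycle.
Qed.

Lemma sum_e2 k i (c : seq L -> btype B -> R) :
  \sum_(s : J k i) c (Jw s) (Jb s) *: e2 s =
  gpr i (\sum_(v <- words k) gbas v (\sum_b c v b *: bz b)).
Proof.
rewrite sum_words_tuple gpr_sum.
under [RHS]eq_bigr => t _ do rewrite gbas_sum gpr_sum.
rewrite pair_bigA /=.
rewrite [RHS](bigID (fun tb : k.-tuple L * btype B => wdeg tb.1 + bdeg tb.2 == i)%N) /=.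
rewrite [X in _ = _ + X]big1 ?addr0 => [|[t b] /= ne]; last first.
  by rewrite gbasZ gprZ gpr_bas (negPf ne) scaler0.
rewrite (big_sub [pred tb : k.-tuple L * btype B | wdeg tb.1 + bdeg tb.2 == i]%N
  (fun tb : k.-tuple L * btype B => gpr i (gbas tb.1 (c tb.1 tb.2 *: bz tb.2)))).
apply: eq_bigr => [[[t b] /= e]] _.
by rewrite gbasZ gprZ gpr_bas e.
Qed.

(** The layer is a direct sum of shifted copies of [K (x) M], one for each word. *)
Lemma e2_spans k i : spans (Zg k i) (Bg k i) (@e2 k i).
Proof.
move=> u [lu pu du].
have /choice[c /choice[th cP]] : forall w, exists c theta,
    u w = \sum_(b : btype B) c b *: bz b + kdiff x theta.
  by move=> w; apply: bz_gen; move: (congr1 (fun f => f w) du).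
exists (fun s => c (Jw s) (Jb s)).
rewrite (sum_e2 k i c) -{1}pu -gprB.
pose e : chain := top k th.
exists (gpr i.+1 e); split; [|exact: gprK|].
  by move=> w sw; rewrite /gpr /e /top (negPf sw) zeroE if_same.
rewrite -gpr_kd; congr (gpr i _); apply/funext => w; rewrite /kd /e /top !fctE.
case: (size w =P k) => [sw|/eqP nsw].
  by rewrite top_sumE // cP addrC addKr.
by rewrite lu // top_sum_out // subrr zeroE.
Qed.

Lemma e2_indep k i : indep m (Bg k i) (@e2 k i).
Proof.
move=> c0 [e [le pe ee]] s0.
(* The extension of [c0] by 0 to the pairs of another degree. *)
pose c (v : seq L) (b : btype B) : R :=
  \sum_(s : J k i | (Jw s == v) && (Jb s == b)) c0 s.
have cE (s : J k i) : c (Jw s) (Jb s) = c0 s.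
  by rewrite /c (big_pred1 s).
have c_out v b : (wdeg v + bdeg b != i)%N -> c v b = 0.
  move=> ne; rewrite /c big_pred0 // => s; apply/negbTE/negP => /andP[/eqP ev /eqP eb].
  by move: ne; rewrite -ev -eb (valP s).
rewrite -(cE s0); apply: (bz_ind (k := B) (c := c (Jw s0)) (theta := e (Jw s0))).
have -> : kdiff x (e (Jw s0)) = kd e (Jw s0) by [].
rewrite -ee; under [in RHS]eq_bigr do rewrite -cE.
have sw : size (Jw s0) = k by rewrite size_tuple.
have <- : \sum_(v <- words k) gbas v (\sum_b c v b *: bz b) = \sum_(s : J k i) c (Jw s) (Jb s) *: e2 s.
  rewrite sum_e2 gpr_sum; apply: eq_bigr => v _; rewrite gbas_sum gpr_sum.
  apply: eq_bigr => b _ /=; rewrite gbasZ gprZ gpr_bas.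
  by case: eqP => // /eqP /c_out ->; rewrite !scale0r.
by rewrite top_sumE.
Qed.

Definition rank k i : nat := \sum_(v <- words k) \sum_(b : btype B) (wdeg v + bdeg b == i)%N.

Lemma card_J k i : #|J k i| = rank k i.
Proof.
rewrite /J card_sig -sum1_card big_mkcond /rank (@sum_words_tuple L nat) pair_bigA /=.
by apply: eq_bigr => tb _; rewrite inE /=; case: eqP.
Qed.

Definition total k i : nat := \sum_(l < k) rank l i.

(** Each layer contributes at most [rank k i] to the homology of [F (x) M] in
degree [i]; if all of them contribute that much then every cycle of every layer
lifts to a cycle of the complex. *)
Lemma count_layers k i : exists (I : finType) (e : I -> chain),
  [/\ spans (Zf k i) (Bf k i) e, (#|I| <= total k i)%N, forall a, Zf k i (e a) &
   #|I| = total k i -> forall l y, (l < k)%N -> Zg l i y ->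
     exists2 z, Zf l.+1 i z & Bg l i (y - top l z)].
Proof.
elim: k => [|k [I [e [sp le eZ full]]]].
  exists void, (fun v : void => match v with end); split=> [u [u0 _ _]||[]|_ l y //].
    exists (fun=> 0); rewrite (_ : u = 0); last by apply/funext => w; apply: u0.
    by rewrite big1 ?subrr //; exact: (submod0 (Bf_submod _ _)).
  by rewrite card_void.
have [d [g [dJ gZ sp' full']]] := ext_count mmax (top := top k) (Bf_submod k.+1 i)
   (Zf_submod k.+1 i) (Bg_submod k i) (@Bf_le k i) (@top_Zf k i) (@exact_Zf k i)
   sp (@Zg_killed k i) (@e2_spans k i) (@e2_Zg k i).
rewrite card_J in dJ full'.
have totS : total k.+1 i = (total k i + rank k i)%N by rewrite /total big_ord_recr.
exists (I + 'I_d)%type, (sumfam e g); split=> //.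
- by rewrite card_sum card_ord totS leq_add.
- case=> a /=; last exact: gZ.
  have [se pe de] := eZ a; split=> //; first exact: vanish_le se.
  by rewrite (gd_widen (leqnSn k)).
rewrite card_sum card_ord totS => eqn.
have eI : #|I| = total k i.
  apply/eqP; rewrite eqn_leq le -(leq_add2r (rank k i)) -eqn leq_add2l dJ //.
have ed : d = rank k i by apply/eqP; rewrite -(eqn_add2l #|I|) eqn eI.
move=> l y; rewrite ltnS leq_eqVlt => /orP[/eqP ->|lk] Zy; last exact: full.
exact: full'.
Qed.

(** The hypothesis concerns homogeneous cycles and lifts them up to boundaries of
the layer. A boundary [kd e] of the layer is the leading part of the boundary of
[e], which corrects the lift. *)
Lemma layers_lift :
  (forall k i y, Zg k i y -> exists2 z, Zf k.+1 i z & Bg k i (y - top k z)) ->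
  lifting D M.
Proof.
move=> full v z dz; set k := size v.
have /choice[u uP] : forall q : nat, exists u, [/\ supp k u, gd k u = 0 &
    forall w, size w = k -> u w = if w == v then kpr q z else 0].
  move=> q; pose y : chain := gbas v (kpr q z).
  have Zy : Zg k (wdeg v + q) y.
    split.
    - by move=> w sw; rewrite /y /gbas; case: (w =P v) sw => // ->; rewrite eqxx.
    - apply/funext => w; rewrite /gpr /y /gbas; case: eqP => [->|_].
        by rewrite leq_addr addKn kprK.
      by rewrite zeroE if_same.
    apply/funext => w; rewrite /kd /y /gbas; case: ifP; rewrite ?zeroE // => _.
    case: q {y} => [|q]; first exact: kdiff_kpr0.
    by rewrite -kpr_diff dz zeroE.
  have [u [su pu du] [e [le pe ye]]] := full _ _ _ Zy.
  have ve := layer_vanish le.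
  exists (u + gd k.+1 e); split.
  - by apply: (submodD (supp_submod k)) => //; apply: gd_vanish.
  - rewrite -(gdiff_widen _ _ (leqnSn k)); last first.
      by apply: (submodD (supp_submod k)) => //; apply: gd_vanish.
    by rewrite gdiffD du gdK // addr0.
  move=> w sw; have := congr1 (fun f => f w) ye; rewrite !fctE.
  have <- : top k (gd k.+1 e) = kd e by rewrite top_gd // top_layer.
  by rewrite /top sw eqxx => <-; rewrite addrC subrK.
exists (\sum_(q < n.+1) u q); split.
- by apply: (submod_sum (supp_submod k)) => q _; have [] := uP q.
- by rewrite gdiff_sum big1 // => q _; have [] := uP q.
move=> w sw; rewrite fct_sumE; under eq_bigr => q _ do
  rewrite (let: And3 _ _ h := uP q in h w sw).
by case: eqP => _; [rewrite -kpr_sum|rewrite big1].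
Qed.

(** If all cycles of the layers lift then their ranks add up to the dimension of
the homology of [F^(k-1) (x) M]. *)
Lemma lifting_basis : lifting D M -> forall k i, exists (I : finType) (e : I -> chain),
  [/\ #|I| = total k i, forall a, Zf k i (e a), spans (Zf k i) (Bf k i) e &
      indep m (Bf k i) e].
Proof.
move=> lift.
have /choice[g gP] : forall kis : {k : nat & {i : nat & J k i}},
    let s := tagged (tagged kis) in
    exists u, Zf (tag kis).+1 (tag (tagged kis)) u /\ top (tag kis) u = e2 s.
  move=> [k [i s]] /=; have [u [su du tu]] := lift (Jw s) _ (bz_cycle (Jb s)).
  have sk : size (Jw s) = k by rewrite size_tuple.
  rewrite sk in su du tu; have [ls ps ds] := e2_Zg s.
  have te : top k u = e2 s.
    apply/funext => w; rewrite /top; case: eqP => [sw|/eqP nsw]; last by rewrite ls.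
    by rewrite tu.
  exists (gpr i u); split; last by rewrite -gpr_top te ps.
  split; [exact: vanish_gpr|exact: gprK|].
  rewrite (gdiff_widen _ _ (leqnSn k)); last exact: supp_pr.
  by case: i s {sk ls ps ds te tu} => [|i] s;
    rewrite ?(gdiff_gpr0 _ _ _ (twist_nil (tD 0))) -?gpr_gd ?du ?zeroE.
pose lft k i (s : J k i) : chain := g (existT _ k (existT _ i s)).
have lftZ k i s : Zf k.+1 i (@lft k i s) by have [] := gP (existT _ k (existT _ i s)).
have lftT k i s : top k (@lft k i s) = e2 s by have [] := gP (existT _ k (existT _ i s)).
elim=> [|k IH] i.
  exists void, (fun v : void => match v with end); split=> [|[]|u [u0 _ _]|c _ []].
    by rewrite card_void /total big_ord0.
  exists (fun=> 0); rewrite (_ : u = 0); last by apply/funext => w; apply: u0.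
  by rewrite big1 ?subrr //; exact: (submod0 (Bf_submod _ _)).
have [I [e [cI eZ sp ind]]] := IH i.
exists (I + J k i)%type, (sumfam e (@lft k i)); split.
- by rewrite card_sum cI card_J /total big_ord_recr.
- case=> a /=; last exact: lftZ.
  have [se pe de] := eZ a; split=> //; first exact: vanish_le se.
  by rewrite (gd_widen (leqnSn k)).
- apply: (ext_spans_lift (top := top k) (Bf_submod k.+1 i) (Zf_submod k.+1 i)
    (@Bf_le k i) (@exact_Zf k i) sp (@lftZ k i)) => z Zz.
  have [c Bc] := e2_spans (top_Zf Zz); exists c.
  by under eq_bigr do rewrite /= lftT.
apply: (ext_indep (top := top k) (Bf_submod k.+1 i) (Z := Zf k.+1 i) _ _ _ _ eZ _ ind (@lftZ k i)).
- exact: Zf_submod.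
- exact: Zf_killed.
- move=> z [vz pz dz] [eta [se pe ze]].
  have Zt : Zg k i.+1 (top k eta).
    split; [exact: layer_top|by rewrite gpr_top pe|].
    rewrite -top_gd // -ze; apply/funext => w; rewrite /top; case: eqP => // sw.
    by rewrite vz ?sw.
  have [c [th [lth pth ec]]] := e2_spans Zt.
  exists (eta - \sum_s c s *: lft k i.+1 s - gd k.+1 th).
  have v1 : vanish k.+1 (eta - \sum_s c s *: lft k i.+1 s - gd k.+1 th).
    apply: (submodB (vanish_submod _)); last exact/gd_vanish/layer_vanish.
    apply: (submodB (vanish_submod _)) => //; apply: (submod_sum (vanish_submod _)) => s _.
    by apply: (submodZ (vanish_submod _)); have [] := lftZ k i.+1 s.
  have v0 : vanish k (eta - \sum_s c s *: lft k i.+1 s - gd k.+1 th).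
    move=> w; rewrite leq_eqVlt => /orP[/eqP sw|]; last exact: v1.
    have : top k (eta - \sum_s c s *: lft k i.+1 s - gd k.+1 th) = 0.
      rewrite !topB top_gd ?(top_layer lth) //; last exact: layer_vanish.
      have -> : top k (\sum_s c s *: lft k i.+1 s) = \sum_s c s *: e2 s.
        by rewrite top_sum; apply: eq_bigr => s _; rewrite topZ lftT.
      by rewrite ec subrr.
    by move/(congr1 (fun f => f w)); rewrite /top -sw eqxx.
  split=> //.
    rewrite !gprB pe gpr_gd pth gpr_sum; congr (_ - _ - _).
    by apply: eq_bigr => s _; rewrite gprZ; have [_ -> _] := lftZ k i.+1 s.
  rewrite -(gd_widen (leqnSn k)) // !gdiffB gdK; last exact: layer_vanish.
  rewrite subr0 -ze gdiff_sum big1 ?subr0 // => s _.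
  by rewrite gdiffZ; have [_ _ ->] := lftZ k i.+1 s; rewrite scaler0.
- exact: top_Bf.
- move=> a; have [se _ _] := eZ a; apply/funext => w; rewrite /= /top; case: (size w =P k) => // sw.
  by apply: se; rewrite sw.
by move=> c; under eq_bigr do rewrite /= lftT; apply: e2_indep.
Qed.

End Counting.

(** * Independence of the resolution *)

Lemma dependent_choice (T : nat -> Type) (Q : forall i, T i -> Prop)
    (r : forall i, T i -> T i.+1 -> Prop) :
  (exists t, Q 0%N t) -> (forall i t, Q i t -> exists t', Q i.+1 t' /\ r i t t') ->
  exists f : forall i, T i, (forall i, Q i (f i)) /\ (forall i, r i (f i) (f i.+1)).
Proof.
move=> /cid[t0 Q0] step.
have st i (t : {t : T i | Q i t}) : {t' : {t' : T i.+1 | Q i.+1 t'} | r i (sval t) (sval t')}.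
  have /cid[t' [Qt' rt']] := step i _ (svalP t).
  by exists (exist _ t' Qt').
pose F := fix F i : {t : T i | Q i t} :=
  if i is i'.+1 then sval (st i' (F i')) else exist _ t0 Q0.
exists (fun i => sval (F i)); split=> i; first exact: svalP.
exact: (svalP (st i (F i))).
Qed.

Section MatrixMap.
Variables (R : comNzRingType) (M : lmodType R) (I J : finType).

Definition matmap (phi : I -> {ffun J -> R^o}) (u : {ffun I -> M}) : {ffun J -> M} :=
  [ffun T => \sum_S (phi S T : R) *: u S].

Fact matmap_is_linear phi : linear (matmap phi).
Proof.
move=> c u v; apply/ffunP => T; rewrite !ffunE scaler_sumr -big_split /=.
by apply: eq_bigr => S _; rewrite !ffunE scalerDr !scalerA mulrC.
Qed.
HB.instance Definition _ phi := GRing.isLinear.Build R {ffun I -> M} {ffun J -> M} *:%R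
  (matmap phi) (matmap_is_linear phi).

End MatrixMap.

Section BasisVectors.
Variables (R : comNzRingType).

Definition basis_vec (I : finType) (S : I) : {ffun I -> R^o} := [ffun T => (T == S)%:R].

Lemma matmap_basis (I J : finType) (phi : I -> {ffun J -> R^o}) S :
  matmap phi (basis_vec S) = phi S.
Proof.
apply/ffunP => T; rewrite ffunE (bigD1 S) //= ffunE eqxx big1 ?addr0.
  exact: mulr1.
by move=> S' /negPf n; rewrite ffunE n; apply: mulr0.
Qed.

Lemma basis_vec_sum (I : finType) (u : {ffun I -> R^o}) :
  u = \sum_S (u S : R) *: basis_vec S.
Proof.
apply/ffunP => T; rewrite sum_ffunE (bigD1 T) //= !ffunE eqxx big1 ?addr0.
  by rewrite [RHS]mulr1.
by move=> S /negPf n; rewrite !ffunE eq_sym n; apply: mulr0.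
Qed.

(** Matrices over [R] act on free modules with coefficients in any [M], and this
action is compatible with composition: chain maps and homotopies between free
complexes hence pass to coefficients in [M]. *)
Lemma matmap_comp (M : lmodType R) (I J K : finType)
    (phi : I -> {ffun J -> R^o}) (psi : J -> {ffun K -> R^o}) (u : {ffun I -> M}) :
  matmap psi (matmap phi u) = matmap (fun S => matmap psi (phi S)) u.
Proof.
apply/ffunP => U; rewrite !ffunE.
under eq_bigr do rewrite ffunE scaler_sumr.
rewrite exchange_big; apply: eq_bigr => S _ /=; rewrite ffunE scaler_suml.
by apply: eq_bigr => T _; rewrite scalerA.
Qed.

Lemma matmapB (M : lmodType R) (I J : finType) (phi psi : I -> {ffun J -> R^o})
    (u : {ffun I -> M}) :
  matmap (fun S => phi S - psi S) u = matmap phi u - matmap psi u.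
Proof.
apply/ffunP => U; rewrite !ffunE -sumrB; apply: eq_bigr => S _.
by rewrite !ffunE scalerBl.
Qed.

Lemma matmap_id (M : lmodType R) (I : finType) (u : {ffun I -> M}) :
  matmap (@basis_vec I) u = u.
Proof.
apply/ffunP => T; rewrite ffunE (bigD1 T) //= ffunE eqxx scale1r big1 ?addr0 //.
by move=> S /negPf n; rewrite ffunE eq_sym n scale0r.
Qed.

End BasisVectors.

Section Resolutions.
Variables (R : comNzRingType) (m : idealr R).

Definition drow (F : free_complex R) i (S : fbasis F i.+1) : {ffun fbasis F i -> R^o} :=
  [ffun T => fdiff S T].

Lemma tens_diffE (F : free_complex R) (M : lmodType R) i (u : tens F M i.+1) :
  tens_diff u = matmap (@drow F i) u.
Proof. by apply/ffunP => T; rewrite !ffunE; apply: eq_bigr => S _; rewrite ffunE. Qed.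

Lemma tens_diffK (F : free_complex R) (M : lmodType R) i (u : tens F M i.+2) :
  tens_diff (tens_diff u) = 0.
Proof.
rewrite !tens_diffE matmap_comp; apply/ffunP => U; rewrite !ffunE big1 // => S _.
rewrite ffunE (_ : \sum__ _ = 0) ?scale0r // -[RHS](fdiffK S U).
by apply: eq_bigr => T _; rewrite !ffunE; apply: mulrC.
Qed.

Local Notation augmentation E :=
  {linear tens E R^o 0 -> {ideal_quot m} | (\pi_({ideal_quot m}))%qT \; *%R}.

Section Compare.
Variables (F G : free_complex R).
Variable epsF : augmentation F.
Variable epsG : augmentation G.
Hypothesis exF : forall i (u : tens F R^o i.+1), tens_cycle u -> tens_boundary u.
Hypothesis exG : forall i (u : tens G R^o i.+1), tens_cycle u -> tens_boundary u.
Hypothesis epsF0 : forall u, epsF u = 0 <-> tens_boundary u.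
Hypothesis epsG0 : forall u, epsG u = 0 <-> tens_boundary u.
Hypothesis epsG_onto : forall y, exists u, epsG u = y.

(** The cycles of the resolution augmented by the residue field, so that degree 0
needs no separate treatment in the comparison. *)
Definition acyc (E : free_complex R)
    (eps : augmentation E)
    i : tens E R^o i -> Prop :=
  match i with 0 => fun u => eps u = 0 | _.+1 => fun u => tens_diff u = 0 end.

Lemma acyc_boundary (E : free_complex R) (eps : augmentation E)
   (ex : forall i (u : tens E R^o i.+1), tens_cycle u -> tens_boundary u)
   (eps0 : forall u, eps u = 0 <-> tens_boundary u) i (u : tens E R^o i) :
  acyc eps u <-> tens_boundary u.
Proof.
case: i u => [|i] u; first exact: eps0.
by split=> [|[v ->]]; [exact: ex|exact: tens_diffK].
Qed.

Lemma tens_matmap (E E' : free_complex R) i (N : lmodType R)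
   (phi : fbasis E i -> tens E' R^o i) (phi' : fbasis E i.+1 -> tens E' R^o i.+1) :
  (forall S, tens_diff (phi' S) = matmap phi (drow S)) ->
  forall u : tens E N i.+1, tens_diff (matmap phi' u : tens E' N i.+1) =
    matmap phi (tens_diff u).
Proof.
move=> h u; rewrite !tens_diffE !matmap_comp; congr (matmap _ u); apply/funext => S.
by rewrite -h tens_diffE.
Qed.

Lemma lift_resolution : exists f : forall i, fbasis F i -> tens G R^o i,
  (forall S, epsG (f 0%N S) = epsF (basis_vec R S)) /\
  forall i S, tens_diff (f i.+1 S) = matmap (f i) (drow S).
Proof.
pose Q i (phi : fbasis F i -> tens G R^o i) :=
  forall u : tens F R^o i, acyc epsF u -> acyc epsG (matmap phi u : tens G R^o i).
pose Q0 i : (fbasis F i -> tens G R^o i) -> Prop :=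
  match i with
  | 0 => fun phi => Q 0%N phi /\ forall S, epsG (phi S) = epsF (basis_vec R S)
  | _.+1 => Q _ end.
have Q0Q i phi : Q0 i phi -> Q i phi by case: i phi => [|i] phi //= [].
have [||f [Qf rf]] := @dependent_choice _ Q0 (fun i phi phi' =>
   forall S, tens_diff (phi' S) = matmap phi (drow S)).
- have /choice[phi phiE] : forall S : fbasis F 0, exists u, epsG u = epsF (basis_vec R S).
    by move=> S; apply: epsG_onto.
  exists phi; split=> // u /=; rewrite {1}[u]basis_vec_sum => e.
  rewrite -[RHS]e [matmap _ _](_ : _ = \sum_S (u S : R) *: phi S); last first.
    by apply/ffunP => T; rewrite ffunE sum_ffunE; apply: eq_bigr => S _; rewrite ffunE; apply: mulrC.
  by rewrite !linear_sum; apply: eq_bigr => S _ /=; rewrite !linearZ /= phiE.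
- move=> i phi /Q0Q Qphi.
  have /choice[phi' phiE] : forall S : fbasis F i.+1, exists y : tens G R^o i.+1,
      matmap phi (drow S) = tens_diff y.
    move=> S; apply/(acyc_boundary exG epsG0)/Qphi/(acyc_boundary exF epsF0).
    by exists (basis_vec R S); rewrite tens_diffE matmap_basis.
  exists phi'; split=> [u /= du|S]; last by rewrite phiE.
  by rewrite (tens_matmap (phi := phi)) ?du ?linear0 // => S; rewrite phiE.
by exists f; split=> //; case: (Qf 0%N).
Qed.

End Compare.

Lemma homotopy_resolution (F : free_complex R)
   (eps : augmentation F)
   (ex : forall i (u : tens F R^o i.+1), tens_cycle u -> tens_boundary u)
   (eps0 : forall u, eps u = 0 <-> tens_boundary u)
   (f : forall i, fbasis F i -> tens F R^o i) :
  (forall S, eps (f 0%N S) = 0) ->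
  (forall i S, tens_diff (f i.+1 S) = matmap (f i) (drow S)) ->
  exists h : forall i, fbasis F i -> tens F R^o i.+1,
    (forall S, tens_diff (h 0%N S) = f 0%N S) /\
    forall i S, tens_diff (h i.+1 S) = f i.+1 S - matmap (h i) (drow S).
Proof.
move=> f0 fS.
pose Q i (h : fbasis F i -> tens F R^o i.+1) :=
  forall S : fbasis F i.+1, tens_diff (f i.+1 S - matmap (h) (drow S)) = 0.
pose Q0 i : (fbasis F i -> tens F R^o i.+1) -> Prop :=
  match i with
  | 0 => fun h => Q 0%N h /\ forall S, tens_diff (h S) = f 0%N S
  | _.+1 => Q _ end.
have Q0Q i h : Q0 i h -> Q i h by case: i h => [|i] h //= [].
have dB i (u v : tens F R^o i.+1) : tens_diff (u - v) = tens_diff u - tens_diff v.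
  by rewrite !tens_diffE linearB.
have [||h [Qh rh]] := @dependent_choice _ Q0 (fun i h h' =>
   forall S, tens_diff (h' S) = f i.+1 S - matmap h (drow S)).
- have /choice[h hE] : forall S : fbasis F 0, exists y : tens F R^o 1, f 0%N S = tens_diff y.
    by move=> S; apply/eps0.
  exists h; split=> // S; rewrite dB fS !tens_diffE matmap_comp.
  apply/eqP; rewrite subr_eq0; apply/eqP; congr matmap; apply/funext => T.
  by rewrite hE tens_diffE.
- move=> i h /Q0Q Qh.
  have /choice[h' hE] : forall S : fbasis F i.+1, exists y : tens F R^o i.+2,
      f i.+1 S - matmap h (drow S) = tens_diff y.
    by move=> S; apply: ex; apply: Qh.
  exists h'; split=> [S|S]; last by rewrite hE.
  rewrite dB fS [X in _ - X]tens_diffE matmap_comp.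
  have -> : (fun T => matmap (@drow F i.+1) (h' T)) = fun T => f i.+1 T - matmap h (drow T).
    by apply/funext => T; rewrite -tens_diffE hE.
  rewrite matmapB opprB addrC subrK -matmap_comp.
  have -> : matmap (@drow F i) (drow S) = 0.
    rewrite -tens_diffE -[drow S](matmap_basis (@drow F i.+1)) -tens_diffE.
    exact: tens_diffK.
  by rewrite linear0.
by exists h; split=> //; case: (Qh 0%N).
Qed.

Lemma tens_boundary_submod (F : free_complex R) (M : lmodType R) i :
  submod (@tens_boundary R F M i).
Proof.
split; first by exists 0; rewrite tens_diffE linear0.
by move=> c _ _ [u ->] [v ->]; exists (c *: u + v); rewrite !tens_diffE linearP.
Qed.

(** The comparison map from [F] to [G] is injective on homology with coefficients,
because its composite with a comparison map back is homotopic to the identity. *)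
Lemma tor_indep (F G : free_complex R) (M : lmodType R) i d (f : 'I_d -> tens F M i) :
  residue_resolution m F -> residue_resolution m G ->
  (forall a, tens_cycle (f a)) -> indep m (@tens_boundary R F M i) f ->
  exists g : 'I_d -> tens G M i,
    (forall a, tens_cycle (g a)) /\ indep m (@tens_boundary R G M i) g.
Proof.
move=> [exF [epsF [ontoF eps0F]]] [exG [epsG [ontoG eps0G]]] fZ find.
have [a [a0 aS]] := lift_resolution exF exG eps0F eps0G ontoG.
have [b [b0 bS]] := lift_resolution exG exF eps0G eps0F ontoF.
pose c j (S : fbasis F j) : tens F R^o j := matmap (b j) (a j S) - basis_vec R S.
have [||h [h0 hS]] := @homotopy_resolution F epsF exF eps0F c.
- move=> S; rewrite /c linearB /=; apply/eqP; rewrite subr_eq0; apply/eqP.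
  rewrite -a0 [in RHS](basis_vec_sum (a 0%N S)).
  rewrite [matmap _ _](_ : _ = \sum_T (a 0%N S T : R) *: b 0%N T); last first.
    apply/ffunP => T; rewrite ffunE sum_ffunE; apply: eq_bigr => U _.
    by rewrite ffunE; apply: mulrC.
  by rewrite !linear_sum; apply: eq_bigr => U _ /=; rewrite !linearZ /= b0.
- move=> j S; rewrite /c tens_diffE linearB /= -!tens_diffE (tens_matmap (@bS j)) aS.
  rewrite matmapB matmap_id matmap_comp; congr (_ - _).
  by rewrite tens_diffE matmap_basis.
have bF j (u : tens G M j) : tens_boundary u -> tens_boundary (matmap (b j) u : tens F M j).
  by move=> [v ->]; exists (matmap (b j.+1) v); rewrite (tens_matmap (@bS j)).
have homot j (u : tens F M j) : tens_cycle u ->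
    tens_boundary (matmap (b j) (matmap (a j) u) - u : tens F M j).
  have e : matmap (b j) (matmap (a j) u) - u = matmap (c j) u.
    by rewrite matmapB matmap_id matmap_comp.
  rewrite e; case: j u {e} => [|j] u cu.
    exists (matmap (h 0%N) u); rewrite tens_diffE matmap_comp; congr (matmap _ u).
    by apply/funext => S; rewrite -h0 tens_diffE.
  exists (matmap (h j.+1) u); rewrite tens_diffE matmap_comp.
  have -> : (fun S => matmap (@drow F j.+1) (h j.+1 S)) =
     fun S => c j.+1 S - matmap (h j) (drow S).
    by apply/funext => S; rewrite -hS tens_diffE.
  by rewrite [RHS]matmapB -(matmap_comp (@drow F j) (h j)) -tens_diffE cu linear0 subr0.
exists (fun l => matmap (a i) (f l)); split.
  move=> l; case: i f fZ find => [//|i] f fZ _ /=.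
  by rewrite (tens_matmap (@aS i)) (fZ l) linear0.
move=> r bd; apply: find; pose y := \sum_l r l *: f l.
have -> : \sum_l r l *: f l = \sum_l r l *: matmap (b i) (matmap (a i) (f l))
   - \sum_l r l *: (matmap (b i) (matmap (a i) (f l)) - f l).
  by rewrite -sumrB; apply: eq_bigr => l _; rewrite -scalerBr subKr.
have hB := tens_boundary_submod F M i; apply: (submodB hB).
  have := bF _ _ bd; rewrite linear_sum /=.
  by under eq_bigr do rewrite linearZ /=.
by apply: (submod_sum hB) => l _; apply/(submodZ hB)/homot.
Qed.

End Resolutions.

(** * The Golod resolution as a complex of free modules *)

Section GolodComplex.
Variables (R : comNzRingType) (m : idealr R) (n : nat) (x : 'I_n -> R).
Hypothesis xgen : generated_by m x setT.
Variable H : letters m x.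
Local Notation L := (ltype H).
Local Notation chain M := (seq L -> kos n M).
Local Notation wdeg := (wdeg (@ldeg _ _ _ _ H)).
Local Notation gpr := (gpr (@ldeg _ _ _ _ H)).
Variable D : seq L -> seq L -> kos n R^o.
Hypothesis tD : forall k, twist k D.
Local Notation gd := (gdiff x D).

(** Words of total degree at most [i] have length at most [i], which makes the basis
of degree [i] finite. *)
Definition gbasis i : finType := {b : {set 'I_n} * i.-bseq L | (#|b.1| + wdeg b.2 == i)%N}.
Definition gset i (b : gbasis i) : {set 'I_n} := (val b).1.
Definition gword i (b : gbasis i) : seq L := (val b).2.

Section Coefficients.
Variable M : lmodType R.

Definition chain_of i (u : {ffun gbasis i -> M}) : chain M :=
  \sum_b gbas (gword b) (kdelta (gset b) (u b)).
Definition tens_of i (U : chain M) : {ffun gbasis i -> M} := [ffun b => U (gword b) (gset b)].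

Lemma chain_ofE i (u : {ffun gbasis i -> M}) b : chain_of u (gword b) (gset b) = u b.
Proof.
rewrite /chain_of fct_sumE sum_ffunE (bigD1 b) //= /gbas eqxx ffunE eqxx big1 ?addr0 // => b' nb.
case: eqP => ew; last by rewrite ffunE.
rewrite ffunE; case: eqP => // es; case/eqP: nb; apply: val_inj.
by apply/eqP/andP; split; apply/eqP; [exact/esym|exact/val_inj/esym].
Qed.

Fact chain_of_is_linear i : linear (@chain_of i).
Proof.
move=> c u v; rewrite /chain_of scaler_sumr -big_split; apply: eq_bigr => b _ /=.
rewrite -linearZ -linearD /=; congr gbas; apply/ffunP => S; rewrite !ffunE.
by case: ifP; rewrite // scaler0 addr0.
Qed.
HB.instance Definition _ i := GRing.isLinear.Build R {ffun gbasis i -> M} (chain M) *:%R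
  (@chain_of i) (@chain_of_is_linear i).

Lemma gprE i (U : chain M) w (S : {set 'I_n}) :
  gpr i U w S = if (#|S| + wdeg w == i)%N then U w S else 0.
Proof.
rewrite /gpr; case: leqP => wi.
  by rewrite ffunE -(eqn_add2r (wdeg w)) subnK.
by rewrite ffunE gtn_eqF // ltn_addl.
Qed.

Lemma chain_of_out i (u : {ffun gbasis i -> M}) w (S : {set 'I_n}) :
  (#|S| + wdeg w != i)%N -> chain_of u w S = 0.
Proof.
move=> ne; rewrite /chain_of fct_sumE sum_ffunE big1 // => b _; rewrite /gbas.
case: eqP => ew; last by rewrite ffunE.
rewrite ffunE; case: eqP => // es; move: ne; rewrite ew es.
by rewrite (valP b).
Qed.

Lemma gpr_chain_of i (u : {ffun gbasis i -> M}) : gpr i (chain_of u) = chain_of u.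
Proof.
apply/funext => w; apply/ffunP => S; rewrite gprE; case: ifP => // /negbT ne.
by rewrite chain_of_out.
Qed.

Lemma tens_ofK i (U : chain M) : gpr i U = U -> chain_of (tens_of i U) = U.
Proof.
move=> pU; apply/funext => w; apply/ffunP => S.
case e : (#|S| + wdeg w == i)%N; last first.
  by rewrite chain_of_out ?e // -pU gprE e.
have le : (size w <= i)%N.
  by rewrite (leq_trans (size_wdeg (@ldeg _ _ _ _ H) w)) // -(eqP e) leq_addl.
pose b : gbasis i := exist _ (S, Bseq le) e.
by rewrite -[w]/(gword b) -[S]/(gset b) chain_ofE ffunE.
Qed.

Lemma chain_ofK i (u : {ffun gbasis i -> M}) : tens_of i (chain_of u) = u.
Proof. by apply/ffunP => b; rewrite ffunE chain_ofE. Qed.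

Lemma chain_of_vanish i k (u : {ffun gbasis i -> M}) : (i < k)%N -> vanish k (chain_of u).
Proof.
move=> ik w kw; apply/ffunP => S; rewrite chain_of_out ?ffunE // gtn_eqF //.
rewrite (leq_trans ik) // (leq_trans kw) //.
by rewrite (leq_trans (size_wdeg (@ldeg _ _ _ _ H) w)) // leq_addl.
Qed.

Lemma chain_of_supp i k (u : {ffun gbasis i -> M}) : (i <= k)%N -> supp k (chain_of u).
Proof. by move=> ik w kw; apply: (@chain_of_vanish i k.+1). Qed.

End Coefficients.

Lemma chain_of_basis i (b : gbasis i) :
  chain_of (basis_vec R b) = gbas (gword b) (kdelta (gset b) (1 : R^o)).
Proof.
rewrite /chain_of (bigD1 b) //= ffunE eqxx big1 ?addr0 // => b' /negPf nb.
rewrite ffunE nb; apply/funext => w; rewrite /gbas; case: ifP => // _.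
by apply/ffunP => S; rewrite !ffunE if_same.
Qed.

(** The differential with coefficients in [M] has the same matrix as the one over
[R]. *)
Lemma gdiff_ten (M : lmodType R) k (v : M) (U : chain R^o) :
  gd k (fun w => kten v (U w)) = fun w => kten v (gd k U w).
Proof.
apply/funext => w; rewrite /gdiff linearD linear_sum -kten_diff; congr (_ + _).
by apply: eq_bigr => v' _; rewrite /= kten_mul kten_grade.
Qed.

Definition gcoef i (b : gbasis i.+1) (b' : gbasis i) : R :=
  gd i.+1 (chain_of (basis_vec R b)) (gword b') (gset b').

Lemma gd_chain_of (M : lmodType R) i k (u : {ffun gbasis i.+1 -> M}) : (i < k)%N ->
  gd k (chain_of u) = chain_of [ffun b' => \sum_b gcoef b b' *: u b].
Proof.
move=> ik; rewrite (gdiff_widen _ _ ik); last exact: chain_of_supp.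
rewrite -[LHS](@tens_ofK M i); last first.
  by rewrite (gpr_gdiffk (tD i.+1)) // gpr_chain_of.
congr chain_of; apply/ffunP => b'; rewrite ffunE [RHS]ffunE /chain_of linear_sum fct_sumE sum_ffunE.
apply: eq_bigr => b _; rewrite /gcoef chain_of_basis.
have -> : gbas (gword b) (kdelta (gset b) (u b)) =
    (fun w => kten (u b) (gbas (gword b) (kdelta (gset b) (1 : R^o)) w)).
  apply/funext => w; rewrite /gbas; apply/ffunP => S.
  by rewrite !ffunE; case: ifP; rewrite !ffunE ?scale0r //; case: ifP; rewrite ?scale1r ?scale0r.
by rewrite /= gdiff_ten ffunE.
Qed.

Fact gcoefK i (S : gbasis i.+2) (U : gbasis i) :
  \sum_(T : gbasis i.+1) gcoef S T * gcoef T U = 0.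
Proof.
have := @gdiffK _ _ _ _ _ i.+2 D (tD _) _ (chain_of (basis_vec R S)) i.+2 (leqnn _)
  (chain_of_supp _ (leqnn _)).
rewrite gd_chain_of // gd_chain_of // => /(congr1 (@tens_of R^o i)).
rewrite chain_ofK => /ffunP/(_ U); rewrite !ffunE => e.
rewrite -[RHS]e; apply: eq_bigr => T _; rewrite ffunE (bigD1 S) //= ffunE eqxx.
rewrite big1 ?addr0 => [|S' /negPf nS]; last by rewrite ffunE nS; apply: mulr0.
by transitivity (gcoef T U * (gcoef S T * 1)); first by rewrite mulr1 mulrC.
Qed.

Definition golod_complex : free_complex R := FreeComplex gcoefK.
Local Notation G := golod_complex.

Lemma chain_of_diff (M : lmodType R) i k (u : tens G M i.+1) : (i < k)%N ->
  chain_of (tens_diff u) = gd k (chain_of u).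
Proof. by move=> ik; rewrite gd_chain_of. Qed.

Lemma tens_cycleE (M : lmodType R) i k (u : tens G M i) : (i < k)%N ->
  tens_cycle u <-> Zf D k i (chain_of u).
Proof.
move=> ik; have zf : vanish k (chain_of u) := chain_of_vanish _ ik.
split=> [cu|[_ _ du]].
  split=> //; first exact: gpr_chain_of.
  case: i u ik cu {zf} => [|i] u ik /= cu.
    by rewrite -gpr_chain_of (gdiff_gpr0 _ _ _ (twist_nil (tD 0))).
  by rewrite -chain_of_diff ?cu ?linear0 // ltnW.
case: i u ik du {zf} => [//|i] u ik du /=.
by rewrite -[LHS]chain_ofK (chain_of_diff _ (ltnW ik)) du; apply/ffunP => b; rewrite !ffunE.
Qed.

Lemma tens_boundaryE (M : lmodType R) i k (u : tens G M i) : (i.+1 < k)%N ->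
  tens_boundary u <-> Bf D k i (chain_of u).
Proof.
move=> ik; split=> [[v ->]|[e [ve pe ee]]].
  exists (chain_of v); split; [exact: chain_of_vanish|exact: gpr_chain_of|].
  by rewrite (@chain_of_diff _ _ k) // ltnW.
exists (tens_of i.+1 e); rewrite -[LHS]chain_ofK ee -{1}(tens_ofK pe).
by rewrite -(chain_of_diff (tens_of i.+1 e)) ?chain_ofK // ltnW.
Qed.

(** In degree [i] only words of length at most [i] occur, so that the cycle lies in
[F^i], and it bounds in [F^(i+1)] by [twist_gen]. *)
Lemma golod_exact i (u : tens G R^o i) : gd i (chain_of u) = 0 ->
  (chain_of u [::] set0 : R) \in m -> tens_boundary u.
Proof.
move=> du au; have su := chain_of_supp u (leqnn i).
have [|c [eta [se _ e]]] := twist_gen xgen (tD i.+1) (zeta := chain_of u); first by split.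
apply/(tens_boundaryE (k := i.+2)) => //.
pose Y := \sum_(v <- words L i.+1) gbas v (kone (c v : R^o)) + eta.
have sY : supp i.+1 Y.
  apply: (submodD (supp_submod _)); first exact: supp_top_sum.
  exact: supp_le se.
exists (gpr i.+1 Y); split; [exact: vanish_gpr|exact: gprK|].
rewrite -(gpr_gdiffk (tD i.+2)) // (gdiff_widen _ _ (leqnSn i.+1) sY).
rewrite /Y (linearD (gdiff x D i.+1)) /= gdiff_scalar_top (gdiff_widen _ _ (leqnSn i) se) -e.
by rewrite gpr_chain_of.
Qed.

Lemma card_set0_nil : (#|(set0 : {set 'I_n})| + wdeg (@nil L) == 0)%N.
Proof. by rewrite cards0 wdeg_nil. Qed.

Definition gunit : gbasis 0 := exist _ (set0, Bseq (leqnn 0 : size (@nil L) <= 0)%N) card_set0_nil.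

Definition geps (u : tens G R^o 0) : {ideal_quot m} := (\pi_({ideal_quot m}) (u gunit : R))%qT.

Fact geps_is_zmod_morphism : zmod_morphism geps.
Proof. by move=> u v; rewrite /geps !ffunE; exact: rmorphB. Qed.
HB.instance Definition _ := GRing.isZmodMorphism.Build (tens G R^o 0) {ideal_quot m} geps
  geps_is_zmod_morphism.
Fact geps_is_scalable : scalable_for ((\pi_({ideal_quot m}))%qT \; *%R) geps.
Proof. by move=> c u; rewrite /geps !ffunE; exact: rmorphM. Qed.
HB.instance Definition _ := GRing.isScalable.Build R (tens G R^o 0) {ideal_quot m}
  ((\pi_({ideal_quot m}))%qT \; *%R) geps geps_is_scalable.

Lemma geps_eq0 u : geps u = 0 <-> (u gunit : R) \in m.
Proof.
rewrite -[X in X \in m]subr0 Quotient.idealrBE /geps; split=> [e|/eqP ->].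
  by apply/eqP; rewrite e rmorph0.
exact: rmorph0.
Qed.

Lemma golod_resolution : residue_resolution m G.
Proof.
split=> [i u /(tens_cycleE (k := i.+2))[]//|].
  move=> su _ du; apply: golod_exact.
    rewrite -[LHS](gdiff_widen _ _ (leqnSn i.+1)) //; exact: chain_of_supp.
  by rewrite chain_of_out ?rpred0 // cards0 wdeg_nil.
exists geps; split=> [y|u].
  by exists ([ffun=> (repr y : R^o)] : {ffun gbasis 0 -> R^o}); rewrite /= /geps ffunE reprK.
have e : chain_of u [::] set0 = u gunit by rewrite -[RHS]chain_ofE.
split=> [/geps_eq0 um|/(tens_boundaryE (k := 2) u (leqnn _))[eta [se pe ee]]].
  apply: golod_exact; last by rewrite e.
  by rewrite -gpr_chain_of (gdiff_gpr0 _ _ _ (twist_nil (tD 0))).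
by apply/geps_eq0; rewrite -e ee; apply: (gdiff_aug xgen (tD 2)).
Qed.

Lemma golod_homology (M : lmodType R) i (I : finType) (e : I -> chain M) :
  (forall a, Zf D i.+2 i (e a)) -> spans (Zf D i.+2 i) (Bf D i.+2 i) e ->
  indep m (Bf D i.+2 i) e -> homology_dim m G M i #|I|.
Proof.
move=> eZ sp ind.
have oe a : chain_of (tens_of i (e a)) = e a by apply: tens_ofK; have [] := eZ a.
have sumE (c : I -> R) : chain_of (\sum_a c a *: tens_of i (e a)) = \sum_a c a *: e a.
  by rewrite linear_sum; apply: eq_bigr => a _; rewrite linearZ /= oe.
apply: (subquotient_dimI (e := fun a => tens_of i (e a))).
- move=> a z am /(tens_cycleE z (leqnSn i.+1)) Zz.
  by apply/(tens_boundaryE _ (leqnn i.+2)); rewrite linearZ; apply: Zf_killed.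
- by move=> a; apply/(tens_cycleE _ (leqnSn i.+1)); rewrite oe.
- move=> z /(tens_cycleE z (leqnSn i.+1))/sp[c Bc]; exists c.
  by apply/(tens_boundaryE _ (leqnn i.+2)); rewrite linearB /= sumE.
move=> c /(tens_boundaryE _ (leqnn i.+2)); rewrite sumE; exact: ind.
Qed.

Lemma golod_indep (M : lmodType R) i d (f : 'I_d -> tens G M i) :
  (forall a, tens_cycle (f a)) -> indep m (@tens_boundary R G M i) f ->
  (forall a, Zf D i.+2 i (chain_of (f a))) /\
  indep m (Bf D i.+2 i) (fun a => chain_of (f a)).
Proof.
move=> fZ ind; split=> [a|c Bc]; first exact/tens_cycleE.
apply: ind; apply/(tens_boundaryE _ (leqnn i.+2)); rewrite linear_sum.
by under eq_bigr do rewrite linearZ /=.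
Qed.

End GolodComplex.

(** * Koszul homology and its dimensions *)

Lemma dep_choice (I : Type) (T : I -> Type) (P : forall i, T i -> Prop) :
  (forall i, exists t, P i t) -> exists f : forall i, T i, forall i, P i (f i).
Proof. by move=> h; exists (fun i => sval (cid (h i))) => i; apply: svalP. Qed.

Lemma sum_sigma (V : nmodType) (Q : finType) (T : Q -> finType) (F : {q : Q & T q} -> V) :
  \sum_s F s = \sum_q \sum_(a : T q) F (existT _ q a).
Proof. by rewrite sig_big_dep /=; apply: eq_bigr => [[q a]]. Qed.

Section KoszulBridge.
Variables (R : comNzRingType) (m : idealr R) (mmax : maximal_ideal m).
Variables (n : nat) (x : 'I_n -> R).
Hypothesis xgen : generated_by m x setT.

Section Coefficients.
Variable M : lmodType R.
Local Notation KT i := (tens (koszul x) M i).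

Definition kembed i (u : KT i) : kos n M := \sum_b kdelta (val b) (u b).
Definition krestrict i (a : kos n M) : KT i := [ffun b => a (val b)].

Lemma kembedE i (u : KT i) b : kembed u (val b) = u b.
Proof.
rewrite sum_ffunE (bigD1 b) //= ffunE eqxx big1 ?addr0 // => b' nb.
by rewrite ffunE; case: eqP => // e; case/eqP: nb; apply/val_inj.
Qed.

Lemma kembed_out i (u : KT i) (S : {set 'I_n}) : #|S| != i -> kembed u S = 0.
Proof.
move=> ne; rewrite sum_ffunE big1 // => b _; rewrite ffunE; case: eqP => // e.
by move: ne; rewrite e (eqP (valP b)) eqxx.
Qed.

Fact kembed_is_linear i : linear (@kembed i).
Proof.
move=> c u v; rewrite /kembed scaler_sumr -big_split; apply: eq_bigr => b _ /=.
by apply/ffunP => S; rewrite !ffunE; case: ifP; rewrite // scaler0 addr0.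
Qed.
HB.instance Definition _ i := GRing.isLinear.Build R (KT i) (kos n M) *:%R (@kembed i)
  (@kembed_is_linear i).

Lemma kembedK i (u : KT i) : krestrict i (kembed u) = u.
Proof. by apply/ffunP => b; rewrite ffunE kembedE. Qed.

Lemma krestrictK i (a : kos n M) : kembed (krestrict i a) = kpr i a.
Proof.
apply/ffunP => S; rewrite [RHS]ffunE; case: eqP => [e|/eqP ne]; last exact: kembed_out.
have eS : #|S| == i by apply/eqP.
by rewrite -[S]/(val (exist (fun S : {set 'I_n} => #|S| == i) S eS : koszul_basis n i)) kembedE ffunE.
Qed.

Lemma kpr_embed i (u : KT i) : kpr i (kembed u) = kembed u.
Proof. by rewrite -krestrictK kembedK. Qed.

Lemma kembed_diff i (u : KT i.+1) : kembed (tens_diff u) = kdiff x (kembed u).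
Proof.
rewrite -[in RHS]kpr_embed -kpr_diff -krestrictK; congr kembed; apply/ffunP => T.
rewrite !ffunE [RHS](bigID (fun S : {set 'I_n} => #|S| == i.+1)) /=.
rewrite [X in _ = _ + X]big1 ?addr0 => [|S nS]; last by rewrite kembed_out ?scaler0.
rewrite (big_sub [pred S : {set 'I_n} | #|S| == i.+1]
  (fun S => koszul_coef x S (val T) *: kembed u S)).
by apply: eq_bigr => S _; rewrite kembedE.
Qed.

Lemma kcycleE i (u : KT i) : tens_cycle u <-> kdiff x (kembed u) = 0.
Proof.
case: i u => [|i] u /=.
  by split=> // _; rewrite -kpr_embed kdiff_kpr0.
split=> [cu|du]; first by rewrite -kembed_diff cu linear0.
by rewrite -[LHS]kembedK kembed_diff du; apply/ffunP => b; rewrite !ffunE.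
Qed.

Lemma kboundaryE i (u : KT i) : tens_boundary u <-> exists theta, kembed u = kdiff x theta.
Proof.
split=> [[v ->]|[th e]]; first by exists (kembed v); rewrite kembed_diff.
exists (krestrict i.+1 th); rewrite -[LHS]kembedK -[RHS]kembedK kembed_diff krestrictK.
by congr krestrict; rewrite -kpr_diff -e kpr_embed.
Qed.

Lemma koszul_killed i : killed m (@tens_cycle R (koszul x) M i) (@tens_boundary R (koszul x) M i).
Proof.
move=> a u am /kcycleE du; apply/kboundaryE; rewrite linearZ /=.
by have [th ->] := kill_kdiff xgen am du; exists th.
Qed.

(** Bases of the homology in the degrees [deg q]. All degrees are taken for the
homology of [M]; for the letters, the class of 1 in degree 0 is left out. *)
Section Bases.
Variables (Q : finType) (deg : Q -> nat) (deg_inj : injective deg).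
Variable k : nat -> nat.
Hypothesis hk : forall i, homology_dim m (koszul x) M i (k i).

Lemma koszul_bases : exists e : forall q : Q, 'I_(k (deg q)) -> kos n M,
  [/\ forall q a, kpr (deg q) (e q a) = e q a,
   forall q a, kdiff x (e q a) = 0,
   forall z : kos n M, kdiff x z = 0 -> z = \sum_q kpr (deg q) z ->
     exists (c : {q : Q & 'I_(k (deg q))} -> R) theta,
     z = \sum_s c s *: e (tag s) (tagged s) + kdiff x theta &
   forall (c : {q : Q & 'I_(k (deg q))} -> R) z theta,
     (forall q, kpr (deg q) z = 0) ->
     z + \sum_s c s *: e (tag s) (tagged s) = kdiff x theta -> forall s, c s \in m].
Proof.
have /(dep_choice)[e0 e0P] : forall q : Q, exists e : 'I_(k (deg q)) -> KT (deg q),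
  [/\ forall i, tens_cycle (e i),
        forall z : KT (deg q), tens_cycle z ->
          exists c : 'I_(k (deg q)) -> R, tens_boundary (z - \sum_i c i *: e i)
      & forall c : 'I_(k (deg q)) -> R, tens_boundary (\sum_i c i *: e i) -> forall i, c i \in m].
  by move=> q; have [_ h] := hk (deg q).
have sumE (c : {q : Q & 'I_(k (deg q))} -> R) q :
   kpr (deg q) (\sum_s c s *: kembed (e0 (tag s) (tagged s))) =
   \sum_(a : 'I_(k (deg q))) c (existT _ q a) *: kembed (e0 q a).
  rewrite sum_sigma /=.
  rewrite (bigD1 q) //= linearD [X in _ + X]linear_sum [X in _ + X]big1 ?addr0 => [|q' nq] /=.
    rewrite linear_sum; apply: eq_bigr => a _; rewrite linearZ /= kpr_embed //.
  rewrite linear_sum big1 // => a _; rewrite linearZ /= -kpr_embed kpr_neq ?scaler0 //.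
  by rewrite (inj_eq deg_inj) eq_sym.
exists (fun q a => kembed (e0 q a)); split=> [q a|q a|z dz zE|c z th z0 ce [q a]].
- exact: kpr_embed.
- by apply/kcycleE; have [h _ _] := e0P q.
- have /(dep_choice)[c cP] : forall q, exists c : 'I_(k (deg q)) -> R, exists th,
      kpr (deg q) z - \sum_a c a *: kembed (e0 q a) = kdiff x th.
    move=> q; have [_ sp _] := e0P q; have [|c /kboundaryE[th e]] := sp (krestrict (deg q) z).
      apply/kcycleE; rewrite krestrictK; case: (deg q) => [|d]; first exact: kdiff_kpr0.
      by rewrite -kpr_diff dz linear0.
    exists c, th; rewrite -e linearB /= krestrictK (linear_sum (@kembed (deg q))); congr (_ - _).
    by apply: eq_bigr => a _; rewrite linearZ.
  have /choice[th thP] := cP.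
  exists (fun s => c (tag s) (tagged s)), (\sum_q th q).
  rewrite sum_sigma /=.
  rewrite [LHS]zE linear_sum -big_split; apply: eq_bigr => q _ /=.
  by rewrite -thP addrC subrK.
have [_ _ ind] := e0P q.
apply: (ind (fun a => c (existT _ q a))); apply/kboundaryE.
exists (kpr (deg q).+1 th); rewrite -kpr_diff -ce linearD /= z0 add0r sumE linear_sum.
by apply: eq_bigr => b _; rewrite linearZ.
Qed.

End Bases.

Lemma homology_dim_big k i : homology_dim m (koszul x) M i k -> (n < i)%N -> k = 0%N.
Proof.
move=> [_ [e [_ _ ind]]] ni; case: k e ind => // k e ind.
suff : 1 \in m by rewrite idealr1.
apply: (ind (fun=> 1) _ ord0); exists 0; apply/ffunP => [[S cS]].
have := max_card S; rewrite card_ord leqNgt => /negP[].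
by rewrite (eqP cS).
Qed.

Lemma koszul_basis_exists (k : nat -> nat) :
  (forall i, homology_dim m (koszul x) M i (k i)) ->
  exists B : koszul_basis_of m x M, forall (F : nat -> nat),
    (\sum_(b : btype B) F (bdeg b) = \sum_(q < n.+1) k q * F q)%N.
Proof.
move=> hk; have [e [epr ecyc egen eind]] := koszul_bases (@ord_inj n.+1) hk.
have gen (z : kos n M) : kdiff x z = 0 -> exists (c : {q : 'I_n.+1 & 'I_(k q)} -> R) th,
    z = \sum_s c s *: e (tag s) (tagged s) + kdiff x th.
  by move=> dz; apply: egen => //; apply: kpr_sum.
have ind (c : {q : 'I_n.+1 & 'I_(k q)} -> R) th :
    \sum_s c s *: e (tag s) (tagged s) = kdiff x th -> forall s, c s \in m.
  by move=> ce; apply: (eind c 0 th) => [q|]; rewrite ?linear0 ?add0r.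
exists (KoszulBasisOf (fun s => epr (tag s) (tagged s)) (fun s => ecyc (tag s) (tagged s)) gen ind).
move=> F /=.
rewrite (@sum_sigma nat) /=.
by apply: eq_bigr => q _; rewrite sum_nat_const card_ord.
Qed.

End Coefficients.

Lemma letters_exist (k : nat -> nat) :
  (forall i, homology_dim m (koszul x) R^o i (k i)) ->
  exists H : letters m x, forall (F : nat -> nat),
    (\sum_(h : ltype H) F (ldeg h) = \sum_(q < n) k q.+1 * F q.+1)%N.
Proof.
move=> hk; have sinj : injective (fun q : 'I_n => q.+1) by move=> q q' [] /val_inj.
have [e [epr ecyc egen eind]] := koszul_bases sinj hk.
have gen (a : kos n R^o) : kdiff x a = 0 -> exists (r : R^o) (c : {q : 'I_n & 'I_(k q.+1)} -> R) th,
    a = kone r + \sum_s c s *: e (tag s) (tagged s) + kdiff x th.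
  move=> da; have aE : a - kpr 0 a = \sum_(q < n) kpr q.+1 a.
    by rewrite {1}[a]kpr_sum big_ord_recl addrC addKr.
  have [||c [th ath]] := egen (a - kpr 0 a).
  - by rewrite linearB /= da kdiff_kpr0 subr0.
  - rewrite {1}aE; apply: eq_bigr => q _.
    by rewrite linearB /= kpr_neq // subr0.
  by exists (a set0), c, th; rewrite -kpr0 -addrA -ath addrC subrK.
have ind (r : R^o) (c : {q : 'I_n & 'I_(k q.+1)} -> R) th :
    kone r + \sum_s c s *: e (tag s) (tagged s) = kdiff x th -> forall s, c s \in m.
  by move=> ce; apply: (eind c (kone r) th) => // q; rewrite kpr_one.
exists (Letters (fun s : {q : 'I_n & 'I_(k q.+1)} => ltn0Sn (tag s)) (fun s => epr (tag s) (tagged s))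
  (fun s => ecyc (tag s) (tagged s)) gen ind).
move=> F /=.
rewrite (@sum_sigma nat) /=.
by apply: eq_bigr => q _; rewrite sum_nat_const card_ord.
Qed.

(** Scalars are Koszul cycles, and they bound when they lie in [m]. *)
Lemma homology_dim0 k : homology_dim m (koszul x) R^o 0 k -> k = 1%N.
Proof.
move=> hk; apply: (subquotient_dim_uniq mmax (tens_boundary_submod _ _ _) hk).
pose u1 : tens (koszul x) R^o 0 := krestrict 0 (kone (1 : R^o)).
have u1E (c : R) : kembed (c *: u1) = kone (c : R^o).
  rewrite linearZ /= krestrictK kpr_one -linearZ; congr kone; exact: mulr1.
have kb (u : tens (koszul x) R^o 0) : kembed u = kone (kembed u set0) by rewrite -kpr0 kpr_embed.
split; first exact: koszul_killed.
exists (fun=> u1); split=> [//|z _|c].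
  exists (fun=> kembed z set0); rewrite big_ord1; apply/kboundaryE; exists 0.
  by rewrite linearB /= u1E -kb subrr linear0.
rewrite big_ord1 => /kboundaryE[th e] i; rewrite ord1.
by have := kdiff_aug xgen th; rewrite -e u1E ffunE eqxx.
Qed.

End KoszulBridge.

(** * The numerical criterion *)

Section Series.

(** The coefficients of [kM / (1 - t (kR - 1))]: the 1 subtracted from [kR]
cancels [kR 0], and no subtraction of natural numbers is left. *)
Definition golod_recursion (P kR kM : nat -> nat) := forall i,
  P i = (kM i + \sum_(s < i) (if val s == 0 then 0 else kR s * P (i - s.+1)))%N.

Lemma golod_recursion_uniq P P' kR kM :
  golod_recursion P kR kM -> golod_recursion P' kR kM -> P =1 P'.
Proof.
move=> rP rP' i; elim: i {-2}i (leqnn i) => [|d IH] i id; rewrite rP rP'.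
  by move: id; rewrite leqn0 => /eqP ->; rewrite !big_ord0.
congr (_ + _)%N; apply: eq_bigr => s _; case: ifP => // _; congr (_ * _)%N; apply: IH.
by rewrite -ltnS (leq_trans _ id) // ltn_subrL (leq_trans _ (ltn_ord s)).
Qed.

Lemma golod_seriesE P kR kM : kR 0%N = 1%N ->
  series_mul (series_nat P) (series_sub series_one
    (series_mulX (series_sub (series_nat kR) series_one))) =1 series_nat kM <->
  golod_recursion P kR kM.
Proof.
move=> k0; pose g := series_sub series_one
    (series_mulX (series_sub (series_nat kR) series_one)).
have mulE i : series_mul (series_nat P) g i =
   (P i)%:Z - (\sum_(s < i) (if val s == 0 then 0 else kR s * P (i - s.+1)))%N%:Z.
  rewrite /series_mul big_ord_recr /= subnn addrC; congr (_ + _).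
    by rewrite /g /series_sub /series_one /series_mulX /series_nat eqxx subr0 mulr1.
  rewrite [X in - X%:Z](reindex_inj rev_ord_inj) /= -[LHS]opprK; congr (- _).
  rewrite -sumrN (big_morph _ PoszD (erefl : Posz 0 = 0)).
  apply: eq_bigr => a _; have ai := ltn_ord a.
  rewrite /g /series_sub /series_one /series_mulX /series_nat.
  rewrite (_ : i - a = (i - a.+1).+1)%N; last by rewrite -subSn.
  rewrite /= sub0r mulrN opprK (_ : i - (i - a.+1).+1 = a)%N; last first.
    by rewrite -subSn // subSS subKn // ltnW.
  case: eqP => [e|/eqP ne]; last by rewrite subr0 PoszM mulrC.
  by rewrite e k0 subrr mulr0.
split=> [h i|h i].
  have := h i; rewrite mulE /series_nat => /eqP; rewrite subr_eq -PoszD => /eqP[].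
  exact.
by rewrite mulE /series_nat h PoszD addrK.
Qed.

Lemma sum_ord_trunc b b' (G : nat -> nat) : (b <= b')%N ->
  (forall s, (b <= s)%N -> G s = 0%N) -> (\sum_(s < b') G s = \sum_(s < b) G s)%N.
Proof.
move=> /subnK <- G0; elim: (b' - b)%N => [//|d IH].
by rewrite addSn big_ord_recr /= IH G0 ?addn0 // leq_addl.
Qed.

End Series.

Section TotalRecursion.
Variables (R : comNzRingType) (m : idealr R) (n : nat) (x : 'I_n -> R).
Variables (H : letters m x) (M : lmodType R) (B : koszul_basis_of m x M).
Variables kR kM : nat -> nat.
Hypothesis kR_big : forall i, (n < i)%N -> kR i = 0%N.
Hypothesis kM_big : forall i, (n < i)%N -> kM i = 0%N.
Hypothesis sumH : forall F : nat -> nat,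
    (\sum_(h : ltype H) F (ldeg h) = \sum_(q < n) kR q.+1 * F q.+1)%N.
Hypothesis sumB : forall F : nat -> nat,
    (\sum_(b : btype B) F (bdeg b) = \sum_(q < n.+1) kM q * F q)%N.

Lemma rank_big l i : (i < l)%N -> rank H B l i = 0%N.
Proof.
move=> il; rewrite /rank big_seq big1 // => v; rewrite mem_words => /eqP sv.
rewrite big1 // => b _; rewrite gtn_eqF // (leq_trans il) // -sv.
exact: leq_trans (size_wdeg (@ldeg _ _ _ _ H) v) (leq_addr _ _).
Qed.

Lemma rank0 i : rank H B 0 i = kM i.
Proof.
rewrite /rank (_ : words _ 0 = [:: [::]]) // big_seq1 wdeg_nil.
rewrite (sumB (fun q => (0 + q == i)%N)) /=.
case: (leqP i n) => ni.
  rewrite (bigD1 (Ordinal (ni : (i < n.+1)%N))) //= add0n eqxx muln1 big1 ?addn0 // => q nq.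
  by rewrite add0n; case: eqP => [e|]; rewrite ?muln0 //; case/eqP: nq; apply: val_inj.
rewrite kM_big // big1 // => q _; rewrite add0n ltn_eqF ?muln0 //.
exact: leq_trans (ltn_ord q) ni.
Qed.

Lemma rankS l i : rank H B l.+1 i =
  (\sum_(h : ltype H) (if ldeg h < i then rank H B l (i - (ldeg h).+1) else 0))%N.
Proof.
rewrite /rank (@big_words _ nat); apply: eq_bigr => h _; case: ltnP => hi.
  apply: eq_bigr => v _; apply: eq_bigr => b _; rewrite wdeg_cons -addnA.
  by rewrite -{1}(subnKC hi) eqn_add2l.
rewrite big1 // => v _; rewrite big1 // => b _; rewrite wdeg_cons -addnA gtn_eqF //.
by rewrite addSn ltnS (leq_trans hi) // leq_addr.
Qed.

(** A nonempty word is a letter [h] followed by a word, and the letter shifts the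
degree by [ldeg h + 1]. *)
Lemma total_recursion : golod_recursion (fun i => total H B i.+2 i) kR kM.
Proof.
move=> i; rewrite {1}/total big_ord_recl rank0; congr (_ + _)%N.
under eq_bigr => l _ do rewrite lift0 rankS.
rewrite exchange_big /=.
pose F q := (if q < i then total H B (i - q.+1).+2 (i - q.+1) else 0)%N.
have -> : (\sum_(h : ltype H) \sum_(l < i.+1)
     (if ldeg h < i then rank H B l (i - (ldeg h).+1) else 0) = \sum_(h : ltype H) F (ldeg h))%N.
  apply: eq_bigr => h _; rewrite /F; case: ltnP => hi; last by rewrite big1.
  have le : ((i - (ldeg h).+1).+2 <= i.+1)%N.
    by rewrite ltnS ltn_subrL /= (leq_ltn_trans _ hi).
  rewrite /total (sum_ord_trunc (G := fun l => rank H B l (i - (ldeg h).+1)) le) //.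
  by move=> l hl; apply: rank_big; apply: leq_trans hl.
rewrite sumH; pose G s := (if s == 0 then 0 else kR s * F s)%N.
transitivity (\sum_(s < n.+1) G s)%N.
  by rewrite big_ord_recl /G /= add0n.
transitivity (\sum_(s < n.+1 + i) G s)%N.
  rewrite (sum_ord_trunc (leq_addr _ _)) // => s hs.
  by rewrite /G; case: eqP => // _; rewrite kR_big.
rewrite (sum_ord_trunc (leq_addl _ _)) => [|s hs].
  by apply: eq_bigr => s _; rewrite /G /F ltn_ord.
by rewrite /G /F ltnNge hs /= muln0; case: eqP.
Qed.

End TotalRecursion.

Section Criterion.
Variables (R : comNzRingType) (m : idealr R) (mmax : maximal_ideal m).
Variables (n : nat) (x : 'I_n -> R) (M : lmodType R) (P kR kM : nat -> nat).
Hypothesis xgen : generated_by m x setT.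
Hypothesis hR : forall i, homology_dim m (koszul x) R^o i (kR i).
Hypothesis hM : forall i, homology_dim m (koszul x) M i (kM i).
Variable H : letters m x.
Variable D : seq (ltype H) -> seq (ltype H) -> kos n R^o.
Hypothesis tD : forall k, twist k D.
Hypothesis sumH : forall F : nat -> nat,
  (\sum_(h : ltype H) F (ldeg h) = \sum_(q < n) kR q.+1 * F q.+1)%N.

Local Notation golod_equality P := (series_mul (series_nat P) (series_sub series_one
  (series_mulX (series_sub (series_nat kR) series_one))) =1 series_nat kM).

Let kR0 : kR 0%N = 1%N := homology_dim0 mmax xgen (hR 0).
Let kR_big i : (n < i)%N -> kR i = 0%N := homology_dim_big (hR i).
Let kM_big i : (n < i)%N -> kM i = 0%N := homology_dim_big (hM i).

(** In degree [i], the dimension of the homology of [F (x) M] is at most the sum of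
the ranks of the layers, which is the coefficient of the Golod bound. By
hypothesis and [tor_indep] it is at least that coefficient, so that
[count_layers] lifts the cycles of the layers. *)
Lemma lifting_of_golod : poincare_series m M P -> golod_equality P -> lifting D M.
Proof.
move=> [F resF hF] /(golod_seriesE _ _ kR0) recP.
have [B sumB] := koszul_basis_exists hM.
have PE : P =1 fun i => total H B i.+2 i.
  exact: golod_recursion_uniq recP (total_recursion kR_big kM_big sumH sumB).
apply: (layers_lift tD) => k i y Zy.
(* Words of length at least [i + 2] have no elements of degree [i]. *)
case: (leqP i.+2 k) => ki.
  exists 0; first exact: (submod0 (Zf_submod _ _ _ _)).
  rewrite linear0 subr0; have [ly py _] := Zy.
  suff -> : y = 0 by apply: (submod0 (Bg_submod _ _ _ _)).
  apply/funext => w; case: (size w =P k) => [sw|/eqP/ly //].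
  rewrite -py /gpr leqNgt (leq_trans _ (size_wdeg (@ldeg _ _ _ _ H) w)) //.
  by rewrite sw (leq_trans _ ki).
have [I [e [sp le eZ full]]] := count_layers mmax xgen B tD i.+2 i.
suff cI : #|I| = total H B i.+2 i by exact: full cI k y ki Zy.
apply/eqP; rewrite eqn_leq le -PE /=.
have [_ [f [fZ _ find]]] := hF i.
have [g [gZ gind]] := tor_indep resF (golod_resolution xgen tD) fZ find.
have [cZ cind] := golod_indep gZ gind.
rewrite -[X in (X <= _)%N]card_ord.
apply: (exchange mmax (Bf_submod _ _ _ _) _ _ cind) => [a b am|a]; last exact/sp/cZ.
by apply: (Zf_killed xgen).
Qed.

Lemma golod_of_lifting : lifting D M ->
  exists2 P, poincare_series m M P & golod_equality P.
Proof.
move=> lift; have [B sumB] := koszul_basis_exists hM.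
exists (fun i => total H B i.+2 i); last first.
  by apply/golod_seriesE => //; apply: total_recursion kR_big kM_big sumH sumB.
exists (golod_complex tD); first exact: golod_resolution.
move=> i; have [I [e [<- eZ sp ind]]] := lifting_basis xgen B tD lift i.+2 i.
exact: golod_homology.
Qed.

End Criterion.

(** * Generators of the maximal ideals *)

(** By Zorn's lemma, an ideal containing [a] and avoiding 1 is contained in a maximal
ideal, which has to be [m]. *)
Lemma local_unit (R : comNzRingType) (m : idealr R) a :
  noetherian_local m -> a \notin m -> exists b, b * a = 1.
Proof.
move=> [_ _ local] am; apply: contrapT => nu.
(* With [forall b, S b -> S a] instead of [S a], the empty set is allowed: it is the
   union of the empty chain. *)
pose proper S := [/\ ~ S 1, forall c u v, S u -> S v -> S (c * u + v) & forall b, S b -> S a].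
have prop_a : proper (fun b => exists c, b = c * a).
  split=> [[c e]|c _ _ [d ->] [e ->]|b _]; first by apply: nu; exists c.
    by exists (c * d + e); rewrite mulrDl mulrA.
  by exists 1; rewrite mul1r.
have [F Fprop Ftot|S [[S1 SD Sa] Smax]] := @classical_sets.Zorn_bigcup R proper.
  split=> [[I FI I1]|c u v [I FI Iu] [I' FI' I'v]|b [I FI Ib]].
  - by have [] := Fprop I FI.
  - have [_ ID _] := Fprop I FI; have [_ ID' _] := Fprop I' FI'.
    by have [s|s] := Ftot I I' FI FI'; [exists I'|exists I] => //; [apply/ID'|apply/ID] => //; apply: s.
  by exists I => //; have [_ _ Ia] := Fprop I FI; apply: Ia Ib.
have aS : S a.
  apply: contrapT => nS; apply: (Smax _ _ prop_a); split=> [b /Sa //|sub].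
  by apply/nS/sub; exists 1; rewrite mul1r.
have [|J HJ] := idealr_of _ SD S1; first by rewrite -(addNr a) -mulN1r; apply: SD.
suff : maximal_ideal J by move/local/(_ a); rewrite (negPf am) => e; have := HJ a; rewrite e; case=> _ /(_ aS).
move=> J' JJ' b bJ'; apply: contrapT => nJ; apply: (Smax (fun c => c \in J')); last first.
  split=> [|c u v uJ vJ|c _]; first by rewrite idealr1.
    by rewrite rpredD // idealMr.
  by apply/JJ'/HJ.
by split=> [c /HJ /JJ' //|sub]; apply/nJ/HJ/sub.
Qed.

(** A generating family of least cardinality. *)
Lemma minimal_generators_exist (R : comNzRingType) (m : idealr R) n (x : 'I_n -> R) :
  generated_by m x setT -> exists r (y : 'I_r -> R), minimal_generators m y.
Proof.
move=> xgen; pose gens k := `[< exists y : 'I_k -> R, generated_by m y setT >].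
have ex : exists k, gens k by exists n; apply/asboolP; exists x.
case: (ex_minnP ex) => r /asboolP[y ygen] rmin; exists r, y; split=> // J Jgen.
apply/eqP; rewrite eqEcard subsetT cardsT card_ord; apply: rmin; apply/asboolP.
exists (fun k : 'I_#|J| => y (enum_val k)) => a; split=> [/Jgen[c ->]|[c ->]].
  exists (fun k => c (enum_val k)).
  rewrite big_enum_val; apply: eq_bigl => k; by rewrite finset.in_setT.
by apply: rpred_sum => k _; apply/idealMr/(xm ygen).
Qed.

Section Retract.
Variables (R A : comNzRingType) (mR : idealr R) (mA : idealr A).
Hypothesis hR : noetherian_local mR.
Variables (j : {rmorphism R -> A}) (p : {rmorphism A -> R}).
Hypotheses (hj : local_hom mR mA j) (hp : local_hom mA mR p).
Hypothesis hpj : forall r, p (j r) = r.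
Variables (n : nat) (y : 'I_n -> A).
Hypothesis ygen : generated_by mA y setT.

Lemma retract_generators : generated_by mR (fun l => p (y l)) setT.
Proof.
move=> a; split=> [am|[c ->]]; last first.
  by apply: rpred_sum => l _; apply/idealMr/hp/(xm ygen).
have /ygen[c jc] := hj am; exists (fun l => p (c l)).
by rewrite -[LHS]hpj jc rmorph_sum; apply: eq_bigr => l _; rewrite rmorphM.
Qed.

(** The coefficients expressing the generators [x i] through the [p (y l)] can be
chosen so that the composite of the two maps of Koszul complexes is the identity:
the matrix [G] of the composite fixes the vector [x], hence is the identity modulo
the maximal ideal by minimality, and it can be inverted. *)
Lemma retract_matrices r (x : 'I_r -> R) : minimal_generators mR x ->
  exists (C : 'I_r -> 'I_n -> A) (C' : 'I_n -> 'I_r -> R),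
  [/\ forall i, j (x i) = \sum_l C i l * y l,
      forall l, p (y l) = \sum_i C' l i * x i &
      forall i k, \sum_l p (C i l) * C' l k = (i == k)%:R].
Proof.
move=> [xgen xmin]; have [_ mmax _] := hR.
have /choice[C0 C0P] : forall i, exists c : 'I_n -> A, j (x i) = \sum_l c l * y l.
  by move=> i; apply/(mgen ygen)/hj/(xm xgen).
have /choice[C' C'P] : forall l, exists c : 'I_r -> R, p (y l) = \sum_i c i * x i.
  by move=> l; apply/(mgen xgen)/hp/(xm ygen).
pose G : 'M[R]_r := \matrix_(i, k) \sum_l p (C0 i l) * C' l k.
pose X : 'cV[R]_r := \col_i x i.
have GX : G *m X = X.
  apply/colP => i; rewrite !mxE; under eq_bigr do rewrite !mxE mulr_suml.
  rewrite exchange_big -[RHS]hpj C0P rmorph_sum; apply: eq_bigr => l _ /=.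
  rewrite rmorphM C'P mulr_sumr; apply: eq_bigr => k _; by rewrite mulrA.
(* If this entry were a unit, row [i] of [(G - 1) X = 0] would express [x k] through
   the other generators. *)
have G1 i k : (G - 1%:M) i k \in mR.
  apply: contrapT => /negP /(local_unit hR)[b bg].
  suff /setP/(_ k) : [set~ k] = setT :> {set 'I_r} by rewrite !inE eqxx.
  apply: xmin => a; split=> [/(mgen xgen)[c ->]|[c ->]]; last first.
    by apply: rpred_sum => l _; apply/idealMr/(xm xgen).
  have rel : \sum_l (G - 1%:M) i l * x l = 0.
    have /colP/(_ i) : (G - 1%:M) *m X = 0 by rewrite mulmxBl GX mul1mx subrr.
    by rewrite !mxE; apply: etrans; apply: eq_bigr => l _; rewrite !mxE.
  exists (fun l => c l - c k * b * (G - 1%:M) i l).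
  transitivity (\sum_l (c l - c k * b * (G - 1%:M) i l) * x l).
    under [RHS]eq_bigr do rewrite mulrBl -!mulrA.
    rewrite sumrB; under [X in _ - X]eq_bigr do rewrite mulrA.
    by rewrite -mulr_sumr rel mulr0 subr0.
  rewrite (bigD1 k) //= -mulrA bg mulr1 subrr mul0r add0r.
  by apply: eq_bigl => l; rewrite !inE.
have [K [phi [_ ker]]] := residue_field mmax.
have phiG : map_mx phi G = 1%:M.
  apply/matrixP => i k; have e : phi (G i k - (1%:M : 'M[R]_r) i k) = 0.
    by apply/ker; have := G1 i k; rewrite mxE [X in _ + X]mxE.
  rewrite [LHS]mxE -[G i k](subrK ((1%:M : 'M[R]_r) i k)) rmorphD e add0r.
  by rewrite !mxE rmorph_nat.
have [b bdet] : exists b, b * \det G = 1.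
  apply: (local_unit hR); apply/negP => /ker e.
  have := det_map_mx phi G; rewrite phiG det1 e => /eqP; by rewrite oner_eq0.
pose W := b *: \adj G.
have WG : W *m G = 1%:M.
  by rewrite /W -scalemxAl mul_adj_mx scale_scalar_mx bdet.
have WX : W *m X = X by rewrite -{1}GX mulmxA WG mul1mx.
exists (fun i l => \sum_k j (W i k) * C0 k l), C'; split=> // [i|i k].
  have /colP/(_ i) := WX; rewrite !mxE => <-; rewrite rmorph_sum.
  under [RHS]eq_bigr do rewrite mulr_suml.
  rewrite exchange_big; apply: eq_bigr => k _ /=; rewrite !mxE rmorphM C0P mulr_sumr.
  by apply: eq_bigr => l _; rewrite mulrA.
have /matrixP/(_ i k) := WG; rewrite mxE [RHS]mxE => <-.
under eq_bigr do rewrite rmorph_sum mulr_suml.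
rewrite exchange_big; apply: eq_bigr => s _ /=; rewrite [G s k]mxE mulr_sumr.
by apply: eq_bigr => l _; rewrite rmorphM hpj mulrA.
Qed.

(** The base change from [N] to [M] has a section, so that the Koszul homology of [M]
is a quotient of that of [N], hence finite dimensional. *)
Lemma retract_homology r (x : 'I_r -> R) (C : 'I_r -> 'I_n -> A) (C' : 'I_n -> 'I_r -> R)
    (N : lmodType A) (M : lmodType R) (f : {additive N -> M}) (g : {additive M -> N}) i k :
  generated_by mR x setT ->
  (forall i, j (x i) = \sum_l C i l * y l) ->
  (forall l, p (y l) = \sum_i C' l i * x i) ->
  (forall i k, \sum_l p (C i l) * C' l k = (i == k)%:R) ->
  (forall c v, f (c *: v) = p c *: f v) -> (forall c v, g (c *: v) = j c *: g v) ->
  cancel g f ->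
  homology_dim mA (koszul y) N i k -> exists k', homology_dim mR (koszul x) M i k'.
Proof.
move=> xgen jx py CC' fZ gZ gK [_ [e [eZ sp _]]]; have [_ mmax _] := hR.
have fgK : cancel (kmap C g) (kmap C' f) := kmap_comp_id fZ gK CC'.
apply: (subquotient_dim_spans mmax (tens_boundary_submod _ _ _)
  (@koszul_killed _ _ _ _ xgen M i)
  (e := fun a => krestrict x i (kmap C' f (kembed (e a))))) => [a|u /kcycleE du].
  apply/kcycleE; rewrite krestrictK kpr_kmap kpr_embed -(kmap_diff fZ _ py).
  by have /kcycleE -> := eZ a; rewrite raddf0.
pose z := kmap C g (kembed u).
have dz : kdiff y z = 0 by rewrite -(kmap_diff gZ _ jx) du raddf0.
have pz : kpr i z = z by rewrite kpr_kmap kpr_embed.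
have [|c /kboundaryE[th the]] := sp (krestrict y i z).
  by apply/kcycleE; rewrite krestrictK pz.
exists (fun a => p (c a)); apply/kboundaryE; exists (kmap C' f th).
rewrite -(kmap_diff fZ _ py) -the !linearB /= krestrictK pz raddfB /= fgK; congr (_ - _).
rewrite !linear_sum raddf_sum; apply: eq_bigr => a _ /=.
by rewrite !linearZ /= (kmapZ _ fZ) krestrictK kpr_kmap kpr_embed.
Qed.

End Retract.

Theorem theorem1p1 (R A : comNzRingType) (mR : idealr R) (mA : idealr A)
  (hR : noetherian_local mR) (hA : noetherian_local mA)
  (j : {rmorphism R -> A}) (p : {rmorphism A -> R})
  (hj : local_hom mR mA j) (hp : local_hom mA mR p)
  (hpj : forall r : R, p (j r) = r)
  (M : lmodType R) (hM0 : exists v : M, v != 0) (hMfg : fin_gen M)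
  (hG : golod_module mA (restrict_scalars M p)) :
  golod_module mR M.
Proof.
have [_ maxR _] := hR; have [_ maxA _] := hA.
have [n [y [P [kA [kN [[ygen _] hP hkA hkN eqA]]]]]] := hG.
pose N := restrict_scalars M p.
have [r [x xmin]] := minimal_generators_exist (retract_generators hj hp hpj ygen).
have [C [C' [jx py CC']]] := retract_matrices hR hj hp hpj ygen xmin.
have [xgen _] := xmin.
pose f : {additive N -> M} := idfun; pose g : {additive M -> N} := idfun.
have fZ c v : f (c *: v) = p c *: f v by [].
have gZ c v : g (c *: v) = j c *: g v by rewrite /g /= -[RHS]/(p (j c) *: v) hpj.
have /choice[kR hkR] : forall i, exists k, homology_dim mR (koszul x) R^o i k.
  move=> i; apply: (retract_homology hR xgen jx py CC' (reg_morphZ p) (reg_morphZ j) _ (hkA i)).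
  exact: hpj.
have /choice[kM hkM] : forall i, exists k, homology_dim mR (koszul x) M i k.
  by move=> i; apply: (retract_homology hR xgen jx py CC' fZ gZ _ (hkN i)).
have [HA sumA] := letters_exist hkA.
have [HR sumR] := letters_exist hkR.
have [DA tA] := twist_exists ygen HA.
have [DR tR] := twist_exists xgen HR.
have liftA : lifting DA N := lifting_of_golod maxA ygen hkA hkN tA sumA hP eqA.
have boundR := bounding_descent hj hp hpj xgen ygen jx py CC' tR tA (bounding_of_lifting liftA).
have [PR hPR eqR] := golod_of_lifting maxR xgen hkR hkM tR sumR (lifting_of_bounding tR boundR).
by exists r, x, PR, kR, kM.
Qed.
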